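(* For $n\in\mathbb{N}$ let $M_n$ be the random symmetric $n\times n$ matrix whose entries on and above the diagonal are independent Rademacher random variables. Then asymptotically almost surely $|\operatorname{per} M_n| = n^{n/2+o(n)}$; that is, for every $\varepsilon>0$, $$\lim_{n\to\infty}\Pr\left(n^{n/2-\varepsilon n}\le |\operatorname{per} M_n|\le n^{n/2+\varepsilon n}\right)=1.$$
   Context: A Rademacher random variable takes the values $+1$ and $-1$ with probability $1/2$ each. The entries of $M_n$ below the diagonal are determined by symmetry. The permanent of an $n\times n$ matrix $M=(x_{i,j})$ is $\operatorname{per}(M)=\sum_{\pi\in S_n}\prod_{i=1}^n x_{i,\pi(i)}$. *)

(* Defs.v *)
From HB Require Import structures.
From mathcomp Require Import all_boot all_order all_algebra all_fingroup.
From mathcomp Require Import all_classical all_reals all_analysis.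

Set Implicit Arguments.
Unset Strict Implicit.
Unset Printing Implicit Defensive.

Import Order.TTheory GRing.Theory Num.Theory.
Import numFieldNormedType.Exports.

Local Open Scope classical_set_scope.
Local Open Scope ring_scope.

Definition permanent (R : comNzRingType) (n : nat) (A : 'M[R]_n) : R :=
  \sum_(s : 'S_n) \prod_(i < n) A i (s i).

Section RandomMatrix.
Context d (T : measurableType d) (R : realType) (P : probability T R).

Definition rademacher (X : {RV P >-> R}) : Prop :=
  P (X @^-1` [set 1]) = (2^-1)%:E /\ P (X @^-1` [set -1]) = (2^-1)%:E.

Definition mutually_independent (I : finType) (A : {set I})
    (X : I -> {RV P >-> R}) : Prop :=
  forall (J : {set I}) (B : I -> set R),
    J \subset A -> (forall i, i \in J -> measurable (B i)) ->
    P [set w | forall i, i \in J -> B i (X i w)] =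
    (\prod_(i in J) P (X i @^-1` B i))%E.

Definition symmetric_rademacher_matrix (n : nat) (M : 'M[{RV P >-> R}]_n) :
    Prop :=
  [/\ forall (i j : 'I_n) (w : T), M i j w = M j i w,
      forall i j : 'I_n, (i <= j)%N -> rademacher (M i j) &
      mutually_independent [set p : 'I_n * 'I_n | (p.1 <= p.2)%N]%SET
        (fun p => M p.1 p.2)].

Definition realization (n : nat) (M : 'M[{RV P >-> R}]_n) (w : T) : 'M[R]_n :=
  \matrix_(i, j) M i j w.

End RandomMatrix.

(* Main.v *)
Require Import Defs.
From HB Require Import structures.
From mathcomp Require Import all_boot all_order all_algebra all_fingroup.
From mathcomp Require Import ring lra zify boolp reals.

(** Write pm(X, Y) for the permanent of the rows outside X and the columns outside Y,
    so that per M = pm(0, 0) and pm(T, T) = 1, and expose the signs in stages.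

    Upper bound: expanding along a row together with the column of the same vertex
    gives a quadratic form in fresh signs; its second moment yields
    E pm(X, Y)^2 <= (6 n)^(n - |X|), and Markov's inequality applies.

    Lower bound. (1) Growth: expose the rows of a block of m vertices and follow
    Z = sum_S pm(X, Y0 + S)^2 over the sets S of remaining columns.  An up-down
    commutator identity gives enough weight to apply the Hilbert-space
    Littlewood-Offord inequality, so that Z gains a factor 2 m per row with few
    exceptions; after B m ~ n rows some minor has square n^(n - o(n)).
    (2) Descent: reserved vertices are added one at a time; the row of a new vertex
    may be spent to lower the defect (the number of rows still unexposed apart from
    the reserved ones), until the defect is a constant u.  (3) u reserved rows, then
    u reserved columns, remove the u leftover columns and rows with probability close
    to 1, so that pm(S + B, S + A) is large for most u-sets A and B with |S| = u fixed.
    (4) Each vertex of S then contributes a quadratic form in fresh signs with a dense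
    set of large coefficients, and a decoupled Littlewood-Offord inequality brings
    |A| = |B| = |S| from u down to 0. *)

Set Implicit Arguments.
Unset Strict Implicit.
Unset Printing Implicit Defensive.

Import Order.TTheory GRing.Theory Num.Theory.
Local Open Scope ring_scope.

Local Notation ind b := (nat_of_bool b%R)%:R.

(** The obstacle is symmetry: the entry joining t and m lies in row t and in row m. The signs of a
    row t are fresh in the columns of C only if the mirror entries lie outside the minors concerned,
    that is if the rows of C are still unexposed or column t is removed. The first possibility
    serves the growth, the second one the reserved vertices. The growth follows a sum of squares
    because all minors on the remaining columns form one Hilbert-space vector; a single minor is
    recovered at the end of a block at the price of a factor 2^n. A bad row may lose a power of n,
    so bad rows must be a small constant fraction of all rows. The descent stops at a constant
    defect because a row step at defect r fails with probability 2^-r, while one large quadratic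
    coefficient only gives success with probability 1/4. The last stages keep a positive density of
    large minors instead of one, which makes small-ball bounds of order 1/L available. All
    probabilities before the final transfer are averages over finitely many bit patterns. *)

Lemma ind_le1 (R : realFieldType) (b : bool) : b%:R <= 1 :> R.
Proof. by case: b; rewrite ?ler01. Qed.

Lemma set_nil (I : finType) : [set t in [::]] = finset.set0 :> {set I}.
Proof. by apply/setP => t; rewrite !inE in_nil. Qed.

Lemma setD_cons (I : finType) (X : {set I}) t (ts : seq I) :
  X :\: [set i in t :: ts] = (X :\ t) :\: [set i in ts].
Proof. by apply/setP => i; rewrite !inE negb_or andbA [(_ \notin _) && _]andbC. Qed.

(** * Uniform averages over finite sets and over sign patterns *)

Definition mean (R : realFieldType) (T : finType) (C : {set T}) (f : T -> R) : R :=
  (\sum_(a in C) f a) / #|C|%:R.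

Definition expect (R : realFieldType) (I : finType)
  (f : {ffun I -> bool} -> R) : R := mean [set: {ffun I -> bool}] f.

Section Mean.
Context (R : realFieldType) (T : finType).
Implicit Types (C : {set T}) (f g : T -> R) (c : R).

Lemma eq_mean C f g : (forall a, a \in C -> f a = g a) -> mean C f = mean C g.
Proof. by move=> fg; rewrite /mean (eq_bigr g). Qed.

Lemma ler_mean C f g :
  (forall a, a \in C -> f a <= g a) -> mean C f <= mean C g.
Proof.
move=> fg; apply: ler_wpM2r; first by rewrite invr_ge0 ler0n.
by apply: ler_sum => a aC; exact: fg.
Qed.

Lemma mean_ge0 C f : (forall a, a \in C -> 0 <= f a) -> 0 <= mean C f.
Proof. by move=> f0; apply: divr_ge0; [exact: sumr_ge0|exact: ler0n]. Qed.

Lemma mean_cst C c : C != finset.set0 -> mean C (fun=> c) = c.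
Proof.
move=> C0; rewrite /mean sumr_const -[c *+ _]mulr_natr mulfK //.
by rewrite pnatr_eq0 -lt0n card_gt0.
Qed.

Lemma mean_cst_le C c : 0 <= c -> mean C (fun=> c) <= c.
Proof.
move=> c0; have [->|C0] := eqVneq C finset.set0; last by rewrite mean_cst.
by rewrite /mean big_set0 mul0r.
Qed.

Lemma mean_le C f c : 0 <= c -> (forall a, a \in C -> f a <= c) -> mean C f <= c.
Proof. by move=> c0 fc; apply: le_trans (ler_mean fc) (mean_cst_le _ c0). Qed.

Lemma meanD C f g : mean C (fun a => f a + g a) = mean C f + mean C g.
Proof. by rewrite /mean big_split mulrDl. Qed.

Lemma meanN C f : mean C (fun a => - f a) = - mean C f.
Proof. by rewrite /mean sumrN mulNr. Qed.

Lemma meanB C f g : mean C (fun a => f a - g a) = mean C f - mean C g.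
Proof. by rewrite meanD meanN. Qed.

Lemma meanZ C c f : mean C (fun a => c * f a) = c * mean C f.
Proof. by rewrite /mean -mulr_sumr mulrA. Qed.

Lemma mean_sum (J : Type) (r : seq J) (P : pred J) C (F : J -> T -> R) :
  mean C (fun a => \sum_(j <- r | P j) F j a) = \sum_(j <- r | P j) mean C (F j).
Proof. by rewrite /mean exchange_big /= mulr_suml. Qed.

Lemma mean_markov C f c : 0 < c -> (forall a, a \in C -> 0 <= f a) ->
  mean C (fun a => ind (c <= f a)) <= mean C f / c.
Proof.
move=> c0 f0; rewrite ler_pdivlMr // mulrC -meanZ; apply: ler_mean => a aC.
by case: (leP c (f a)) => [ca|_]; [rewrite mulr1|rewrite mulr0 f0].
Qed.

(** Reverse Markov: points with f below c contribute at most c to the mean, so the others carry at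
    least c of it. Averages over pairs become dense sets of good fibres at the cost of a factor
    2. *)
Lemma mean_dense C f c : C != finset.set0 -> (forall a, a \in C -> f a <= 1) ->
  c *+ 2 <= mean C f -> 0 <= c -> c <= mean C (fun a => ind (c <= f a)).
Proof.
move=> C0 f1 cf c0.
have : mean C f <= mean C (fun a => ind (c <= f a) + c).
  apply: ler_mean => a aC; case: (leP c (f a)) => [_|/ltW]; last by rewrite add0r.
  by rewrite (le_trans (f1 a aC)) // lerDl.
by rewrite meanD mean_cst // mulr2n in cf *; lra.
Qed.

End Mean.

Lemma mean_exchange (R : realFieldType) (T U : finType) (C : {set T})
    (D : {set U}) (f : T -> U -> R) :
  mean C (fun a => mean D (f a)) = mean D (fun b => mean C (fun a => f a b)).
Proof.
rewrite /mean -!mulr_suml exchange_big /= -!mulrA; congr (_ * _); exact: mulrC.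
Qed.

Section Expect.
Context (R : realFieldType) (I : finType).
Implicit Types (f g : {ffun I -> bool} -> R).

Lemma expect_neq0 : [set: {ffun I -> bool}] != finset.set0.
Proof. by apply/set0Pn; exists [ffun=> true]; rewrite inE. Qed.

Lemma expect_cst (c : R) : expect (fun _ : {ffun I -> bool} => c) = c.
Proof. exact/mean_cst/expect_neq0. Qed.

Lemma ler_expect f g : (forall w, f w <= g w) -> expect f <= expect g.
Proof. by move=> fg; apply: ler_mean => w _. Qed.

Lemma eq_expect f g : f =1 g -> expect f = expect g.
Proof. by move=> fg; apply: eq_mean => w _. Qed.

Lemma expectD f g : expect (fun w => f w + g w) = expect f + expect g.
Proof. exact: meanD. Qed.

Lemma expectB f g : expect (fun w => f w - g w) = expect f - expect g.
Proof. exact: meanB. Qed.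

Lemma expectZ c f : expect (fun w => c * f w) = c * expect f.
Proof. exact: meanZ. Qed.

Lemma expectZr c f : expect (fun w => f w * c) = expect f * c.
Proof. by rewrite mulrC -expectZ; apply: eq_expect => w; rewrite mulrC. Qed.

Lemma expect_le f c : (forall w, f w <= c) -> expect f <= c.
Proof. by move=> fc; rewrite -[leRHS]expect_cst; apply: ler_expect. Qed.

Lemma expect_ge0 f : (forall w, 0 <= f w) -> 0 <= expect f.
Proof. by move=> f0; apply: mean_ge0 => w _. Qed.

Lemma expect_reindex f (h : {ffun I -> bool} -> {ffun I -> bool}) :
  involutive h -> expect f = expect (f \o h).
Proof.
move=> hK; rewrite /expect /mean; congr (_ / _).
by rewrite (reindex_inj (inv_inj hK)) /=; apply: eq_bigl => w; rewrite !inE.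
Qed.

Lemma expect_compl (E : pred {ffun I -> bool}) :
  expect (fun w => (~~ E w)%:R) = 1 - expect (fun w => (E w)%:R) :> R.
Proof.
rewrite -[X in X - _]expect_cst -meanB; apply: eq_expect => w.
by case: (E w) => /=; rewrite ?subr0 ?subrr.
Qed.

End Expect.

Definition flip (I : finType) (i : I) (w : {ffun I -> bool}) : {ffun I -> bool} :=
  [ffun j => (i == j) (+) w j].

Definition sg (R : pzRingType) (b : bool) : R := (-1) ^+ b.

Lemma flipK (I : finType) (i : I) : involutive (flip i).
Proof. by move=> w; apply/ffunP => j; rewrite !ffunE addbA addbb. Qed.

Lemma flip_id (I : finType) (i : I) w : flip i w i = ~~ w i.
Proof. by rewrite ffunE eqxx. Qed.

Lemma flip_neq (I : finType) (i j : I) w : i != j -> flip i w j = w j.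
Proof. by rewrite ffunE => /negbTE ->. Qed.

Section Signs.
Context (R : realFieldType).

Lemma sgN (b : bool) : sg R (~~ b) = - sg R b.
Proof. by case: b; rewrite /sg !(expr0, expr1) ?opprK. Qed.

Lemma sgK (b : bool) : sg R b * sg R b = 1.
Proof. by case: b; rewrite /sg !(expr0, expr1) ?mulrNN mulr1. Qed.

Lemma sg_norm (b : bool) : `|sg R b| = 1.
Proof. by case: b; rewrite /sg !(expr0, expr1) ?normrN normr1. Qed.

Lemma expect_flip (I : finType) (i : I) (f : {ffun I -> bool} -> R) :
  expect f = expect (fun w => (f w + f (flip i w)) / 2).
Proof.
have -> : expect (fun w => (f w + f (flip i w)) / 2)
        = (expect f + expect (f \o flip i)) / 2.
  rewrite -meanD [RHS]mulrC -meanZ; apply: eq_mean => w _ /=; exact: mulrC.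
by rewrite -(expect_reindex _ (flipK i)); field.
Qed.

End Signs.

(** * Small-ball estimates for Rademacher sums *)

Section LittlewoodOfford.
Context (R : realFieldType) (J : finType).
Local Notation V := {ffun J -> R}.
Implicit Types (u v x y : V) (r : R).

Definition dot u v : R := \sum_j u j * v j.
Definition nsq u : R := dot u u.

Lemma dotDl u v x : dot (u + v) x = dot u x + dot v x.
Proof.
by rewrite /dot -big_split; apply: eq_bigr => j _; rewrite ffunE mulrDl.
Qed.

Lemma dotC u v : dot u v = dot v u.
Proof. by apply: eq_bigr => j _; rewrite mulrC. Qed.

Lemma dotNl u v : dot (- u) v = - dot u v.
Proof. by rewrite /dot -sumrN; apply: eq_bigr => j _; rewrite ffunE mulNr. Qed.

Lemma dotDr u v x : dot x (u + v) = dot x u + dot x v.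
Proof. by rewrite dotC dotDl !(dotC x). Qed.

Lemma dotNr u v : dot v (- u) = - dot v u.
Proof. by rewrite dotC dotNl dotC. Qed.

Lemma nsq_ge0 u : 0 <= nsq u.
Proof. by apply: sumr_ge0 => j _; rewrite -expr2 sqr_ge0. Qed.

(** Distance at least 2 sqrt r: two points of the ball [nsq x < r] are never apart. *)
Definition apart r x y := 4 * r <= nsq (x - y).

(** The difference is (y - x) + 2 u; its cross term is nonnegative, and the square of 2 u alone
    contributes 4 r. *)
Lemma apart_opposite r x y u : 0 <= r -> r <= nsq u -> dot x u <= dot y u ->
  apart r (y + u) (x - u).
Proof.
rewrite /apart /nsq => r0 ru xy.
have := nsq_ge0 (y - x); rewrite /nsq.
by rewrite !(dotDl, dotDr, dotNl, dotNr) !(dotC u) (dotC x y); lra.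
Qed.

Lemma seq_argmax (phi : V -> R) x s :
  exists2 y, y \in x :: s & forall z, z \in x :: s -> phi z <= phi y.
Proof.
elim: s x => [|a s IH] x.
  by exists x => [|z]; rewrite inE // => /eqP ->.
have [y ys ymax] := IH a; have [xy|yx] := leP (phi x) (phi y).
  exists y => [|z]; first by rewrite inE ys orbT.
  by rewrite inE => /orP[/eqP -> //|]; exact: ymax.
exists x => [|z]; first exact: mem_head.
rewrite inE => /orP[/eqP -> //|/ymax zy]; exact: le_trans zy (ltW yx).
Qed.

Definition sgv (b : bool) v : V := if b then - v else v.

(** The number of k-step walks with steps +1 and -1 started at j that never visit 0; j plays the
    length of a separated list. *)
Fixpoint walks (k j : nat) : nat :=
  if k is k'.+1 then
    if j is j'.+1 then (walks k' j'.+2 + walks k' j')%N else 0%N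
  else (0 < j)%N.

Fixpoint hits (b : pred V) (us : seq V) (y : V) : nat :=
  if us is u :: us' then (hits b us' (y + u)%R + hits b us' (y - u)%R)%N else b y.

(* Kleitman's argument: a list of m well-separated points splits, after adding
   +u or -u to each of them, into separated lists of m + 1 and m - 1 points. *)
Lemma hits_walks (b : pred V) r us ys : 0 <= r ->
  (forall x y, b x -> b y -> ~~ apart r x y) ->
  all (fun u => r <= nsq u) us -> pairwise (apart r) ys ->
  (\sum_(y <- ys) hits b us y <= walks (size us) (size ys))%N.
Proof.
move=> r0 bsmall; elim: us ys => [|u us IH] ys.
  move=> _; elim: ys => [|y ys IHys] /=; first by rewrite big_nil.
  move=> /andP[/allP yys pys]; rewrite big_cons; case by_: (b y); last first.
    by apply: leq_trans (IHys pys) _; case: (ys).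
  rewrite big1_seq // => z /andP[_ zys]; apply/eqP; rewrite eqb0.
  by apply/negP => bz; have := bsmall _ _ by_ bz; rewrite yys.
move=> /andP[ru rus] pys; case: ys pys => [|y0 s] pys; first by rewrite big_nil.
(* The extreme point in direction u: its translate by +u is apart from every translate by -u, so it
   can change lists. *)
have [y y_ys ymax] := seq_argmax (dot^~ u) y0 s.
move: (y0 :: s) y_ys ymax pys => ys y_ys.
case/splitPr: ys / y_ys => s1 s2 ymax pys.
set rest := s1 ++ s2.
have szE : size (s1 ++ y :: s2) = (size rest).+1 by rewrite !size_cat /= addnS.
have prest : pairwise (apart r) rest.
  move: pys; rewrite !pairwise_cat /= allrel_consr => /and3P[/andP[_ ->] -> /=].
  by case/andP.
have shift v (zs : seq V) : pairwise (apart r) [seq z + v | z <- zs]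
    = pairwise (apart r) zs.
  rewrite pairwise_map; apply: eq_pairwise => x z; rewrite /apart /=.
  by rewrite opprD addrACA subrr addr0.
have pA : pairwise (apart r) ((y + u) :: [seq z - u | z <- s1 ++ y :: s2]).
  rewrite /= shift pys andbT; apply/allP => _ /mapP[z zs ->].
  by apply: apart_opposite => //; exact: ymax.
have pB : pairwise (apart r) [seq z + u | z <- rest] by rewrite shift.
have := leq_add (IH _ rus pA) (IH _ rus pB).
rewrite /= !size_map szE /=; apply: leq_trans.
rewrite big_cons !big_map /rest !big_cat !big_cons /= !big_split /=.
rewrite leq_eqVlt; apply/orP; left; apply/eqP. ring.
Qed.

Lemma walks_le k j : (walks k j <= 2 ^ k)%N.
Proof.
elim: k j => [|k IH] [|j] //=; rewrite expnS mul2n -addnn; exact: leq_add.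
Qed.

(* Gambler's ruin: the walk started at j survives k steps either by reaching L
   or by staying in (0, L), whose expected exit time is j (L - j). *)
Lemma walks_ruin (L k j : nat) : (0 < L)%N -> (j <= L)%N ->
  (walks k j)%:R <= 2 ^+ k * (j%:R / L%:R + j%:R * (L%:R - j%:R) / k%:R) :> R
  \/ k = 0%N.
Proof.
move=> L0; have L0' : 0 < L%:R :> R by rewrite ltr0n.
elim: k j => [|k IH] j jL; first by right.
left; have k0 : 0 < k.+1%:R :> R by rewrite ltr0n.
have jL' : j%:R <= L%:R :> R by rewrite ler_nat.
have trivial_case (x : R) : 1 <= x -> (walks k.+1 j)%:R <= 2 ^+ k.+1 * x.
  move=> x1; rewrite -[leLHS]mulr1; apply: ler_pM => //.
  by rewrite -natrX ler_nat walks_le.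
case: j jL jL' trivial_case => [|j] jL jL' trivial_case.
  by rewrite /= !mul0r addr0 mulr0.
have j0 : 0 < j.+1%:R :> R by rewrite ltr0n.
have [->|jnL] := eqVneq j.+1 L.
  by rewrite subrr mulr0 mul0r addr0 divff ?gt_eqF // mulr1 -natrX ler_nat walks_le.
(* If x = j (L - j) exceeds k + 1, the claimed bound is weaker than the trivial one. Otherwise
   averaging over both neighbours of j lowers x by 1, and (x - 1) / k <= x / (k + 1) amounts to x <=
   k + 1. *)
have [small|big] := leP (j.+1%:R * (L%:R - j.+1%:R)) (k.+1%:R : R); last first.
  apply: trivial_case; rewrite -[leLHS]add0r; apply: lerD.
    by rewrite divr_ge0 // ltW.
  by rewrite ler_pdivlMr // mul1r ltW.
have [k_eq0|k_neq0] := eqVneq k 0%N.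
  move: small; rewrite k_eq0 => small.
  have jL1 : 1 <= L%:R - j.+1%:R :> R.
    by rewrite lerBrDr nat1r ler_nat ltn_neqAle jnL.
  have j1 : 1 <= j.+1%:R :> R by rewrite ler1n.
  have prod1 : 1 <= j.+1%:R * (L%:R - j.+1%:R) :> R by rewrite -[leLHS]mulr1 ler_pM.
  have := trivial_case (j.+1%:R / L%:R + j.+1%:R * (L%:R - j.+1%:R)).
  rewrite k_eq0 divr1; apply; rewrite -[leLHS]add0r lerD // divr_ge0 //; exact: ltW.
have k0' : 0 < k%:R :> R by rewrite ltr0n lt0n.
have jlt : (j.+2 <= L)%N by rewrite ltn_neqAle jnL.
have [IH1|b] := IH j.+2 jlt; last by move: k_neq0; rewrite b.
have [IH2|b] := IH j (ltnW jL); last by move: k_neq0; rewrite b.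
rewrite /= natrD; apply: (le_trans (lerD IH1 IH2)).
rewrite -[leLHS]mulrDr exprSr -[leRHS]mulrA; apply: ler_wpM2l; first by rewrite exprn_ge0.
have -> : j.+2%:R = j.+1%:R + 1 :> R by rewrite [RHS]natr1.
have -> : j%:R = j.+1%:R - 1 :> R by rewrite -[j.+1%:R]natr1 addrK.
move: small; rewrite -[k.+1%:R]natr1 => small.
set a := j.+1%:R in small *; set l := L%:R in small L0' *; set q := k%:R in small k0' *.
have -> : (a + 1) / l + (a + 1) * (l - (a + 1)) / q
          + ((a - 1) / l + (a - 1) * (l - (a - 1)) / q)
        = 2 * (a / l) + 2 * ((a * (l - a) - 1) / q) by field; lra.
rewrite -mulrDr ler_pM2l // lerD2l ler_pdivrMr // mulrAC ler_pdivlMr; last lra.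
by rewrite mulrBl mul1r mulrDr mulr1; lra.
Qed.

Context (I : finType).
Implicit Types w : {ffun I -> bool}.

(** The signs on s are averaged exactly by pairing patterns under flips; the other signs are frozen
    into the starting point of [hits]. *)
Lemma expect_hits (u : I -> V) (w0 : V) (b : pred V) (s : seq I) : uniq s ->
  expect (fun w => ind (b (w0 + \sum_i sgv (w i) (u i))))
  = expect (fun w => (hits b [seq u i | i <- s]
       (w0 + \sum_(i | i \notin s) sgv (w i) (u i)))%:R) / 2 ^+ size s :> R.
Proof.
elim: s => [|i s IH] /=; first by rewrite expr0 divr1.
move=> /andP[is_ us]; rewrite (IH us) exprS.
rewrite (expect_flip i) invfM mulrA; congr (_ / _).
rewrite [RHS]mulrC -meanZ; apply: eq_expect => w.
have rest w' : (forall j, j != i -> w' j = w j) ->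
    w0 + \sum_(j | j \notin s) sgv (w' j) (u j)
  = w0 + \sum_(j | j \notin i :: s) sgv (w j) (u j) + sgv (w' i) (u i).
  move=> ww'; rewrite (bigD1 i) //= -addrA [_ + \sum_(_ | _) _]addrC.
  congr (_ + (_ + _)); apply: eq_big => j; first by rewrite inE negb_or andbC.
  by move=> /andP[_ ji]; rewrite ww'.
rewrite (rest w) // (rest (flip i w)); last first.
  by move=> j; rewrite eq_sym => /flip_neq.
rewrite flip_id natrD mulrC; congr (_ * _).
by case: (w i); rewrite /sgv //= addrC.
Qed.

(* The bound 2 / L comes from [walks_ruin] with k >= L ^ 2 steps. *)
Lemma small_ball (u : I -> V) (w0 : V) r (A : {set I}) (L : nat) :
  0 <= r -> (0 < L)%N -> (L ^ 2 <= #|A|)%N ->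
  (forall i, i \in A -> r <= nsq (u i)) ->
  expect (fun w => ind (nsq (w0 + \sum_i sgv (w i) (u i)) < r)) <= 2 / L%:R :> R.
Proof.
move=> r0 L0 LA uA; set b := fun x : V => nsq x < r.
rewrite (@expect_hits u w0 b (enum A) (enum_uniq _)).
have L0' : 0 < L%:R :> R by rewrite ltr0n.
have sz : (L ^ 2 <= size (enum A))%N by rewrite -cardE.
rewrite ler_pdivrMr ?exprn_gt0 // mulrC.
have bsmall x y : b x -> b y -> ~~ apart r x y.
  rewrite /b /apart -ltNge => bx by_.
  have := nsq_ge0 (x + y); move: bx by_; rewrite /nsq.
  by rewrite !(dotDl, dotDr, dotNl, dotNr) !(dotC y x); lra.
apply: expect_le => w.
have := @hits_walks b r [seq u i | i <- enum A]
   [:: w0 + \sum_(i | i \notin enum A) sgv (w i) (u i)] r0 bsmall.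
rewrite big_seq1 /= size_map => /(_ _ isT) hw.
have {}hw := hw (introT allP _).
apply: le_trans (_ : (walks (size (enum A)) 1)%:R <= _).
  rewrite ler_nat; apply: hw => _ /mapP[i + ->]; rewrite mem_enum; exact: uA.
have [|k0] := @walks_ruin L (size (enum A)) 1 L0 L0; last first.
  by move: sz; rewrite k0 leqn0 expn_eq0 (gtn_eqF L0).
move=> /le_trans; apply; rewrite ler_wpM2l ?exprn_ge0 // mul1r.
have k0 : 0 < (size (enum A))%:R :> R.
  by rewrite ltr0n (leq_trans _ sz) // expn_gt0 L0.
have -> : 2 / L%:R = 1 / L%:R + 1 / L%:R :> R by lra.
rewrite mul1r lerD2l ler_pdivrMr // mul1r [leRHS]mulrC ler_pdivlMr //.
have : L%:R ^+ 2 <= (size (enum A))%:R :> R by rewrite -natrX ler_nat.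
by rewrite expr2 mulrBl; lra.
Qed.

End LittlewoodOfford.

Lemma small_ball_scalar (R : realFieldType) (I : finType) (u : I -> R) (w0 r : R)
    (A : {set I}) (L : nat) : (0 < L)%N -> (L ^ 2 <= #|A|)%N ->
  (forall i, i \in A -> r <= `|u i|) ->
  expect (fun w => ind (`|w0 + \sum_i sg R (w i) * u i| < r)) <= 2 / L%:R :> R.
Proof.
move=> L0 LA uA; have [r0|r0] := ltP r 0.
  apply: expect_le => w; rewrite ltNge (le_trans (ltW r0)) ?normr_ge0 //=.
  by rewrite divr_ge0.
pose v i : {ffun unit -> R} := [ffun=> u i].
have nsqE (x : {ffun unit -> R}) : nsq x = x tt ^+ 2.
  by rewrite /nsq /dot (big_pred1 tt) // => -[].
have := @small_ball R unit I v [ffun=> w0] (r ^+ 2) A L (sqr_ge0 _) L0 LA.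
have uA' i : i \in A -> r ^+ 2 <= nsq (v i).
  by move=> /uA ui; rewrite nsqE ffunE -(real_normK (num_real (u i))) lerXn2r ?nnegrE.
move=> /(_ uA'); congr (_ <= _); apply: eq_expect => w.
rewrite nsqE !ffunE sum_ffunE -(real_normK (num_real (w0 + _))).
rewrite ltr_pXn2r ?nnegrE //; congr (ind (`|_ + _| < _)).
by apply: eq_bigr => i _; case: (w i); rewrite !ffunE /sg ?mulN1r ?mul1r.
Qed.

(** * Independent trials *)

Section Trials.
Context (R : realFieldType) (I : finType).

(** Of a pattern and its flip at j at most one fails trial j, and no other trial notices the flip.
    The trials thus behave like independent ones with failure probability at most 1/2. *)
Lemma trials_fail_seq (s : seq I) (F : I -> pred {ffun I -> bool}) : uniq s ->
  (forall j w, j \in s -> F j w || F j (flip j w)) ->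
  (forall i j w, i \in s -> j \in s -> i != j -> F i (flip j w) = F i w) ->
  expect (fun w => ind (all (fun j => ~~ F j w) s)) <= 2^-1 ^+ size s :> R.
Proof.
elim: s => [|j s IH] /= => [_ _ _|/andP[js us] F1 F2].
  by apply: expect_le => w.
have {}IH := IH us _ _; rewrite exprS.
apply: le_trans (_ : 2^-1 * expect (fun w => ind (all (fun j => ~~ F j w) s)) <= _).
  rewrite (expect_flip j) -meanZ; apply: ler_expect => w.
  have -> : all (fun i => ~~ F i (flip j w)) s = all (fun i => ~~ F i w) s.
    apply: eq_in_all => i si; rewrite F2 ?inE ?eqxx ?si ?orbT //.
    by apply: contraNneq js => <-.
  case: all; rewrite ?andbF ?andbT /=; last by rewrite addr0 mul0r mulr0.
  by have := F1 j w (mem_head _ _); case: (F j w); case: (F j (flip j w)) => //= _; lra.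
apply: ler_wpM2l; first by rewrite invr_ge0.
apply: IH => [i w si|i k w si sk ik].
  by apply: F1; rewrite inE si orbT.
by apply: F2 => //; rewrite inE ?si ?sk orbT.
Qed.

Lemma trials_fail (J : {set I}) (F : I -> pred {ffun I -> bool}) :
  (forall j w, j \in J -> F j w || F j (flip j w)) ->
  (forall i j w, i \in J -> j \in J -> i != j -> F i (flip j w) = F i w) ->
  expect (fun w => ind (~~ [exists j in J, F j w])) <= 2^-1 ^+ #|J| :> R.
Proof.
move=> F1 F2; rewrite cardE.
apply: le_trans (@trials_fail_seq (enum J) F (enum_uniq _) _ _).
- apply: ler_expect => w; rewrite ler_nat; case: existsP => //= noF.
  rewrite lt0b; apply/allP => j; rewrite mem_enum => jJ.
  by apply/negP => Fj; apply: noF; exists j; rewrite jJ.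
- by move=> j w; rewrite mem_enum; exact: F1.
- by move=> i j w; rewrite !mem_enum; exact: F2.
Qed.

End Trials.

(** * Removing columns one row at a time *)

Section Chain.
Context (R : realFieldType) (I : finType).
Implicit Types (f : {set I} -> R) (x y : I -> R) (C G J Y S H : {set I}).
Implicit Types (w : {ffun I -> bool}) (Phi : ({set I} -> R) -> R).

(** Laplace expansion along a row x, where f gives the minors indexed by their sets of removed
    columns: the new row releases one column m. *)
Definition D x f Y : R := \sum_(m | m \notin Y) x m * f (m |: Y).

Definition mixrow C y w (m : I) : R := if m \in C then sg R (w m) else y m.

(** Exposure in stages as nested averages: conditioning on earlier rows means evaluating at the
    current f, so one-row estimates compose by induction on the list. *)
Fixpoint chain C (ys : seq (I -> R)) f Phi : R :=
  if ys is y :: ys' then expect (fun w => chain C ys' (D (mixrow C y w) f) Phi)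
  else Phi f.

Lemma chain_cat C ys zs f Phi :
  chain C (ys ++ zs) f Phi = chain C ys f (fun f' => chain C zs f' Phi).
Proof. by elim: ys f => //= y ys IH f; apply: eq_expect => w. Qed.

Lemma ler_chain C ys f Phi Psi : (forall f', Phi f' <= Psi f') ->
  chain C ys f Phi <= chain C ys f Psi.
Proof. by move=> PP; elim: ys f => //= y ys IH f; apply: ler_expect => w. Qed.

Lemma chain_le C ys f Phi (c : R) : (forall f', Phi f' <= c) ->
  chain C ys f Phi <= c.
Proof. by move=> Pc; elim: ys f => //= y ys IH f; apply: expect_le => w. Qed.

Lemma chain_ge0 C ys f Phi : (forall f', 0 <= Phi f') -> 0 <= chain C ys f Phi.
Proof. by move=> P0; elim: ys f => //= y ys IH f; apply: expect_ge0 => w. Qed.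

Lemma chainD C ys f Phi Psi :
  chain C ys f (fun f' => Phi f' + Psi f') = chain C ys f Phi + chain C ys f Psi.
Proof.
by elim: ys f => //= y ys IH f; rewrite -meanD; apply: eq_mean => w _; exact: IH.
Qed.

Lemma chainZ C ys f (c : R) Phi :
  chain C ys f (fun f' => c * Phi f') = c * chain C ys f Phi.
Proof.
by elim: ys f => //= y ys IH f; rewrite -meanZ; apply: eq_mean => w _; exact: IH.
Qed.

Lemma chain_cst C ys f (c : R) : chain C ys f (fun=> c) = c.
Proof.
elim: ys f => //= y ys IH f; rewrite -[RHS](@expect_cst R I).
by apply: eq_expect => w; exact: IH.
Qed.

Definition homog (c : nat) f := forall Y, f Y != 0 -> #|Y| = c.

Lemma homogD c x f : homog c.+1 f -> homog c (D x f).
Proof.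
move=> hf Y; have [//|ne] := eqVneq #|Y| c.
rewrite /D big1 ?eqxx // => m mY; have [->|/hf] := eqVneq (f (m |: Y)) 0.
  by rewrite mulr0.
by rewrite cardsU1 mY add1n => -[/eqP]; rewrite (negbTE ne).
Qed.

Section Step.
Context (C Y0 : {set I}) (y : I -> R) (f : {set I} -> R).
Hypothesis CY0 : [disjoint C & Y0].
Local Notation f' w := (D (mixrow C y w) f).

Lemma D_mixrow w S : S \subset C ->
  f' w (Y0 :|: S) = \sum_(m in C :\: S) sg R (w m) * f (Y0 :|: (m |: S))
    + \sum_(m | (m \notin C) && (m \notin Y0 :|: S)) y m * f (m |: (Y0 :|: S)).
Proof.
move=> SC; rewrite /D (bigID (fun m : I => m \in C)) /=; congr (_ + _).
  apply: eq_big => m.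
    rewrite !inE negb_or; have [mC|] := boolP (m \in C); rewrite ?andbF ?andbT //.
    by rewrite (disjointFr CY0 mC).
  by move=> /andP[_ mC]; rewrite /mixrow mC setUCA.
apply: eq_big => m; first exact: andbC.
by move=> /andP[_ /negbTE mC]; rewrite /mixrow mC.
Qed.

(** The value at S minus j is the value at S with the sign w j, plus terms that read no sign of a
    column in S. Flipping w j moves it by twice the value at S, so one of both outcomes is large;
    different j use different signs. *)
Lemma star_step S J : S \subset C -> J \subset S ->
  expect (fun w => ind (~~ [exists j in J,
     `|f (Y0 :|: S)| <= `|f' w (Y0 :|: S :\ j)|])) <= 2^-1 ^+ #|J| :> R.
Proof.
move=> SC JS.
have E w j : j \in J -> f' w (Y0 :|: S :\ j) = sg R (w j) * f (Y0 :|: S)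
   + (\sum_(m in C :\: S) sg R (w m) * f (Y0 :|: (m |: S :\ j))
    + \sum_(m | (m \notin C) && (m \notin Y0 :|: S :\ j))
        y m * f (m |: (Y0 :|: S :\ j))).
  move=> jJ; have jS := subsetP JS j jJ; have jC := subsetP SC j jS.
  rewrite D_mixrow ?(subset_trans (subsetDl _ _)) //.
  rewrite (bigD1 j) /=; last by rewrite !inE eqxx jC.
  rewrite setD1K // -addrA; congr (_ + (_ + _)); apply: eq_bigl => m.
  rewrite !inE; have [->|mj] := eqVneq m j; first by rewrite jS andbF.
  by rewrite andbT.
have E2 w w' j : j \in J -> (forall m, m \in C :\: S -> w' m = w m) ->
    f' w' (Y0 :|: S :\ j) = f' w (Y0 :|: S :\ j)
      + (sg R (w' j) - sg R (w j)) * f (Y0 :|: S).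
  move=> jJ ww'; rewrite !E // (eq_bigr (fun m =>
     sg R (w m) * f (Y0 :|: (m |: S :\ j)))); first by ring.
  by move=> m mCS; rewrite ww'.
have flipC w j : j \in J -> forall m, m \in C :\: S -> flip j w m = w m.
  move=> jJ m; rewrite inE => /andP[mS _]; apply: flip_neq.
  by apply: contraNneq mS => <-; exact: (subsetP JS).
apply: trials_fail => [j w jJ|i j w iJ jJ ij].
  rewrite (E2 w (flip j w) j jJ (flipC w j jJ)) flip_id sgN.
  set a := f (Y0 :|: S); set b := f' w _.
  case: (leP `|a| `|b|) => //= ba.
  have : `|b + (- sg R (w j) - sg R (w j)) * a - b| = 2 * `|a|.
    rewrite addrC addKr normrM -opprD normrN -mulr2n normrMn sg_norm; ring.
  by have := ler_normB (b + (- sg R (w j) - sg R (w j)) * a) b; lra.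
rewrite (E2 w (flip j w) i iJ (flipC w j jJ)).
by rewrite flip_neq 1?eq_sym // subrr mul0r addr0.
Qed.

End Step.

(** * Growth of the squared weight under exposed rows *)

Definition weight C Y0 f : R := \sum_(S : {set I} | S \subset C) f (Y0 :|: S) ^+ 2.

Lemma weight_ge0 C Y0 f : 0 <= weight C Y0 f.
Proof. by apply: sumr_ge0 => S _; exact: sqr_ge0. Qed.

Lemma sum_sqr_expand C (G : {set I}) (Q : I -> {set I} -> bool)
    (F : I -> {set I} -> R) :
  \sum_(H : {set I} | H \subset C) (\sum_(m in G | Q m H) F m H) ^+ 2
  = \sum_(m in G) \sum_(k in G)
      \sum_(H : {set I} | [&& H \subset C, Q m H & Q k H]) F m H * F k H.
Proof.
under eq_bigr do rewrite expr2 mulr_suml.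
rewrite (exchange_big_dep (fun m : I => m \in G)) /=; last first.
  by move=> H m _ /andP[].
apply: eq_bigr => m mG; under eq_bigr do rewrite mulr_sumr.
rewrite (exchange_big_dep (fun m : I => m \in G)) /=; last by move=> H k _ /andP[].
by apply: eq_bigr => k kG; apply: eq_bigl => H; rewrite mG kG /= andbA.
Qed.

(* Up-down commutator: [sum_m x_m d_m] and its adjoint commute up to the
   difference of the numbers of elements of G inside and outside S. *)
Lemma commutator C G (x : I -> R) (h : {set I} -> R) :
  G \subset C -> (forall m, x m * x m = 1) ->
  \sum_(S : {set I} | S \subset C) (#|G :&: S|%:R - #|G :\: S|%:R) * h S ^+ 2
  <= \sum_(H : {set I} | H \subset C) (\sum_(m in G | m \notin H) x m * h (m |: H)) ^+ 2.
Proof.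
move=> GC x1.
have: 0 <= \sum_(H : {set I} | H \subset C) (\sum_(m in G | m \in H) x m * h (H :\ m)) ^+ 2.
  by apply: sumr_ge0 => H _; exact: sqr_ge0.
rewrite !sum_sqr_expand => B0; rewrite -subr_ge0; move: B0; congr (0 <= _).
symmetry; apply/eqP; rewrite subr_eq addrC -subr_eq -sumrB; apply/eqP.
(* Off-diagonal terms cancel: adjoining m and k to a set that avoids both maps one sum onto the
   other. *)
have off m k : m \in G -> k \in G -> m != k ->
    \sum_(H : {set I} | [&& H \subset C, m \notin H & k \notin H])
       x m * h (m |: H) * (x k * h (k |: H))
  = \sum_(H : {set I} | [&& H \subset C, m \in H & k \in H])
       x m * h (H :\ m) * (x k * h (H :\ k)).
  move=> mG kG mk; rewrite (reindex_onto (fun S => S :\ m :\ k)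
    (fun H => m |: (k |: H))) /=; last first.
    move=> H /and3P[_ mH kH]; rewrite setU1K ?setU1K //.
    by rewrite !inE negb_or mk.
  apply: eq_big => S.
    rewrite !inE !eqxx /= andbF !andbT.
    apply/andP/and3P => [[SC /eqP <-]|[SC mS kS]].
      split; rewrite ?inE ?eqxx ?orbT // !subUset !sub1set !(subsetP GC) //=.
    rewrite (subset_trans (subsetDl _ _)) ?(subset_trans (subsetDl _ _)) //.
    by rewrite setD1K ?setD1K ?eqxx // !inE eq_sym mk.
  move=> /andP[_ /eqP SE]; have mS : m \in S by rewrite -SE setU11.
  have kS : k \in S by rewrite -SE !inE eqxx orbT.
  have -> : k |: S :\ m :\ k = S :\ m by rewrite setD1K // !inE eq_sym mk.
  have -> : m |: S :\ m :\ k = S :\ k.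
    apply/setP => i; rewrite !inE; have [->|_] := eqVneq i m; first by rewrite mk.
    by [].
  ring.
have in_out (m : I) : m \in G ->
    \sum_(H : {set I} | (H \subset C) && (m \notin H)) h (m |: H) ^+ 2
  = \sum_(S : {set I} | (S \subset C) && (m \in S)) h S ^+ 2.
  move=> mG; rewrite [RHS](reindex_onto (fun H => m |: H) (fun S => S :\ m)) /=.
    apply: eq_bigl => H; rewrite setU11 andbT subUset sub1set (subsetP GC) //=.
    by congr (_ && _); apply/idP/eqP => [/setU1K //|<-]; rewrite setD11.
  by move=> S /andP[_ mS]; rewrite setD1K.
have out_in (m : I) : m \in G ->
    \sum_(H : {set I} | (H \subset C) && (m \in H)) h (H :\ m) ^+ 2
  = \sum_(S : {set I} | (S \subset C) && (m \notin S)) h S ^+ 2.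
  move=> mG; rewrite (reindex_onto (fun H => m |: H) (fun S => S :\ m)) /=.
    apply: eq_big => H.
      rewrite setU11 andbT subUset sub1set (subsetP GC) //=.
      by congr (_ && _); apply/eqP/idP => [<-|/setU1K //]; rewrite setD11.
    by move=> /andP[_ /eqP ->].
  by move=> S /andP[_ mS]; rewrite setD1K.
have -> : \sum_(S : {set I} | S \subset C) (#|G :&: S|%:R - #|G :\: S|%:R) * h S ^+ 2
  = \sum_(m in G) (\sum_(S : {set I} | (S \subset C) && (m \in S)) h S ^+ 2
                  - \sum_(S : {set I} | (S \subset C) && (m \notin S)) h S ^+ 2).
  rewrite sumrB (exchange_big_dep (fun S : {set I} => S \subset C)) /=; last first.
    by move=> m S _ /andP[].
  rewrite [X in _ = _ - X](exchange_big_dep (fun S : {set I} => S \subset C)) /=;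
    last by move=> m S _ /andP[].
  rewrite -sumrB; apply: eq_bigr => S SC; rewrite SC /= mulrBl !sumr_const.
  rewrite !mulr_natl; congr (_ *+ _ - _ *+ _).
    by apply: eq_card => m; rewrite !inE.
  by apply: eq_card => m; rewrite !inE andbC.
apply: eq_bigr => m mG; rewrite -sumrB.
rewrite (bigD1 m) //= [X in _ + X]big1 ?addr0; last first.
  by move=> k /andP[kG km]; rewrite off ?subrr // eq_sym.
congr (_ - _).
  rewrite -in_out //; apply: eq_big => [H|H _]; first by rewrite andbb.
  by rewrite mulrACA x1 mul1r.
rewrite -out_in //; apply: eq_big => [H|H _]; first by rewrite andbb.
by rewrite mulrACA x1 mul1r.
Qed.

Lemma subset_card (s : nat) C : (s <= #|C|)%N ->
  exists2 A : {set I}, A \subset C & #|A| = s.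
Proof.
move=> sC; exists [set x in take s (enum C)].
  by apply/subsetP => x; rewrite inE => /mem_take; rewrite mem_enum.
rewrite cardsE (card_uniqP _) ?take_uniq ?enum_uniq // size_take -cardE.
by move: sC; rewrite leq_eqVlt => /orP[/eqP->|->//]; rewrite ltnn.
Qed.

Lemma coloring (s k : nat) C : (k * s <= #|C|)%N ->
  exists col : I -> nat, forall g, (g < k)%N -> #|[set m in C | col m == g]| = s.
Proof.
elim: k C => [|k IH] C; first by exists (fun=> 0%N).
rewrite mulSn => ksC.
have [A AC As] := subset_card (leq_trans (leq_addr _ _) ksC).
have ksCA : (k * s <= #|C :\: A|)%N by rewrite cardsDS // As leq_subRL ?As // (leq_trans _ ksC) ?leq_addr.
have [col colE] := IH _ ksCA.
exists (fun m => if m \in A then k else if (col m < k)%N then col m else k.+1).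
move=> g; rewrite ltnS leq_eqVlt => /orP[/eqP->|gk].
  rewrite -As; apply: eq_card => m; rewrite !inE.
  have [mA|mA] := boolP (m \in A); first by rewrite eqxx (subsetP AC).
  by case: ltnP => ck; rewrite ?(ltn_eqF ck) ?(gtn_eqF (ltnSn _)) andbF.
rewrite -(colE g gk); apply: eq_card => m; rewrite !inE.
have [mA|mA] := boolP (m \in A); first by rewrite (gtn_eqF gk) andbF.
case: ltnP => // ck; have /negbTE -> : k.+1 != g by lia.
by have /negbTE -> : col m != g by lia.
Qed.

Section Growth.
Context (C Y0 : {set I}).
Hypothesis CY0 : [disjoint C & Y0].
Local Notation Z := (weight C Y0).

(* Flipping the signs of whole groups of columns of size 4 m leaves the law of
   the row unchanged; each group contributes at least 2 m Z by [commutator]. *)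
Lemma growth_step y f (m L : nat) : (0 < L)%N ->
  (forall S, S \subset C -> f (Y0 :|: S) != 0 -> (#|C :\: S| <= m)%N) ->
  (L ^ 2 * (4 * m) <= #|C|)%N ->
  expect (fun w => ind (Z (D (mixrow C y w) f) < (2 * m)%:R * Z f)) <= 2 / L%:R :> R.
Proof.
move=> L0 supp LC; have [col colE] := coloring LC.
pose G (g : 'I_(L ^ 2)) := [set i in C | col i == g].
have GC g : G g \subset C by apply/subsetP => i; rewrite inE => /andP[].
pose tw (eta : {ffun 'I_(L ^ 2) -> bool}) w : {ffun I -> bool} :=
  [ffun i => if insub (col i) is Some g then eta g (+) w i else w i].
have twK eta : involutive (tw eta).
  by move=> w; apply/ffunP => i; rewrite !ffunE; case: insub => // g; rewrite addbA addbb.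
pose u w (g : 'I_(L ^ 2)) : {ffun {set I} -> R} := [ffun H : {set I} =>
  if H \subset C then \sum_(i in G g | i \notin H) sg R (w i) * f (Y0 :|: (i |: H))
  else 0].
pose w0 w : {ffun {set I} -> R} := [ffun H : {set I} => if H \subset C then
   \sum_(i in C :\: H | (L ^ 2 <= col i)%N) sg R (w i) * f (Y0 :|: (i |: H))
   + \sum_(i | (i \notin C) && (i \notin Y0 :|: H)) y i * f (i |: (Y0 :|: H))
  else 0].
have decomp w eta : Z (D (mixrow C y (tw eta w)) f)
    = nsq (w0 w + \sum_g sgv (eta g) (u w g)).
  rewrite /nsq /dot [RHS](bigID (fun H : {set I} => H \subset C)) /=.
  rewrite [X in _ + X]big1 ?addr0; last first.
    move=> H /negbTE HC; rewrite !ffunE sum_ffunE HC add0r big1 ?mul0r // => g _.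
    by case: (eta g); rewrite !ffunE HC ?oppr0.
  apply: eq_bigr => H HC; rewrite expr2; suff -> : D (mixrow C y (tw eta w)) f (Y0 :|: H)
     = (w0 w + \sum_g sgv (eta g) (u w g)) H by [].
  rewrite D_mixrow // !ffunE sum_ffunE HC.
  rewrite (bigID (fun i => (L ^ 2 <= col i)%N)) /= -addrA [RHS]addrAC -[RHS]addrA.
  congr (_ + _).
    apply: eq_bigr => i /andP[_ Li]; rewrite ffunE insubF //.
    by apply/negbTE; rewrite -leqNgt.
  rewrite addrC [RHS]addrC; congr (_ + _).
  rewrite (partition_big (fun i => insubd (Ordinal (_ : (0 < L ^ 2)%N)) (col i)) xpredT) //=.
    by rewrite expn_gt0 L0.
  move=> e0; apply: eq_bigr => g _; rewrite (_ : sgv _ _ _ =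
    \sum_(i in G g | i \notin H) sg R (eta g (+) w i) * f (Y0 :|: (i |: H))).
    apply: eq_big => i.
      rewrite !inE -ltnNge; have [iH|iH] /= := boolP (i \in H); rewrite ?andbF //.
      have [iC|iC] /= := boolP (i \in C) => //; rewrite ?andbT.
      have [ci|ci] /= := ltnP (col i) (L ^ 2).
        by rewrite -val_eqE /= val_insubd ci.
      by symmetry; apply/negbTE; apply: contraL ci => /eqP->; rewrite -ltnNge.
    move=> /andP[/andP[_ ci] /eqP gE]; rewrite ffunE.
    by rewrite -ltnNge in ci; rewrite insubT -gE /insubd insubT.
  rewrite /sgv; case: (eta g); rewrite !ffunE HC // -?sumrN.
  by apply: eq_bigr => i _; rewrite /= sgN mulNr.
(* Here G has 4 m columns and at most m columns of C lie outside S, so the commutator weight is at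
   least 3 m - m. *)
have u_large w g : (2 * m)%:R * Z f <= nsq (u w g).
  have := @commutator C (G g) (fun i => sg R (w i)) (fun S => f (Y0 :|: S)) (GC g).
  move=> /(_ (fun i => sgK R (w i))) H1.
  apply: le_trans (le_trans H1 _).
    rewrite /weight mulr_sumr; apply: ler_sum => S SC.
    have [->|fS] := eqVneq (f (Y0 :|: S)) 0; first by rewrite expr0n !mulr0.
    apply: ler_wpM2r; first exact: sqr_ge0.
    have := supp S SC fS; have := subset_leq_card (setSD S (GC g)).
    have := cardsID S (G g); rewrite colE // => c1 c2 c3.
    rewrite lerBrDr -natrD ler_nat; lia.
  rewrite /nsq /dot [leRHS](bigID (fun H : {set I} => H \subset C)) /=.
  rewrite -[leLHS]addr0 lerD //; last by apply: sumr_ge0 => H _; rewrite -expr2 sqr_ge0.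
  by apply: ler_sum => H HC; rewrite -expr2 ffunE HC.
have E (eta : {ffun 'I_(L ^ 2) -> bool}) :
    expect (fun w => ind (Z (D (mixrow C y w) f) < (2 * m)%:R * Z f))
    = expect (fun w => ind (nsq (w0 w + \sum_g sgv (eta g) (u w g)) < (2 * m)%:R * Z f)) :> R.
  by rewrite (expect_reindex _ (twK eta)); apply: eq_expect => w /=; rewrite decomp.
apply: le_trans (_ : expect (fun eta : {ffun 'I_(L ^ 2) -> bool} => expect (fun w =>
    ind (nsq (w0 w + \sum_g sgv (eta g) (u w g)) < (2 * m)%:R * Z f))) <= _).
  by rewrite -[leLHS](@expect_cst R 'I_(L ^ 2)); apply: ler_expect => eta; rewrite (E eta).
rewrite /expect mean_exchange; apply: expect_le => w.
apply: (@small_ball R _ _ (u w) (w0 w) _ setT) => //.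
- by rewrite mulr_ge0 ?weight_ge0.
- by rewrite cardsT card_ord.
Qed.

(** By [star_step], S passes its value on to some S minus j unless s trials all fail. A set receives
    from at most |C| others, so losing more than the factor 2 |C| forces the unlucky S to carry half
    of the weight; Markov's inequality bounds that event. *)
Lemma survive_step y f (c s : nat) : homog c f -> c = (#|Y0| + s)%N ->
  expect (fun w => ind (Z (D (mixrow C y w) f) * (2 * #|C|)%:R < Z f))
    <= 2 * 2^-1 ^+ s :> R.
Proof.
move=> hf cE; set f' := fun w => D (mixrow C y w) f.
pose ok w (S : {set I}) := [exists j in S, `|f (Y0 :|: S)| <= `|f' w (Y0 :|: S :\ j)|].
have sS S : S \subset C -> f (Y0 :|: S) != 0 -> #|S| = s.
  move=> SC /hf; rewrite cE cardsU disjoint_setI0 ?cards0 ?subn0.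
    by move/addnI.
  by rewrite disjoint_sym (disjointWl SC).
have okZ w : \sum_(S : {set I} | S \subset C) (ok w S)%:R * f (Y0 :|: S) ^+ 2
    <= #|C|%:R * Z (f' w).
  apply: le_trans (_ : \sum_(S : {set I} | S \subset C) \sum_(j in S)
     f' w (Y0 :|: S :\ j) ^+ 2 <= _).
    apply: ler_sum => S SC; have [/existsP[j /andP[jS fj]]|_] := boolP (ok w S).
      rewrite mul1r (bigD1 j) //= -[leLHS]addr0 lerD ?sumr_ge0 //.
        by rewrite -(real_normK (num_real (f _))) -(real_normK (num_real (f' w _)))
          lerXn2r ?nnegrE.
      by move=> i _; exact: sqr_ge0.
    by rewrite mul0r sumr_ge0 // => i _; exact: sqr_ge0.
  rewrite (exchange_big_dep (fun j : I => j \in C)) /=; last first.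
    by move=> S j SC; exact: (subsetP SC).
  rewrite mulr_natl -sumr_const; apply: ler_sum => j jC.
  rewrite (reindex_onto (fun H => j |: H) (fun S => S :\ j)) /=; last first.
    by move=> S /andP[_ jS]; rewrite setD1K.
  rewrite /weight [leRHS](bigID (fun S : {set I} => j \notin S)) /=.
  rewrite -[leLHS]addr0 lerD ?sumr_ge0 //; last by move=> i _; exact: sqr_ge0.
  rewrite le_eqVlt; apply/orP; left; apply/eqP; apply: eq_big => H.
    rewrite setU11 andbT subUset sub1set jC /=.
    by congr (_ && _); apply/eqP/idP => [<-|/setU1K //]; rewrite setD11.
  by move=> /andP[_ /eqP ->].
have [Z0|Zneq0] := eqVneq (Z f) 0.
  apply: expect_le => w; rewrite Z0 ltNge mulr_ge0 ?weight_ge0 //=.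
  by rewrite mulr_ge0 // exprn_ge0 // invr_ge0.
have Zgt0 : 0 < Z f by rewrite lt0r Zneq0 weight_ge0.
rewrite -(ler_pM2r Zgt0) [leLHS]mulrC -meanZ.
apply: le_trans (_ : expect (fun w => 2 * \sum_(S : {set I} | S \subset C)
     (~~ ok w S)%:R * f (Y0 :|: S) ^+ 2) <= _).
  apply: ler_expect => w; case: ltP => [Zw|_]; last first.
    by rewrite mulr0 mulr_ge0 // sumr_ge0 // => S _; rewrite mulr_ge0 ?sqr_ge0.
  have : \sum_(S : {set I} | S \subset C) (ok w S)%:R * f (Y0 :|: S) ^+ 2
     + \sum_(S : {set I} | S \subset C) (~~ ok w S)%:R * f (Y0 :|: S) ^+ 2 = Z f.
    rewrite -big_split; apply: eq_bigr => S _ /=.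
    by case: (ok w S); rewrite mul0r mul1r ?addr0 ?add0r.
  have := okZ w; rewrite mulr1 natrM in Zw *; move: Zw; rewrite [Z _ * _]mulrC -mulrA /f'.
  lra.
rewrite /expect meanZ mean_sum -[leRHS]mulrA ler_pM2l // mulr_sumr.
apply: ler_sum => S SC; under eq_mean do rewrite mulrC.
rewrite meanZ mulrC; have [->|fS] := eqVneq (f (Y0 :|: S)) 0; first by rewrite expr0n !mulr0.
by apply: ler_wpM2r; rewrite ?sqr_ge0 // -(sS S SC fS); exact: star_step.
Qed.

End Growth.

End Chain.

Section GrowthChain.
Context (R : realFieldType) (I : finType) (C Y0 : {set I}) (m L : nat).
Hypotheses (CY0 : [disjoint C & Y0]) (m0 : (0 < m)%N) (L0 : (0 < L)%N).
Hypothesis LC : (L ^ 2 * (4 * m) <= #|C|)%N.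
Local Notation Z := (@weight R I C Y0).
Let g : R := (2 * m)%:R.
Let q : R := (2 * #|C|)%:R * g.
Let p : R := 2 / L%:R.

(* A step is good if Z grows by the factor g; a bad step costs the factor q
   relative to a good one, and b bounds the number of bad steps. *)
Lemma growth_chain ys f (s b : nat) :
  homog (#|Y0| + s)%N f -> (s <= #|C|)%N -> (#|C| - s + size ys <= m)%N ->
  chain C ys f (fun f' => ind (Z f' * q ^+ b < g ^+ size ys * Z f))
  <= 2 ^+ size ys * p ^+ b.+1 + (size ys)%:R * (2 * 2^-1 ^+ (#|C| - m)).
Proof.
have p0 : 0 < p by rewrite divr_gt0 // ltr0n.
have C4m : (4 * m <= #|C|)%N by apply: leq_trans LC; rewrite leq_pmull // expn_gt0 L0.
have C0 : (0 < #|C|)%N by lia.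
have g0 : 0 < g by rewrite ltr0n; lia.
have g1 : 1 <= g by rewrite ler1n; lia.
have c0 : 1 <= (2 * #|C|)%:R :> R by rewrite ler1n; lia.
have q1 : 1 <= q by rewrite -[leLHS]mulr1 ler_pM.
have d0 : 0 <= 2 * 2^-1 ^+ (#|C| - m) :> R by rewrite mulr_ge0 // exprn_ge0 // invr_ge0.
elim: ys f s b => [|y ys IH] f s b hf sC sm.
  rewrite /= !expr0 !mul1r mul0r addr0 ltNge ler_peMr ?weight_ge0 ?exprn_ege1 //=.
  by rewrite exprn_ge0 // ltW.
case: s hf sC sm => [|s] hf sC sm; first by move: sm C4m => /=; clear -m0; lia.
rewrite /=; set T := size ys.
have hf' w : homog (#|Y0| + s)%N (D (mixrow C y w) f).
  by apply: homogD; rewrite -addnS.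
have sm' : (#|C| - s + T <= m)%N by move: sm; rewrite /= -/T; clear; lia.
(* A good step keeps the budget b, a bad one leaves b - 1, and a step losing more than 2 |C| is
   charged to the additive error. As a bad step has probability at most p, the bound closes by 2^T
   p^(b+1) + p 2^T p^b = 2^(T+1) p^(b+1). *)
have pointwise w : chain C ys (D (mixrow C y w) f)
      (fun f' => ind (Z f' * q ^+ b < g ^+ T.+1 * Z f))
    <= 2 ^+ T * p ^+ b.+1 + T%:R * (2 * 2^-1 ^+ (#|C| - m))
       + (2 ^+ T * p ^+ b) * ind (Z (D (mixrow C y w) f) < g * Z f)
       + ind (Z (D (mixrow C y w) f) * (2 * #|C|)%:R < Z f).
  set f1 := D _ f; have hf1 : homog (#|Y0| + s)%N f1 := hf' w.
  have A0 : 0 <= 2 ^+ T * p ^+ b.+1 by rewrite mulr_ge0 // exprn_ge0 // ltW.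
  have A1 : 0 <= 2 ^+ T * p ^+ b by rewrite mulr_ge0 // exprn_ge0 // ltW.
  have A2 : 0 <= T%:R * (2 * 2^-1 ^+ (#|C| - m)) :> R by rewrite mulr_ge0.
  have [good|bad] := leP (g * Z f) (Z f1).
    rewrite mulr0 addr0 -[leLHS]addr0 lerD //; apply: le_trans (IH f1 s b hf1 (ltnW sC) sm').
    apply: ler_chain => f'; rewrite ler_nat; case: ltP => //= lt1.
    rewrite lt0b; apply: lt_le_trans lt1 _; rewrite exprSr -mulrA.
    by rewrite ler_wpM2l // exprn_ge0 // ltW.
  have [dead|alive] := ltP (Z f1 * (2 * #|C|)%:R) (Z f).
    apply: le_trans (_ : 1 <= _); last by rewrite -[leLHS]add0r lerD // mulr1 !addr_ge0.
    by apply: chain_le => f'; exact: ind_le1.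
  rewrite mulr1 addr0; case: b A0 A1 => [|b] A0 A1.
    apply: le_trans (_ : 1 <= _).
      by apply: chain_le => f'; exact: ind_le1.
    rewrite expr0 mulr1 -[leLHS]add0r lerD ?addr_ge0 //.
    by rewrite exprn_ege1 // ler1n.
  rewrite addrAC -[leLHS]add0r -addrA lerD //.
  rewrite [X in _ <= X]addrC; apply: le_trans (le_trans (IH f1 s b hf1 (ltnW sC) sm') _).
    apply: ler_chain => f'; rewrite ler_nat; case: ltP => //= lt1.
    rewrite lt0b; move: lt1; rewrite exprS mulrCA [g ^+ T.+1]exprSr -mulrA /q => lt1.
    have q0 : 0 < (2 * #|C|)%:R * g by exact: lt_le_trans q1.
    rewrite -(ltr_pM2l q0); apply: lt_le_trans lt1 _.
    rewrite -mulrA [leRHS]mulrCA [leRHS]mulrA mulrCA.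
    rewrite -[leRHS]mulrA ler_pM2l // [leRHS]mulrCA.
    by rewrite ler_wpM2l // ?exprn_ge0 ?(ltW g0) // mulrC.
  by rewrite addrC.
apply: le_trans (ler_expect pointwise) _.
rewrite /expect !meanD -!/(expect _) !expect_cst /expect meanZ -!/(expect _).
have suppf (S : {set I}) : S \subset C -> f (Y0 :|: S) != 0 -> (#|C :\: S| <= m)%N.
  move=> SC /hf; rewrite cardsU disjoint_setI0 ?cards0 ?subn0; last first.
    by rewrite disjoint_sym (disjointWl SC).
  by move/addnI => Ss; rewrite cardsDS // Ss; move: sm; clear; rewrite /=; lia.
have e1 := @growth_step R I C Y0 CY0 y f m L L0 suppf LC.
have e2 := @survive_step R I C Y0 CY0 y f _ s.+1 hf erefl.
have e3 : 2 * 2^-1 ^+ s.+1 <= 2 * 2^-1 ^+ (#|C| - m) :> R.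
  rewrite ler_pM2l // ler_wiXn2l //; last by move: sm; clear; rewrite /=; lia.
    by rewrite invr_ge0.
  by rewrite invf_le1 // ler1n.
apply: le_trans (lerD (lerD (lexx _) (ler_wpM2l _ e1)) (le_trans e2 e3)) _.
  by rewrite mulr_ge0 // exprn_ge0 // ltW.
rewrite -/p -[T.+1%:R]natr1 !exprS; set d := 2^-1 ^+ _.
by rewrite le_eqVlt; apply/orP; left; apply/eqP; ring.
Qed.

(** Pigeonhole over the 2^|C| subsets; homogeneity then fixes the size of the chosen one. *)
Lemma weight_pick (s : nat) f : homog (#|Y0| + s)%N f ->
  0 < Z f ->
  exists2 S : {set I}, (S \subset C) && (#|S| == s) &
    Z f <= 2 ^+ #|C| * f (Y0 :|: S) ^+ 2.
Proof.
move=> hf Z0.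
have [S SC Smax] : exists2 S : {set I}, S \subset C &
    Z f <= 2 ^+ #|C| * f (Y0 :|: S) ^+ 2.
  apply/exists_inP; apply: contraTT Z0 => /exists_inPn noS; rewrite -leNgt.
  have lt (S : {set I}) : S \subset C -> 2 ^+ #|C| * f (Y0 :|: S) ^+ 2 < Z f.
    by move=> SC; rewrite ltNge; exact: noS.
  rewrite leNgt; apply/negP => Z0.
  have : \sum_(S in powerset C) 2 ^+ #|C| * f (Y0 :|: S) ^+ 2 < \sum_(S in powerset C) Z f.
    apply: ltr_sum => [|S]; last by rewrite powersetE; exact: lt.
    by apply/hasP; exists C; rewrite ?mem_index_enum // powersetE.
  rewrite -mulr_sumr sumr_const card_powerset -[_ *+ (2 ^ _)]mulr_natl natrX.
  by rewrite (eq_bigl _ _ (fun S => powersetE S C)) ltxx.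
exists S => //; rewrite SC /=; have fS : f (Y0 :|: S) != 0.
  by apply: contraTneq Z0 => fS0; rewrite -leNgt (le_trans Smax) // fS0 expr0n mulr0.
move: (hf _ fS); rewrite cardsU disjoint_setI0 ?cards0 ?subn0; last first.
  by rewrite disjoint_sym (disjointWl SC).
by move/addnI => ->.
Qed.

End GrowthChain.

(** * From one heavy minor to the empty column set *)

(** Tuples are drawn with repetition, so that the average factors coordinate by coordinate, the head
    innermost. [tavg_uniq] bounds the share of tuples with repeated or forbidden entries by O(1 /
    |C|). *)
Fixpoint tavg (R : realFieldType) (I : finType) (C : {set I}) (q : nat)
    (F : seq I -> R) : R :=
  if q is q'.+1 then tavg C q' (fun s => mean C (fun a => F (a :: s))) else F [::].

Section Tavg.
Context (R : realFieldType) (I : finType) (C : {set I}).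
Implicit Types (F G : seq I -> R) (q : nat).

Lemma ler_tavg q F G :
  (forall s, size s = q -> all (fun a => a \in C) s -> F s <= G s) ->
  tavg C q F <= tavg C q G.
Proof.
elim: q F G => [|q IH] F G FG /=; first exact: FG.
apply: IH => s sq sC; apply: ler_mean => a aC.
by apply: FG; rewrite /= ?sq // aC.
Qed.

Lemma eq_tavg q F G : F =1 G -> tavg C q F = tavg C q G.
Proof. by move=> FG; apply/eqP; rewrite eq_le !ler_tavg // => s *; rewrite FG. Qed.

Lemma tavg_cst q (c : R) : C != finset.set0 -> tavg C q (fun=> c) = c.
Proof.
by move=> C0; elim: q => //= q IH; rewrite -[RHS]IH; apply: eq_tavg => s; rewrite mean_cst.
Qed.

Lemma tavgD q F G : tavg C q (fun s => F s + G s) = tavg C q F + tavg C q G.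
Proof.
by elim: q F G => //= q IH F G; rewrite -IH; apply: eq_tavg => s; rewrite meanD.
Qed.

Lemma tavgZ q (c : R) F : tavg C q (fun s => c * F s) = c * tavg C q F.
Proof.
by elim: q F => //= q IH F; rewrite -IH; apply: eq_tavg => s; rewrite meanZ.
Qed.

Lemma tavg_ge0 q F : (forall s, 0 <= F s) -> 0 <= tavg C q F.
Proof.
move=> F0; have <- : tavg C q (fun s => 0 * F s) = 0 by rewrite tavgZ mul0r.
by apply: ler_tavg => s _ _; rewrite mul0r.
Qed.

Lemma tavg_le q F (c : R) : 0 <= c -> (forall s, F s <= c) -> tavg C q F <= c.
Proof.
move=> c0 Fc; have [C0|C0] := eqVneq C finset.set0; last first.
  by rewrite -[leRHS](@tavg_cst q c C0); apply: ler_tavg.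
case: q F Fc => [|q] F Fc /=; first exact: Fc.
have -> : tavg C q (fun s => mean C (fun a => F (a :: s))) = tavg C q (fun s => 0 * F s).
  by apply: eq_tavg => s; rewrite mul0r /mean C0 big_set0 mul0r.
by rewrite tavgZ mul0r.
Qed.

Lemma tavg_dense q F (c : R) : C != finset.set0 -> (forall s, F s <= 1) ->
  c *+ 2 <= tavg C q F -> 0 <= c -> c <= tavg C q (fun s => ind (c <= F s)).
Proof.
move=> C0 F1 cF c0; have : tavg C q F <= tavg C q (fun s => ind (c <= F s) + c).
  apply: ler_tavg => s _ _; case: (leP c (F s)) => [_|/ltW]; last by rewrite add0r.
  by rewrite (le_trans (F1 s)) // lerDl.
by rewrite tavgD tavg_cst // mulr2n in cF *; lra.
Qed.

Lemma tavg_mean (T : finType) (A : {set T}) q (F : T -> seq I -> R) :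
  mean A (fun t => tavg C q (F t)) = tavg C q (fun s => mean A (F^~ s)).
Proof.
elim: q F => //= q IH F; rewrite IH; apply: eq_tavg => s /=.
by rewrite mean_exchange.
Qed.

Lemma tavg_chain B ys f q (F : ({set I} -> R) -> seq I -> R) :
  chain B ys f (fun f' => tavg C q (F f'))
  = tavg C q (fun s => chain B ys f (fun f' => F f' s)).
Proof.
elim: ys f => //= y ys IH f; rewrite /expect -tavg_mean.
by apply: eq_mean => w _; exact: IH.
Qed.

Lemma tavg_uniq (U : {set I}) q :
  tavg C q (fun s => ind (~~ (uniq s && all (fun a => a \notin U) s)))
  <= (q * (q + #|U|))%:R / #|C|%:R :> R.
Proof.
elim: q => [|q IH] /=; first by rewrite mul0n mul0r.
apply: le_trans (_ : tavg C q (fun s =>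
     ind (~~ (uniq s && all (fun a => a \notin U) s)) + (q + #|U|)%:R / #|C|%:R) <= _).
  apply: ler_tavg => s sq sC.
  apply: le_trans (_ : mean C (fun a => ind (~~ (uniq s && all (fun a => a \notin U) s))
    + ind (a \in [set x in s] :|: U)) <= _).
    apply: ler_mean => a aC; rewrite !inE.
    by case: (a \in s); case: (a \in U); case: uniq; case: all;
      rewrite /= ?addr0 ?add0r ?lerDl ?lerDr.
  rewrite meanD lerD //; first exact: mean_cst_le.
  rewrite /mean ler_wpM2r ?invr_ge0 // -natr_sum ler_nat -big_mkcondr sum1_card.
  apply: (@leq_trans #|[set x in s] :|: U|).
    by apply: subset_leq_card; apply/subsetP => x /andP[].
  rewrite (leq_trans (leq_card_setU _ _)) // leq_add2r -sq.
  by rewrite cardsE card_size.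
have c0 : 0 <= (q + #|U|)%:R / #|C|%:R :> R by rewrite divr_ge0.
rewrite tavgD; apply: le_trans (lerD IH (tavg_le q c0 (fun=> lexx _))) _.
rewrite -mulrDl ler_wpM2r ?invr_ge0 // -natrD ler_nat; lia.
Qed.

End Tavg.

Section Archimedean.
Context (R : archiRealFieldType).

Lemma ex_nat_ge (x : R) : exists2 n, (0 < n)%N & x <= n%:R.
Proof.
exists (Num.bound `|x|).+1; first by [].
apply: ltW; apply: le_lt_trans (ler_norm x) _.
by apply: lt_le_trans (archi_boundP (normr_ge0 x)) _; rewrite ler_nat.
Qed.

Lemma ex_div_le (x y : R) : 0 < y -> exists2 n, (0 < n)%N & x / n%:R <= y.
Proof.
move=> y0; have [n n0 xn] := ex_nat_ge (x / y); exists n => //.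
by rewrite ler_pdivrMr ?ltr0n // mulrC -ler_pdivrMr.
Qed.

Lemma ex_expr_le (a y : R) : 0 <= a -> a < 1 -> 0 < y -> exists n, a ^+ n <= y.
Proof.
move=> a0 a1 y0; have [->|an0] := eqVneq a 0; first by exists 1; rewrite expr1 ltW.
have {a0}an : 0 < a by rewrite lt0r an0.
have b0 : 0 < a^-1 - 1 by rewrite subr_gt0 invf_gt1.
have [n _ nb] := ex_nat_ge (y^-1 / (a^-1 - 1)); exists n.
have bern k : 1 + k%:R * (a^-1 - 1) <= a^-1 ^+ k.
  elim: k => [|k IH]; first by rewrite mul0r addr0 expr0.
  rewrite exprS; have a1' : 1 <= a^-1 by rewrite -subr_ge0 ltW.
  apply: le_trans (ler_wpM2l _ IH); last by rewrite invr_ge0 ltW.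
  have := mulr_ge0 (ler0n R k) (sqr_ge0 (a^-1 - 1)); rewrite -[k.+1%:R]natr1 expr2; nra.
rewrite -[y]invrK -[a]invrK exprVn lef_pV2 ?posrE ?invr_gt0 ?exprn_gt0 ?invr_gt0 //.
apply: le_trans (bern n); move: nb; rewrite ler_pdivrMr // => nb.
by rewrite (le_trans nb) // lerDr.
Qed.

End Archimedean.

(** * Removing all columns of a large constant-size set with probability close to 1 *)

Section Game.
Context (R : realFieldType) (I : finType) (C Y0 : {set I}) (K : R).
Hypothesis CY0 : [disjoint C & Y0].
Implicit Types (f : {set I} -> R) (S T : {set I}) (s : seq I) (ys : seq (I -> R)).

Definition heavy f S := K <= `|f (Y0 :|: S)|.
Definition hv f s := [&& uniq s, all (fun a => a \in C) s & heavy f [set x in s]].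

Definition covers f S T z :=
  [&& S \subset T, T \subset C, #|T :\: S| == z & heavy f T].

Lemma heavy_step y f S T : S \subset T -> T \subset C -> heavy f T ->
  expect (fun w => ind (~~ [exists T' : {set I},
     covers (D (mixrow C y w) f) S T' #|T :\: S|.-1])) <= 2^-1 ^+ #|T :\: S| :> R.
Proof.
move=> ST TC hT; apply: le_trans (star_step y f CY0 TC (subsetDl T S)).
apply: ler_expect => w; rewrite ler_nat; case: existsP => //= noT.
rewrite lt0b; apply/existsP => -[j /andP[jTS hj]]; apply: noT; exists (T :\ j).
have [jS jT] : j \notin S /\ j \in T by move: jTS; rewrite inE => /andP[].
apply/and4P; split.
- by rewrite subsetD1 ST.
- by rewrite (subset_trans (subsetDl _ _)).
- rewrite -(eqP (_ : #|(T :\: S) :\ j| == #|T :\: S|.-1)).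
    by apply/eqP; apply: eq_card => x; rewrite !inE andbCA.
  by rewrite (cardsD1 j (T :\: S)) jTS.
- exact: le_trans hT hj.
Qed.

(* A heavy set loses its elements outside S one by one; when k of them are left
   the step fails with probability at most 2 ^- k. *)
Lemma heavy_path ys f S T z :
  S \subset T -> T \subset C -> heavy f T -> #|T :\: S| = (z + size ys)%N ->
  chain C ys f (fun f' => ind (~~ [exists T' : {set I}, covers f' S T' z]))
  <= 2^-1 ^+ z - 2^-1 ^+ (z + size ys).
Proof.
elim: ys f T => [|y ys IH] f T ST TC hT cT /=.
  rewrite addn0 subrr; case: existsP => //= noT; case: noT; exists T.
  by rewrite /covers ST TC hT cT addn0 eqxx.
apply: le_trans (_ : expect (fun w => ind (~~ [exists T' : {set I},
     covers (D (mixrow C y w) f) S T' #|T :\: S|.-1])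
   + (2^-1 ^+ z - 2^-1 ^+ (z + size ys))) <= _).
  apply: ler_expect => w; case: existsP => [[T' /and4P[ST' T'C /eqP cT' hT']]|_] /=.
    by rewrite add0r (IH _ T') // cT' cT /= addnS.
  rewrite -[leLHS]addr0 lerD ?chain_le // => [f'|]; first exact: ind_le1.
  rewrite subr_ge0 ler_wiXn2l ?leq_addr ?invr_ge0 // invf_le1 ?ler1n //.
rewrite /expect meanD -!/(expect _) expect_cst.
apply: le_trans (lerD (heavy_step y ST TC hT) (lexx _)) _.
rewrite cT /= addnS exprS; lra.
Qed.

(** With q rows, success has probability at least the product of 1 - 2^-k over k <= q. The extra
    2^-(q+1) makes the bound 1/4 inductive: (1 - x) (1/4 + x) >= 1/4 + x/2 when 0 <= x <= 1/4. *)
Lemma heavy_end ys f S T :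
  S \subset T -> T \subset C -> heavy f T -> #|T :\: S| = (size ys).+1 ->
  forall y, 1 / 4 + 2^-1 ^+ (size ys).+2 <=
  chain C (y :: ys) f (fun f' => ind (heavy f' S)).
Proof.
elim: ys f T => [|y' ys IH] f T ST TC hT cT y.
  pose ok w := [exists T' : {set I}, covers (D (mixrow C y w) f) S T' #|T :\: S|.-1].
  have := heavy_step y ST TC hT; rewrite (@expect_compl _ _ ok) cT => ok_ge.
  rewrite /= expr2; apply: le_trans (_ : expect (fun w => ind (ok w)) <= _).
    by move: ok_ge; rewrite expr1; lra.
  apply: ler_expect => w; case: (boolP (ok w)) => [|_]; last exact: ler0n.
  move=> /existsP[T' /and4P[ST' _ /eqP cT' hT']] /=.
  suff -> : S = T' by rewrite hT'.
  apply/eqP; rewrite eqEsubset ST' -setD_eq0 -cards_eq0 cT' cT.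
  by [].
set b : R := 1 / 4 + 2^-1 ^+ (size ys).+2.
have b0 : 0 <= b by rewrite addr_ge0 ?divr_ge0 // exprn_ge0 // invr_ge0.
pose ok w := [exists T' : {set I}, covers (D (mixrow C y w) f) S T' #|T :\: S|.-1].
have := heavy_step y ST TC hT; rewrite (@expect_compl _ _ ok) cT => ok_ge.
apply: le_trans (_ : expect (fun w => b * ind (ok w)) <= _); last first.
  apply: ler_expect => w; case: (boolP (ok w)) => [/existsP|_] /=; last first.
    by rewrite mulr0 expect_ge0 // => w'; apply: chain_ge0 => f'; exact: ler0n.
  move=> [T' /and4P[ST' T'C /eqP cT' hT']]; rewrite mulr1.
  by apply: (IH _ T') => //; rewrite cT' cT.
rewrite /expect meanZ -/(expect _) /b; set e := expect _ in ok_ge *.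
rewrite /= in ok_ge; set t : R := 2^-1 ^+ (size ys) .
have t0 : 0 <= t by rewrite exprn_ge0 // invr_ge0.
have t1 : t <= 1 by rewrite exprn_ile1 ?invr_ge0 // invf_le1 ?ler1n.
rewrite !exprS -/t in ok_ge b0 *; nra.
Qed.

Definition lost f : R := ind (~~ heavy f finset.set0).

End Game.

(* The density of heavy tuples drops at most by a factor 4 at each step: the
   sets with many heavy extensions are killed with probability O(1 / L). *)
Lemma dense_linear (R : archiRealFieldType) (q : nat) (del th : R) :
  0 < del -> 0 < th -> exists u0 : nat,
  forall (I : finType) (C Y0 : {set I}) (K : R) (f : {set I} -> R) ys,
    [disjoint C & Y0] -> (u0 <= #|C|)%N -> size ys = q ->
    del <= tavg C q (fun s => ind (hv C Y0 K f s)) ->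
    chain C ys f (lost Y0 K) <= th.
Proof.
elim: q del th => [|q IH] del th del0 th0.
  exists 0%N => I C Y0 K f [|y ys] //= _ _ _; rewrite /hv /lost /=.
  rewrite set_nil.
  by case: heavy => /=; [move=> _; exact: ltW|rewrite leNgt del0].
have del4 : 0 < del / 4 by rewrite divr_gt0.
have th2 : 0 < th / 2 by rewrite divr_gt0.
have [u1 Hu1] := IH _ _ del4 th2.
(* A mean loss of density 2 / L reaches del / 4 with probability at most 8 / (del L). The choice of
   u2 below ensures that a share del / 2 of C has L^2 elements. *)
have [L L0 HL] := @ex_div_le R (8 / del) (th / 2) th2.
have [u2 u20 Hu2] := @ex_nat_ge R ((L ^ 2)%:R * 2 / del).
exists (maxn u1 u2) => I C Y0 K f [|y ys] //= CY0; rewrite geq_max => /andP[u1C u2C].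
move=> [sys] dense.
have C0 : C != finset.set0 by rewrite -card_gt0 (leq_trans u20).
have Cpos : 0 < #|C|%:R :> R by rewrite ltr0n card_gt0.
pose deg s := mean C (fun a => ind (hv C Y0 K f (a :: s)) : R).
pose good s := del / 2 <= deg s.
have hgood : del / 2 <= tavg C q (fun s => ind (good s)).
  apply: tavg_dense => // [s||]; last by rewrite divr_ge0 // ltW.
    by apply: mean_le => // a _; exact: ind_le1.
  by apply: le_trans dense; rewrite mulr2n; lra.
pose bad w : R := tavg C q (fun s => ind (good s && ~~ hv C Y0 K (D (mixrow C y w) f) s)).
have good_survives s :
    expect (fun w => ind (good s && ~~ hv C Y0 K (D (mixrow C y w) f) s)) <= 2 / L%:R :> R.
  have [gs|_] := boolP (good s); last by apply: expect_le => w; rewrite divr_ge0.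
  pose A := [set a in C | hv C Y0 K f (a :: s)].
  have LA : (L ^ 2 <= #|A|)%N.
    rewrite -(ler_nat R); move: gs; rewrite /good /deg /mean ler_pdivlMr //.
    rewrite -natr_sum -big_mkcondr /= sum1_card => gs.
    have -> : #|A| = #|[pred a in C | hv C Y0 K f (a :: s)]|.
      by apply: eq_card => a; rewrite !inE.
    apply: le_trans gs; move: Hu2; rewrite ler_pdivrMr // => Hu2.
    have : u2%:R <= #|C|%:R :> R by rewrite ler_nat.
    by move=> /(ler_wpM2r (ltW del0)); lra.
  have [a aA] : exists a, a \in A.
    by apply/set0Pn; rewrite -card_gt0 (leq_trans _ LA) // expn_gt0 L0.
  move: (aA); rewrite inE => /andP[_ /and3P[/andP[_ us0] /andP[_ sC0] _]].
  have us : uniq s := us0; have sC : all (fun a => a \in C) s := sC0.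
  pose S := [set x in s]; have SC : S \subset C.
    by apply/subsetP => x; rewrite inE; exact: (allP sC).
  pose w0 := \sum_(m | (m \notin C) && (m \notin Y0 :|: S)) y m * f (m |: (Y0 :|: S)).
  pose u m := if m \in C :\: S then f (Y0 :|: (m |: S)) else 0.
  apply: le_trans (@small_ball_scalar R I u w0 K A L L0 LA _); last first.
    move=> m; rewrite inE => /andP[mC /and3P[/andP[ms _] _]]; rewrite /u !inE ms mC.
    rewrite /heavy (_ : [set x in m :: s] = m |: S) //.
    by apply/setP => x; rewrite !inE.
  apply: ler_expect => w; rewrite /hv us sC /= /heavy -ltNge D_mixrow //.
  rewrite ler_nat addrC -/w0 (_ : \sum_(m in C :\: S) _ = \sum_i sg R (w i) * u i) //.
  rewrite [LHS]big_mkcond; apply: eq_bigr => m _; rewrite /u.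
  by case: ifP; rewrite ?mulr0.
have Ebad : expect bad <= 2 / L%:R.
  rewrite /bad /expect tavg_mean; apply: tavg_le => //; first by rewrite divr_ge0.
have step w : chain C ys (D (mixrow C y w) f) (lost Y0 K) <= ind (del / 4 <= bad w) + th / 2.
  have [_|few] := leP (del / 4) (bad w).
    rewrite -[leLHS]addr0 lerD ?(ltW th2) // chain_le // => f'; exact: ind_le1.
  rewrite add0r; apply: Hu1 => //.
  have : tavg C q (fun s => ind (good s)) <=
     tavg C q (fun s => ind (hv C Y0 K (D (mixrow C y w) f) s)
       + ind (good s && ~~ hv C Y0 K (D (mixrow C y w) f) s)) :> R.
    apply: ler_tavg => s _ _.
    by case: (good s); case: hv; rewrite /= ?addr0 ?add0r.
  by rewrite tavgD -/(bad w); lra.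
apply: le_trans (ler_expect step) _; rewrite /expect meanD -!/(expect _) expect_cst.
have : expect (fun w => ind (del / 4 <= bad w)) <= expect bad / (del / 4).
  by apply: mean_markov => // w _; apply: tavg_ge0.
have : expect bad / (del / 4) <= 8 / del / L%:R.
  rewrite ler_pdivrMr // (le_trans Ebad) // le_eqVlt; apply/orP; left; apply/eqP.
  by field; rewrite gt_eqF ?ltr0n //= gt_eqF.
lra.
Qed.

Section Trials.
Context (R : archiRealFieldType) (I : finType) (C Y0 : {set I}) (K : R) (z : nat).
Hypothesis CY0 : [disjoint C & Y0].
Implicit Types (f : {set I} -> R) (S T : {set I}) (s : seq I).
Implicit Types (ys : seq (I -> R)) (yss : seq (seq (I -> R))).

(** The situation z rows before a checkpoint: the tuple lies in a heavy set with exactly z elements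
    to lose. *)
Definition covered f s : bool :=
  [&& uniq s, all (fun a => a \in C) s &
   [exists T : {set I}, covers C Y0 K f [set x in s] T z]].
Definition well_covered f j := 1 / 2 <= tavg C (j * z) (fun s => ind (covered f s)) :> R.
Definition dense f j := 1 / 16 <= tavg C (j * z) (fun s => ind (hv C Y0 K f s)) :> R.

(** A covered tuple becomes heavy with probability at least 1/4, so the mean density of heavy tuples
    is at least 1/8; reverse Markov leaves density 1/16 with probability at least 1/16. *)
Lemma trial ys f j : (0 < z)%N -> size ys = z -> well_covered f j ->
  chain C ys f (fun f' => ind (~~ dense f' j)) <= 15 / 16.
Proof.
move=> z0 sys cov.
have : 1 / 8 <= chain C ys f (fun f' => tavg C (j * z) (fun s => ind (hv C Y0 K f' s))).
  rewrite tavg_chain; apply: le_trans (_ : tavg C (j * z) (fun s => 1 / 4 * ind (covered f s)) <= _).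
    by rewrite tavgZ; move: cov; rewrite /well_covered; lra.
  apply: ler_tavg => s _ _; have [|_] := boolP (covered f s); last first.
    by rewrite mulr0; apply: chain_ge0 => f'; exact: ler0n.
  move=> /and3P[us sC /existsP[T /and4P[sT TC /eqP cT hT]]]; rewrite mulr1.
  case: ys sys => [|y ys] sys; first by move: z0; rewrite -sys.
  rewrite /hv us sC /=; apply: le_trans (heavy_end CY0 sT TC hT _ y); last first.
    by rewrite cT -sys.
  by rewrite lerDl exprn_ge0 // invr_ge0.
have : chain C ys f (fun f' => tavg C (j * z) (fun s => ind (hv C Y0 K f' s)))
    <= chain C ys f (fun f' => (1 + 1 / 16) + - 1 * ind (~~ dense f' j)).
  apply: ler_chain => f'; rewrite /dense; case: (leP (1 / 16) _) => /=; last by lra.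
  move=> _; rewrite mulr0 addr0; apply: (@le_trans _ _ 1); last by lra.
  by apply: tavg_le => // s; exact: ind_le1.
rewrite chainD chainZ chain_cst; lra.
Qed.

(** The expected number of checkpoints along the chain at which coverage fails, that is their union
    bound. *)
Fixpoint failures yss f : R :=
  if yss is ys :: yss' then
    ind (~~ well_covered f (size yss')) + chain C ys f (failures yss')
  else 0.

Lemma failures_ge0 yss f : 0 <= failures yss f.
Proof.
by elim: yss f => //= ys yss IH f; rewrite addr_ge0 // chain_ge0.
Qed.

(* Either some checkpoint is dense, and then the game is won by [dense_linear],
   or every well-covered checkpoint is a fresh trial failing with probability
   at most 15/16. *)
Lemma trials_lost (e : R) yss f : (0 < z)%N -> 0 <= e ->
  all (fun ys => size ys == z) yss ->
  (forall j ys f, (0 < j <= size yss)%N -> size ys = (j * z)%N -> dense f j ->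
     chain C ys f (lost Y0 K) <= e) ->
  chain C (flatten yss) f (lost Y0 K)
  <= ind (~~ dense f (size yss)) * (15 / 16) ^+ size yss + failures yss f + e.
Proof.
move=> z0 e0; elim: yss f => [|ys yss IH] f /=.
  move=> _ _; rewrite expr0 mulr1 addr0 /dense mul0n /= /lost /hv /=.
  rewrite set_nil.
  case: heavy => /=; first by rewrite addr_ge0.
  have -> : (1 / 16 <= 0 :> R) = false by apply/negbTE; rewrite -ltNge divr_gt0.
  by rewrite /= lerDl.
move=> /andP[/eqP sys syss] win.
have [df|ndf] := boolP (dense f (size yss).+1).
  rewrite mul0r add0r; apply: le_trans (_ : e <= _); last first.
    by rewrite lerDr (failures_ge0 (ys :: yss)).
  apply: (win (size yss).+1) => //; rewrite ?ltnSn //.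
  rewrite size_cat sys size_flatten mulSn; congr (_ + _)%N.
  by elim: (yss) syss => //= a l IHl /andP[/eqP -> /IHl ->]; rewrite mulSn.
rewrite mul1r chain_cat.
have {}IH f' := IH f' syss (fun j ys f h => win j ys f (andb_true_intro
   (conj (proj1 (andP h)) (leqW (proj2 (andP h)))))).
have [wc|nwc] := boolP (well_covered f (size yss)); last first.
  rewrite addrAC [1 + _]addrC addrA -[leLHS]add0r lerD //.
    by rewrite !addr_ge0 ?exprn_ge0 ?divr_ge0 // chain_ge0 // => f'; exact: failures_ge0.
  by apply: chain_le => f'; apply: chain_le => g; exact: ind_le1.
rewrite add0r; apply: le_trans (ler_chain _ _ _ IH) _.
rewrite !chainD chain_cst !lerD2r exprSr.
apply: (@le_trans _ _ (chain C ys f (fun f' =>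
    (15 / 16) ^+ size yss * ind (~~ dense f' (size yss))))).
  by apply: ler_chain => f'; rewrite mulrC.
by rewrite chainZ ler_wpM2l ?exprn_ge0 ?divr_ge0 // trial.
Qed.

Lemma failures_le ys0 yss (eta : R) : (0 < z)%N ->
  all (fun ys => size ys == z) yss -> (size ys0 + size yss * z = #|C|)%N ->
  (forall ys j f, (j < size yss)%N -> (size ys + j.+1 * z = #|C|)%N ->
    heavy Y0 K f C -> chain C ys f (fun f' => ind (~~ well_covered f' j)) <= eta) ->
  forall f, heavy Y0 K f C -> chain C ys0 f (failures yss) <= (size yss)%:R * eta.
Proof.
move=> z0; elim: yss ys0 => [|ys yss IH] ys0 /=.
  by move=> *; rewrite chain_cst mul0r.
move=> /andP[/eqP sys syss] szE cov f hf; rewrite chainD -chain_cat.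
rewrite -natr1 mulrDl mul1r addrC lerD //; last exact: cov.
apply: IH => //; first by rewrite size_cat sys -szE mulSn addnA.
by move=> ys' j f' jy; apply: cov; rewrite ltnS ltnW.
Qed.

(** Starting from the heavy set C, [heavy_path] covers each fixed tuple of distinct elements except
    with probability 2^-z. The second term counts tuples with repetitions, and the factor 2 is
    Markov at level 1/2. *)
Lemma uncovered_le ys j f : (0 < #|C|)%N -> (size ys + j.+1 * z = #|C|)%N ->
  heavy Y0 K f C -> chain C ys f (fun f' => ind (~~ well_covered f' j))
    <= 2 * (2^-1 ^+ z + (j * z * (j * z))%:R / #|C|%:R).
Proof.
move=> C0 szE hC; have C0' : C != finset.set0 by rewrite -card_gt0.
apply: le_trans (_ : chain C ys f (fun f' =>
    2 * tavg C (j * z) (fun s => ind (~~ covered f' s))) <= _).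
  apply: ler_chain => f'; rewrite /well_covered.
  case: (leP (1 / 2) _) => /= [_|lt].
    by rewrite mulr_ge0 // tavg_ge0.
  have : tavg C (j * z) (fun s => ind (covered f' s) + ind (~~ covered f' s)) = 1 :> R.
    rewrite -[RHS](tavg_cst (j * z) 1 C0'); apply: eq_tavg => s.
    by case: covered; rewrite ?addr0 ?add0r.
  by rewrite tavgD; lra.
rewrite chainZ ler_pM2l // tavg_chain.
apply: le_trans (_ : tavg C (j * z) (fun s => 2^-1 ^+ z +
   ind (~~ (uniq s && all (fun a => a \notin finset.set0) s))) <= _); last first.
  rewrite tavgD tavg_cst // lerD2l; have := tavg_uniq R C finset.set0 (j * z).
  by rewrite cards0 addn0.
apply: ler_tavg => s ss sC; have -> : all (fun a => a \notin finset.set0) s.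
  by apply/allP => a _; rewrite inE.
rewrite /covered sC; have [us|nus] := boolP (uniq s); last first.
  by rewrite chain_cst lerDr exprn_ge0 // invr_ge0.
rewrite addr0 /=; pose S := [set x in s].
have SC : S \subset C by apply/subsetP => x; rewrite inE; exact: (allP sC).
have cS : #|C :\: S| = (z + size ys)%N.
  rewrite cardsDS // cardsE (card_uniqP us) ss -szE mulSn addnCA addnA addnK.
  by rewrite addnC.
apply: le_trans (heavy_path CY0 SC (subxx C) hC cS) _.
by rewrite lerBlDr lerDl exprn_ge0 // invr_ge0.
Qed.

End Trials.

(** K is never lowered, since heaviness passes from set to set. The order of choices matters: first
    the number M of trials, to make (15/16)^M small, then z so that all M checkpoints are covered,
    then |C| large against (M z)^2 and for [dense_linear] at every checkpoint. *)
Lemma game_lost (R : archiRealFieldType) (th : R) : 0 < th -> exists u0 : nat,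
  forall (I : finType) (C Y0 : {set I}) (K : R) (f : {set I} -> R) ys,
    [disjoint C & Y0] -> (u0 <= #|C|)%N -> size ys = #|C| -> heavy Y0 K f C ->
    chain C ys f (lost Y0 K) <= th.
Proof.
move=> th0; have th4 : 0 < th / 4 by rewrite divr_gt0.
have a0 : 0 <= 15 / 16 :> R by rewrite divr_ge0.
have a1 : 15 / 16 < 1 :> R by lra.
have [M HM] := ex_expr_le a0 a1 th4.
have M0 : 0 < th / 4 / 2 / M.+1%:R by rewrite !divr_gt0.
have h0 : 0 <= 2^-1 :> R by rewrite invr_ge0.
have h1 : 2^-1 < 1 :> R by lra.
have [z0 Hz0] := ex_expr_le h0 h1 M0.
pose z := z0.+1; have Hz : M%:R * (2 * 2^-1 ^+ z) <= th / 4.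
  have : 2^-1 ^+ z <= th / 4 / 2 / M.+1%:R.
    by apply: le_trans Hz0; rewrite ler_wiXn2l // ltW.
  rewrite ler_pdivlMr ?ltr0n // => H.
  have : 0 <= 2^-1 ^+ z :> R by rewrite exprn_ge0.
  by move: H; rewrite -[M.+1%:R]natr1 mulrDr mulr1; lra.
have [u1 u10 Hu1] := @ex_div_le R (M%:R * (2 * (M * z * (M * z))%:R)) (th / 4) th4.
have d0 : 0 < 1 / 16 :> R by rewrite divr_gt0.
have [u2 Hu2] : exists u2 : nat, forall j, (j <= M)%N ->
    forall (I : finType) (C Y0 : {set I}) (K : R) (f : {set I} -> R) ys,
    [disjoint C & Y0] -> (u2 <= #|C|)%N -> size ys = (j * z)%N ->
    1 / 16 <= tavg C (j * z) (fun s => ind (hv C Y0 K f s)) :> R ->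
    chain C ys f (lost Y0 K) <= th / 4.
  elim: (M) => [|M' [u2 Hu2]].
    have [u2 Hu2] := dense_linear (0 * z) d0 th4; exists u2 => j.
    by rewrite leqn0 => /eqP ->.
  have [u3 Hu3] := dense_linear (M'.+1 * z) d0 th4; exists (maxn u2 u3) => j.
  rewrite leq_eqVlt ltnS => /orP[/eqP->|jM] I C Y0 K f ys CY0; rewrite geq_max => /andP[h2 h3].
    exact: Hu3.
  exact: (Hu2 j jM).
exists (maxn (maxn u1 u2) (M * z)) => I C Y0 K f ys CY0.
rewrite !geq_max => /andP[/andP[h1C h2C] MzC] sys hC.
have C0 : (0 < #|C|)%N by exact: leq_trans h1C.
pose ys0 := take (#|C| - M * z) ys.
pose yss := reshape (nseq M z) (drop (#|C| - M * z) ys).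
have sz0 : size ys0 = (#|C| - M * z)%N by rewrite size_takel // sys leq_subr.
have sumz : sumn (nseq M z) = (M * z)%N by rewrite sumn_nseq mulnC.
have szd : size (drop (#|C| - M * z) ys) = sumn (nseq M z).
  by rewrite size_drop sys sumz subKn.
have shp : shape yss = nseq M z by rewrite reshapeKl // szd.
have szyss : size yss = M by rewrite -(size_map size) -/(shape yss) shp size_nseq.
have ally : all (fun ys => size ys == z) yss.
  have : all (pred1 z) (shape yss) by rewrite shp all_nseq /= eqxx orbT.
  by rewrite /shape all_map.
have -> : ys = ys0 ++ flatten yss by rewrite reshapeKr ?szd // cat_take_drop.
rewrite chain_cat.
have step f' := @trials_lost R I C Y0 K z CY0 (th / 4) yss f' (ltn0Sn _) (ltW th4) ally.
have win j ys' f' : (0 < j <= size yss)%N -> size ys' = (j * z)%N ->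
    dense C Y0 K z f' j -> chain C ys' f' (lost Y0 K) <= th / 4.
  by rewrite szyss => /andP[_ jM] sy dj; exact: (Hu2 j).
apply: le_trans (ler_chain _ _ _ (fun f' => step f' win)) _.
rewrite !chainD chain_cst.
have B1 : chain C ys0 f (fun f' => ind (~~ dense C Y0 K z f' (size yss)) * (15 / 16) ^+ size yss)
    <= th / 4.
  apply: chain_le => f'; apply: le_trans HM; rewrite szyss -[leRHS]mul1r.
  by rewrite ler_wpM2r ?exprn_ge0 ?ind_le1.
have B2 : chain C ys0 f (failures C Y0 K z yss) <= th / 4 + th / 4.
  apply: le_trans (failures_le (eta := 2 * (2^-1 ^+ z + (M * z * (M * z))%:R / #|C|%:R)) _ _ _ _ _) _ => //.
  - by rewrite szyss sz0 subnK.
  - move=> ys' j f' jM szE hf; apply: le_trans (uncovered_le CY0 C0 szE hf) _.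
    rewrite ler_pM2l // lerD2l ler_wpM2r ?invr_ge0 // ler_nat.
    by rewrite szyss in jM; rewrite leq_mul // leq_mul // ltnW.
  rewrite szyss mulrDr mulrDr lerD //.
  apply: le_trans Hu1; rewrite !mulrA; apply: ler_wpM2l; first by rewrite !mulr_ge0.
  by rewrite lef_pV2 ?posrE ?ltr0n // ler_nat.
by move: B1 B2; lra.
Qed.

(** * Permanents of minors *)

Section Minors.
Context (R : realFieldType) (I : finType).
Implicit Types (M : I -> I -> R) (X Y : {set I}) (s : {perm I}).

Definition minor_sum M X Y : R :=
  \sum_(s : {perm I} | s @: X == Y) \prod_(i | i \notin X) M i (s i).

(* The permanent of the rows outside X and the columns outside Y; the factor
   #|X|! counts the ways of extending a bijection by one from X to Y. *)
Definition pm M X Y : R := minor_sum M X Y / (#|X|`!)%:R.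

Lemma pm_homog M X : homog #|X| (pm M X).
Proof.
move=> Y; apply: contraNeq => XY; rewrite /pm /minor_sum big1 ?mul0r // => s /eqP sX.
by move: XY; rewrite -sX card_imset ?eqxx //; exact: perm_inj.
Qed.

Lemma minor_sum_row M X Y r : r \in X ->
  minor_sum M (X :\ r) Y
  = \sum_(m | m \notin Y) M r m *
      \sum_(s : {perm I} | (s @: X == m |: Y) && (s r == m))
        \prod_(i | i \notin X) M i (s i).
Proof.
move=> rX; rewrite /minor_sum (partition_big (fun s : {perm I} => s r)
   (fun m => m \notin Y)) /=; last first.
  move=> s /eqP <-; rewrite mem_imset; last exact: perm_inj.
  by rewrite !inE eqxx.
apply: eq_bigr => m mY; rewrite mulr_sumr; apply: eq_big => s.
  rewrite andbC [RHS]andbC; have [srm|] //= := eqVneq (s r) m.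
  apply/eqP/eqP => [<-|sX].
    by rewrite -{1}(setD1K rX) imsetU1 srm.
  apply/setP => j; apply/imsetP/idP => [[i + ->]|jY].
    rewrite !inE => /andP[ir iX]; have : s i \in m |: Y by rewrite -sX imset_f.
    by rewrite in_setU1 -srm (inj_eq perm_inj) (negbTE ir).
  have : j \in s @: X by rewrite sX in_setU1 jY orbT.
  case/imsetP => i iX jE; exists i => //; rewrite !inE iX andbT.
  by apply: contraTneq jY => ir; rewrite jE ir srm.
move=> /andP[/eqP sX /eqP srm]; rewrite (bigD1 r) /=; last by rewrite !inE eqxx.
rewrite srm; congr (_ * _); apply: eq_bigl => i; rewrite !inE negb_and negbK.
by have [->|_] /= := eqVneq i r; rewrite ?rX // andbT.
Qed.

(** All values of s at r in m |: Y contribute equally: composing with a transposition of two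
    elements of m |: Y leaves the rows outside X alone. Hence the factor |X|. *)
Lemma minor_sum_col M X Y r m : r \in X -> m \notin Y ->
  minor_sum M X (m |: Y)
  = #|X|%:R * \sum_(s : {perm I} | (s @: X == m |: Y) && (s r == m))
        \prod_(i | i \notin X) M i (s i).
Proof.
move=> rX mY; rewrite /minor_sum (partition_big (fun s : {perm I} => s r)
   (fun k => k \in m |: Y)) /=; last by move=> s /eqP <-; rewrite imset_f.
set Q := \sum_(s : {perm I} | _) _.
have [cXY|cXY] := eqVneq #|X| #|m |: Y|; last first.
  have none (s : {perm I}) : (s @: X == m |: Y) = false.
    apply: contraNF cXY => /eqP <-; rewrite card_imset //; exact: perm_inj.
  have -> : Q = 0 by apply: big_pred0 => s; rewrite none.
  by rewrite mulr0 big1 // => k _; apply: big_pred0 => s; rewrite none.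
rewrite (eq_bigr (fun=> Q)) ?sumr_const ?cXY ?mulr_natl // => k kY.
rewrite /Q (reindex_inj (mulIg (tperm k m))) /=; apply: eq_big => s.
  rewrite permM; congr (_ && _); last first.
    by rewrite -[X in (_ == X) = _](tpermR k m) (inj_eq perm_inj).
  have tY : tperm k m @: (m |: Y) = m |: Y.
    apply/eqP; rewrite eqEcard card_imset ?leqnn ?andbT; last exact: perm_inj.
    apply/subsetP => _ /imsetP[j jY ->]; case: tpermP => // _.
    by rewrite setU11.
  have -> : (s * tperm k m)%g @: X = tperm k m @: (s @: X).
    by rewrite -imset_comp; apply: eq_imset => i; rewrite /= permM.
  apply/eqP/eqP => [sX|->//]; apply: (imset_inj (@perm_inj _ (tperm k m))).
  by rewrite sX.
move=> /andP[/eqP sX _]; apply: eq_bigr => i iX; rewrite permM; congr (M i _).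
have si : tperm k m (s i) \notin m |: Y.
  by rewrite -sX -permM mem_imset //; exact: perm_inj.
rewrite -[RHS](tpermK k m) [in RHS]tpermD //; first by apply: contraNneq si => <-.
by apply: contraNneq si => <-; rewrite setU11.
Qed.

Lemma pm_row M X Y r : r \in X -> pm M (X :\ r) Y = D (M r) (pm M X) Y.
Proof.
move=> rX; rewrite /pm minor_sum_row // /D mulr_suml; apply: eq_bigr => m mY.
rewrite (minor_sum_col _ rX mY) -mulrA; congr (_ * _).
rewrite (cardsD1 r X) rX add1n factS natrM mulrAC invfM mulrA.
by rewrite divff ?mul1r ?pnatr_eq0 // mulrC.
Qed.

Lemma pm_tr M X Y : pm (fun i j => M j i) X Y = pm M Y X.
Proof.
have [cXY|ne] := eqVneq #|X| #|Y|; last first.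
  rewrite [LHS](_ : _ = 0) ?[RHS](_ : _ = 0) //; apply/eqP; apply: contraNT ne.
    by move=> /pm_homog ->.
  by move=> /pm_homog ->.
rewrite /pm cXY; congr (_ / _); rewrite /minor_sum (reindex_inj invg_inj) /=.
apply: eq_big => s.
  apply/eqP/eqP => [<-|<-].
    by rewrite -imset_comp (eq_imset (g := id)) ?imset_id // => i /=; rewrite permKV.
  by rewrite -imset_comp (eq_imset (g := id)) ?imset_id // => i /=; rewrite permK.
move=> /eqP sX; rewrite (reindex_inj (@perm_inj _ s)) /=; apply: eq_big => i.
  by rewrite -sX -[i in RHS](permK s) mem_imset //; exact: perm_inj.
by rewrite permK.
Qed.

Lemma pm_local M M' X Y :
  (forall i j, i \notin X -> j \notin Y -> M i j = M' i j) -> pm M X Y = pm M' X Y.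
Proof.
move=> MM'; rewrite /pm; congr (_ / _); apply: eq_bigr => s /eqP sX.
apply: eq_bigr => i iX; apply: MM' => //.
by rewrite -sX mem_imset //; exact: perm_inj.
Qed.

Lemma pm_full M : pm M setT setT = 1.
Proof.
rewrite /pm /minor_sum (eq_bigr (fun=> 1)); last first.
  by move=> s _; apply: big_pred0 => i; rewrite inE.
rewrite sumr_const (eq_card (B := perm_on [set: I])).
  by rewrite card_perm !cardsT divff // pnatr_eq0 -lt0n fact_gt0.
move=> s; transitivity true; last first.
  by symmetry; rewrite unfold_in; apply/subsetP => i _; rewrite inE.
rewrite -[LHS]/(s @: [set: I] == [set: I]) eqEcard subsetT card_imset ?leqnn //; exact: perm_inj.
Qed.

Lemma pm_empty M : pm M finset.set0 finset.set0 = \sum_(s : {perm I}) \prod_i M i (s i).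
Proof.
rewrite /pm cards0 fact0 divr1 /minor_sum; apply: eq_big => s; first by rewrite imset0 eqxx.
by move=> _; apply: eq_bigl => i; rewrite inE.
Qed.

Lemma pm_col M X Y c : c \in Y ->
  pm M X (Y :\ c) = \sum_(k | k \notin X) M k c * pm M (k |: X) Y.
Proof.
move=> cY; rewrite -pm_tr pm_row // /D; apply: eq_bigr => k _.
by rewrite pm_tr.
Qed.

Lemma pm_both M X Y t : t \notin X -> t \notin Y ->
  pm M X Y = M t t * pm M (t |: X) (t |: Y)
  + \sum_(k | k \notin t |: X) \sum_(m | m \notin t |: Y)
       M k t * M t m * pm M (k |: (t |: X)) (m |: (t |: Y)).
Proof.
move=> tX tY; rewrite -{1}(setU1K tX) pm_row ?setU11 // /D (bigD1 t) //=.
congr (_ + _); rewrite exchange_big /=; apply: eq_big => [m|m /andP[mY mt]].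
  by rewrite !inE negb_or andbC.
have tmY : t \notin m |: Y by rewrite in_setU1 negb_or eq_sym mt.
rewrite -(setU1K tmY) pm_col ?setU11 // mulr_sumr; apply: eq_bigr => k _.
rewrite mulrA [M t m * _]mulrC; congr (_ * pm M _ _); exact: setUCA.
Qed.

End Minors.

(** * Random symmetric sign matrices *)

Section Resampling.
Context (R : realFieldType) (J : finType).
Implicit Types (w v : {ffun J -> bool}) (B : {set J}) (F : {ffun J -> bool} -> R).

Definition mix B v w : {ffun J -> bool} := [ffun p => if p \in B then v p else w p].

(** Conditional expectation given the bits outside B, realised by resampling the bits in B. *)
Definition cexp B F w : R := expect (fun v => F (mix B v w)).

Lemma mixT v w : mix setT v w = v.
Proof. by apply/ffunP => p; rewrite ffunE inE. Qed.

Lemma cexpT F w : cexp setT F w = expect F.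
Proof. by apply: eq_expect => v; rewrite mixT. Qed.

Lemma ler_cexp B F G w : (forall v, F v <= G v) -> cexp B F w <= cexp B G w.
Proof. by move=> FG; apply: ler_expect => v. Qed.

Lemma expect_mix B F : expect F = expect (fun w => expect (fun v => F (mix B v w))).
Proof.
pose xr v w : {ffun J -> bool} := [ffun p => ((p \in B) && v p) (+) w p].
have xrK v : involutive (xr v) by move=> w; apply/ffunP => p; rewrite !ffunE addbA addbb.
pose full v w : {ffun J -> bool} := [ffun p => v p (+) w p].
have fullK v : involutive (full v).
  by move=> w; apply/ffunP => p; rewrite !ffunE addbA addbb.
transitivity (expect (fun v => expect (fun w => F (xr v w)))).
  by rewrite -[LHS](@expect_cst R J); apply: eq_expect => v; exact: expect_reindex.
rewrite /expect mean_exchange; apply: eq_mean => w _.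
rewrite -!/(expect _) (expect_reindex _ (fullK w)); apply: eq_expect => v /=.
congr F; apply/ffunP => p; rewrite !ffunE; case: ifP => //= _.
by rewrite addbC addbA addbb.
Qed.

Lemma cexp_sub B B' F w : B' \subset B -> cexp B F w = cexp B (cexp B' F) w.
Proof.
move=> sB; rewrite /cexp (expect_mix B'); apply: eq_expect => v; apply: eq_expect => u.
congr F; apply/ffunP => p; rewrite !ffunE.
have [pB'|] := boolP (p \in B'); first by rewrite (subsetP sB).
by case: ifP.
Qed.

End Resampling.

Section Bits.
Context (R : realFieldType) (I : finType).
Local Notation Omega := {ffun {set I} -> bool}.
Implicit Types (w v : Omega) (B : {set {set I}}) (C X Y : {set I}).
Implicit Types (x : {ffun I -> bool}) (F : Omega -> R) (t m i j : I).

(** Entry (i, j) reads the bit of the set {i, j}, a singleton on the diagonal. Symmetry is built in,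
    and exposing a row is an update of the bits of the edges at one vertex. *)
Definition mat w i j : R := sg R (w [set i; j]).

Lemma matC w i j : mat w i j = mat w j i.
Proof. by rewrite /mat setUC. Qed.

Lemma set2_inj t : injective (fun m => [set t; m]).
Proof.
move=> m k e; have : m \in [set t; k] by rewrite -e !inE eqxx orbT.
rewrite !inE => /orP[/eqP mt|/eqP //]; have : k \in [set t; m] by rewrite e !inE eqxx orbT.
by rewrite mt !inE orbb => /eqP.
Qed.

Lemma set2_eq i j t m : [set i; j] = [set t; m] -> i = t \/ i = m.
Proof.
by move=> e; have := set21 i j; rewrite e !inE => /orP[/eqP|/eqP]; [left|right].
Qed.

Definition bit t C (p : {set I}) := [pick m in C | p == [set t; m]].

Lemma bit_in t C m : m \in C -> bit t C [set t; m] = Some m.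
Proof.
rewrite /bit; case: pickP => [k /andP[_ /eqP/set2_inj ->] //|no mC].
by have := no m; rewrite mC eqxx.
Qed.

Lemma bit_out t C p : (forall m, m \in C -> p != [set t; m]) -> bit t C p = None.
Proof.
move=> no; rewrite /bit; case: pickP => // m /andP[mC].
by rewrite (negbTE (no m mC)).
Qed.

Lemma bitP t C p m : bit t C p = Some m -> m \in C /\ p = [set t; m].
Proof. by rewrite /bit; case: pickP => // k /andP[kC /eqP pk] [<-]. Qed.

Definition upd t C x w : Omega :=
  [ffun p => if bit t C p is Some m then x m else w p].

(** Adding independent bits on the edges from t to C preserves the law, so the signs of row t on C
    can be averaged separately, as a function on vertices. *)
Lemma cexp_refresh B t C F w : (forall m, m \in C -> [set t; m] \in B) ->
  cexp B F w = cexp B (fun v => expect (fun x => F (upd t C x v))) w.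
Proof.
move=> tCB; pose xr x v : Omega :=
  [ffun p => (if bit t C p is Some m then x m else false) (+) v p].
have xrK x : involutive (xr x) by move=> v; apply/ffunP => p; rewrite !ffunE addbA addbb.
pose sh v x : {ffun I -> bool} := [ffun m => v [set t; m] (+) x m].
have shK v : involutive (sh v) by move=> x; apply/ffunP => m; rewrite !ffunE addbA addbb.
transitivity (expect (fun x : {ffun I -> bool} => expect (fun v => F (mix B (xr x v) w)))).
  rewrite -[LHS](@expect_cst R I); apply: eq_expect => x.
  by rewrite [RHS](expect_reindex _ (xrK x)); apply: eq_expect => v /=; rewrite xrK.
rewrite /expect mean_exchange; apply: eq_mean => v _.
rewrite -!/(expect _) (expect_reindex _ (shK v)); apply: eq_expect => x /=.
congr F; apply/ffunP => p; rewrite !ffunE.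
case e: (bit t C p) => [m|//]; have [mC ->] := bitP e.
by rewrite tCB // ffunE addbAC addbb.
Qed.

Lemma mat_upd_row t C x w : mat (upd t C x w) t = mixrow C (mat w t) x.
Proof.
apply: funext => m; rewrite /mat /mixrow ffunE.
case: ifP => [mC|/negbT mC]; first by rewrite bit_in.
by rewrite bit_out // => k kC; apply: contraNneq mC => /set2_inj ->.
Qed.

Lemma map_mat_upd t C x w ts : t \notin ts -> (forall t', t' \in ts -> t' \notin C) ->
  [seq mat (upd t C x w) t' | t' <- ts] = [seq mat w t' | t' <- ts].
Proof.
move=> tts tsC; apply/eq_in_map => t' t'ts; apply: funext => i.
rewrite /mat ffunE bit_out // => m mC.
apply/eqP => /set2_eq[tt'|t'm]; first by rewrite -tt' t'ts in tts.
by have := tsC t' t'ts; rewrite t'm mC.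
Qed.

Fixpoint rerow C (ts : seq I) w F : R :=
  if ts is t :: ts' then expect (fun x => rerow C ts' (upd t C x w) F) else F w.

Lemma ler_rerow C ts w F G : (forall v, F v <= G v) -> rerow C ts w F <= rerow C ts w G.
Proof. by move=> FG; elim: ts w => //= t ts IH w; apply: ler_expect => x. Qed.

Lemma cexp_rerow B ts C F w :
  (forall t m, t \in ts -> m \in C -> [set t; m] \in B) ->
  cexp B F w = cexp B (fun v => rerow C ts v F) w.
Proof.
elim: ts => //= t ts IH tsB; rewrite IH; last first.
  by move=> t' m t'ts; apply: tsB; rewrite inE t'ts orbT.
by apply: cexp_refresh => m; apply: tsB; rewrite inE eqxx.
Qed.

(** Refreshing row t also rewrites the mirror entries (m, t) for m in C. The minors on X do not see
    them because C lies in X, and the later rows do not because [ts] avoids C. *)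
Lemma rerow_chain C X ts w (Phi : ({set I} -> R) -> R) :
  uniq ts -> {subset ts <= X} -> C \subset X -> (forall t, t \in ts -> t \notin C) ->
  rerow C ts w (fun v => Phi (pm (mat v) (X :\: [set t in ts])))
  = chain C [seq mat w t | t <- ts] (pm (mat w) X) Phi.
Proof.
elim: ts X w => [|t ts IH] X w /=.
  move=> _ _ _ _; by rewrite set_nil setD0.
move=> /andP[tts uts] tsX CX tsC; apply: eq_expect => x.
have tX : t \in X by rewrite tsX // mem_head.
have tC : t \notin C by rewrite tsC // mem_head.
rewrite setD_cons IH //; last first.
- by move=> t' t'ts; apply: tsC; rewrite inE t'ts orbT.
- by rewrite subsetD1 CX tC.
- move=> t' t'ts; rewrite !inE tsX ?inE ?t'ts ?orbT // andbT.
  by apply: contraNneq tts => <-.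
rewrite map_mat_upd // => [|t' t'ts]; last by apply: tsC; rewrite inE t'ts orbT.
congr chain; apply: funext => Y; rewrite pm_row // mat_upd_row; congr (D _ _ Y); apply: funext.
move=> Z; apply: pm_local => i j iX _; rewrite /mat ffunE bit_out // => m mC.
by apply: contraNneq iX => /set2_eq[->//|->]; rewrite (subsetP CX).
Qed.

End Bits.

(** * Growth of minors *)

Lemma ler_chain_homog (R : realFieldType) (I : finType) (C : {set I}) ys
    (f : {set I} -> R) c Phi Psi :
  homog (c + size ys)%N f -> (forall g, homog c g -> Phi g <= Psi g) ->
  chain C ys f Phi <= chain C ys f Psi.
Proof.
elim: ys f => [|y ys IH] f /=; first by rewrite addn0 => hf; apply.
rewrite addnS => hf PP; apply: ler_expect => w; apply: IH => //.
exact: homogD.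
Qed.

Section Blocks.
Context (R : realFieldType) (I : finType).
Local Notation Omega := {ffun {set I} -> bool}.
Implicit Types (w v : Omega) (C X Y U T : {set I}).

Definition inner X : {set {set I}} := [set p : {set I} | p \subset X].

(* U collects the vertices whose rows and columns are reserved for later stages. *)
Definition large_minor U (c : nat) (a : R) w :=
  [exists X : {set I}, exists Y : {set I},
    [&& U \subset X, U \subset Y, #|X| == c & a <= pm (mat R w) X Y ^+ 2]].

Context (m L b : nat) (U : {set I}).
Hypotheses (m0 : (0 < m)%N) (L0 : (0 < L)%N).
Let fail : R := 2 ^+ m * (2 / L%:R) ^+ b.+1 + m%:R * (2 * 2^-1 ^+ (3 * m)).
(** Effect of a block on the square of a minor: m rows gain 2 m each, b bad rows are paid for, and
    picking the heaviest minor out of the weight costs at most 2^n. *)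
Definition gain : R := (2 * m)%:R ^+ m / ((2 * #|I|)%:R * (2 * m)%:R) ^+ b / 2 ^+ #|I|.

Lemma inner_mix X w v : pm (mat R (mix (inner X) v w)) X = pm (mat R w) X.
Proof.
apply: funext => Y; apply: pm_local => i j iX _; rewrite /mat ffunE inE subUset sub1set.
by rewrite (negbTE iX).
Qed.

Lemma block_chain C Y0 ys (f : {set I} -> R) (K : R) :
  [disjoint C & Y0] -> (L ^ 2 * (4 * m) <= #|C|)%N -> size ys = m ->
  homog (#|Y0| + #|C|)%N f -> 0 < K -> K <= f (Y0 :|: C) ^+ 2 ->
  chain C ys f (fun g => ind (~~ [exists S : {set I},
    [&& S \subset C, #|C :\: S| == m & K * gain <= g (Y0 :|: S) ^+ 2]])) <= fail.
Proof.
move=> CY0 LC sys hf K0 Kf.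
have C4m : (4 * m <= #|C|)%N by apply: leq_trans LC; rewrite leq_pmull // expn_gt0 L0.
have cI : (0 < #|I|)%N by have := max_card C; move: C4m m0; clear; lia.
pose q : R := (2 * #|C|)%:R * (2 * m)%:R; pose g : R := (2 * m)%:R.
have g0 : 0 < g by rewrite ltr0n; lia.
have q0 : 0 < q by rewrite mulr_gt0 // ltr0n; lia.
have Zf : K <= weight C Y0 f.
  rewrite /weight (bigD1 C) //=; apply: le_trans Kf _.
  by rewrite lerDl sumr_ge0 // => S _; exact: sqr_ge0.
apply: le_trans (_ : chain C ys f (fun f' =>
   ind (weight C Y0 f' * q ^+ b < g ^+ size ys * weight C Y0 f)) <= _); last first.
  have := @growth_chain R I C Y0 m L CY0 m0 L0 LC ys f #|C| b hf (leqnn _).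
  rewrite subnn add0n sys leqnn => /(_ isT) /le_trans; apply; rewrite lerD2l.
  rewrite ler_wpM2l // ler_pM2l // ler_wiXn2l ?invr_ge0 // ?invf_le1 ?ler1n //.
  by move: C4m; clear; lia.
have CmE : (#|Y0| + #|C| = (#|Y0| + (#|C| - m)) + size ys)%N by rewrite sys; move: C4m; clear; lia.
rewrite CmE in hf; apply: (@ler_chain_homog R I C ys f _ _ _ hf) => f' hf'.
rewrite ler_nat; case: ltP => //= [_|good]; first exact: leq_b1.
rewrite leqn0 eqb0 negbK.
have Zf'0 : 0 < weight C Y0 f'.
  rewrite -(pmulr_lgt0 _ (exprn_gt0 b q0)); apply: lt_le_trans good.
  by rewrite mulr_gt0 ?exprn_gt0 // (lt_le_trans K0).
have [S /andP[SC /eqP cS] HS] := weight_pick CY0 hf' Zf'0.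
apply/existsP; exists S; rewrite SC cardsDS // cS subKn ?eqxx /=; last by move: C4m; clear; lia.
have qq : q <= (2 * #|I|)%:R * (2 * m)%:R.
  by rewrite ler_wpM2r // ler_nat leq_mul2l max_card.
have : K * g ^+ m <= q ^+ b * 2 ^+ #|C| * f' (Y0 :|: S) ^+ 2.
  rewrite -mulrA mulrC; move: good; rewrite sys => good.
  apply: le_trans (ler_wpM2l _ Zf) _; first by rewrite exprn_ge0 // ltW.
  apply: le_trans good _; rewrite mulrC; apply: ler_wpM2l => //.
  by rewrite exprn_ge0 // ltW.
move=> H; rewrite /gain !mulrA ler_pdivrMr ?exprn_gt0 // ler_pdivrMr; last first.
  by rewrite exprn_gt0 // (lt_le_trans q0).
apply: le_trans H _; rewrite mulrC -mulrA ler_wpM2l ?sqr_ge0 // mulrC.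
apply: ler_pM; rewrite ?exprn_ge0 ?(ltW q0) //.
  by rewrite ler_weXn2l ?ler1n ?max_card.
by rewrite lerXn2r ?nnegrE ?(ltW q0) // (le_trans (ltW q0)).
Qed.

(** A block uses up m columns of C. Their vertices still have unexposed rows, which form the next T.
    The supply of vertices with row and column both free drops by m per block, whence the bound (4
    L^2 + k) m. *)
Lemma growth_blocks k X Y T w (K : R) :
  T \subset X -> #|T| = m -> U \subset X -> U \subset Y -> [disjoint U & T] ->
  ((4 * L ^ 2 + k) * m <= #|X :&: Y :\: T :\: U|)%N ->
  #|X| = #|Y| -> 0 < K -> K <= pm (mat R w) X Y ^+ 2 ->
  cexp (inner X) (fun v => ind (~~ large_minor U (#|X| - k * m) (K * gain ^+ k) v)) w
  <= k%:R * fail.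
Proof.
have fail0 : 0 <= fail by rewrite addr_ge0 ?mulr_ge0 ?exprn_ge0 ?divr_ge0 ?invr_ge0.
elim: k X Y T w K => [|k IH] X Y T w K TX cT UX UY UT cC cXY K0 HK.
  rewrite mul0r mul0n subn0 expr0 mulr1; apply: expect_le => v.
  rewrite (_ : large_minor _ _ _ _ = true) //; apply/existsP; exists X.
  apply/existsP; exists Y; rewrite UX UY eqxx /=.
  by rewrite (_ : pm _ _ _ = pm (mat R w) X Y) // inner_mix.
pose C := X :&: Y :\: T :\: U; pose Y0 := Y :\: C.
have CX : C \subset X by apply/subsetP => i; rewrite !inE => /and4P[].
have CY : C \subset Y by apply/subsetP => i; rewrite !inE => /and4P[].
have CT t : t \in T -> t \notin C by move=> tT; rewrite !inE tT andbF.
have YE : Y0 :|: C = Y by rewrite setUC -[in RHS](setID Y C) (setIidPr CY).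
have CY0 : [disjoint C & Y0] by rewrite disjoints_subset; apply/subsetP => i iC; rewrite in_setC in_setD iC.
have cXT : #|X :\: T| = (#|X| - m)%N by rewrite cardsDS // cT.
pose F v : R := ind (~~ large_minor U (#|X| - k.+1 * m) (K * gain ^+ k.+1) v).
pose good (g : {set I} -> R) := [exists S : {set I},
    [&& S \subset C, #|C :\: S| == m & K * gain <= g (Y0 :|: S) ^+ 2]].
have LC : (L ^ 2 * (4 * m) <= #|C|)%N.
  by apply: leq_trans cC; rewrite mulnDl mulnA [(_ * 4)%N]mulnC leq_addr.
have gain0 : 0 < gain.
  have C4m : (4 * m <= #|C|)%N by apply: leq_trans LC; rewrite leq_pmull // expn_gt0 L0.
  have cI : (0 < #|I|)%N by have := max_card C; move: C4m m0; clear; lia.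
  have m2 : 0 < (2 * m)%:R :> R by rewrite ltr0n muln_gt0.
  have n2 : 0 < (2 * #|I|)%:R :> R by rewrite ltr0n muln_gt0.
  by rewrite /gain divr_gt0 ?divr_gt0 ?exprn_gt0 ?mulr_gt0.
rewrite -/(F) (@cexp_sub _ _ (inner X) (inner (X :\: T))); last first.
  apply/subsetP => p; rewrite !inE => /subset_trans; apply; exact: subsetDl.
rewrite (@cexp_rerow _ _ (inner X) (enum T) C); last first.
  move=> t i; rewrite mem_enum => tT iC; rewrite inE subUset !sub1set.
  by rewrite (subsetP TX) // (subsetP CX).
apply: expect_le => v; set w1 := mix _ _ _.
have pw1 : pm (mat R w1) X = pm (mat R w) X by exact: inner_mix.
apply: le_trans (_ : rerow C (enum T) w1 (fun v =>
   ind (~~ good (pm (mat R v) (X :\: [set t in enum T]))) + k%:R * fail) <= _).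
  apply: ler_rerow => w2; rewrite set_enum.
  have [|_] := boolP (good _); last first.
    rewrite -[leLHS]addr0 lerD ?mulr_ge0 //; apply: expect_le => u; exact: ind_le1.
  move=> /existsP[S /and3P[SC /eqP cCS HS]]; rewrite add0r.
  have XmE : (#|X| - k.+1 * m = #|X :\: T| - k * m)%N by rewrite cXT mulSn subnDA.
  rewrite /F XmE exprS mulrA.
  have cSC : (#|S| + m = #|C|)%N.
    by rewrite -cCS cardsDS // subnKC // subset_leq_card.
  have UC : [disjoint U & C].
    by rewrite disjoints_subset; apply/subsetP => i iU; rewrite in_setC in_setD iU.
  have UY' : U \subset Y0 :|: S.
    apply/subsetP => i iU; rewrite in_setU in_setD (subsetP UY) // andbT.
    by rewrite (negbT (disjointFr UC iU)).
  apply: (IH _ (Y0 :|: S) (C :\: S)) => //.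
  - apply/subsetP => i; rewrite in_setD => /andP[_ iC]; rewrite in_setD (subsetP CX) // andbT.
    by apply: contraL iC; exact: CT.
  - by rewrite subsetD UX.
  - by apply: disjointWr UC; exact: subsetDl.
  - apply: (@leq_trans #|S|); first by move: cC; rewrite -/C -cSC; clear; lia.
    apply: subset_leq_card; apply/subsetP => i iS; have iC := subsetP SC i iS.
    have iT : i \notin T by apply: contraL iC; exact: CT.
    have iU : i \notin U by apply: contraL iC => iU; rewrite (negbT (disjointFr UC iU)).
    by rewrite !(in_setD, in_setI, in_setU) iS orbT iT iU (subsetP CX).
  - have dC : Y0 :&: C = finset.set0 by apply: disjoint_setI0; rewrite disjoint_sym.
    have dS : Y0 :&: S = finset.set0.
      by apply: disjoint_setI0; rewrite disjoint_sym; apply: disjointWl CY0.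
    by rewrite cXT cXY -YE !cardsU dC dS cards0 !subn0 -cSC addnA addnK.
  - exact: mulr_gt0.
rewrite (@rerow_chain _ _ C X (enum T) w1 (fun g => ind (~~ good g) + k%:R * fail)).
- rewrite chainD chain_cst -natr1 mulrDl mul1r addrC lerD2l pw1.
  apply: block_chain => //.
  + by rewrite size_map -cardE.
  + have -> : (#|Y0| + #|C| = #|X|)%N.
      rewrite cXY -YE cardsU disjoint_setI0 ?cards0 ?subn0 //.
      by rewrite disjoint_sym.
    exact: pm_homog.
  + by rewrite YE.
- exact: enum_uniq.
- by move=> t; rewrite mem_enum; exact: (subsetP TX).
- exact: CX.
- by move=> t; rewrite mem_enum; exact: CT.
Qed.

End Blocks.

(** * Lowering the defect with new vertices *)

Section Bilinear.
Context (R : realFieldType) (I : finType).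
Implicit Types (a b c : I -> R) (x : {ffun I -> bool}).

Definition bil (T : I -> I -> R) a b := \sum_k \sum_m a k * b m * T k m.

Lemma eq_bil T a a' b b' : a =1 a' -> b =1 b' -> bil T a b = bil T a' b'.
Proof. by move=> ea eb; apply: eq_bigr => k _; apply: eq_bigr => m _; rewrite ea eb. Qed.

Lemma bilDl T a b c : bil T (fun k => a k + b k) c = bil T a c + bil T b c.
Proof.
rewrite /bil -big_split; apply: eq_bigr => k _; rewrite -big_split.
by apply: eq_bigr => m _; rewrite !mulrDl.
Qed.

Lemma bilDr T a b c : bil T a (fun k => b k + c k) = bil T a b + bil T a c.
Proof.
rewrite /bil -big_split; apply: eq_bigr => k _; rewrite -big_split.
by apply: eq_bigr => m _; rewrite mulrDr mulrDl.
Qed.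

Lemma bil_delta T i l (al be : R) :
  bil T (fun k => if k == i then al else 0) (fun k => if k == l then be else 0)
  = al * be * T i l.
Proof.
rewrite /bil (bigD1 i) //= [X in _ + X]big1 ?addr0; last first.
  by move=> k /negbTE ->; rewrite big1 // => m _; rewrite !mul0r.
rewrite eqxx (bigD1 l) //= big1 ?addr0 ?eqxx // => m /negbTE ->.
by rewrite mulr0 mul0r.
Qed.

(** The mixed second difference in the signs of i and l has modulus 4 |T i l + T l i|, so one of the
    four patterns reaches [kap]. *)
Lemma expect_quad T (d : R) t i l (kap : R) : i != l -> i != t -> l != t ->
  kap <= `|T i l + T l i| ->
  expect (fun x => ind (`|sg R (x t) * d + bil T (fun k => sg R (x k)) (fun k => sg R (x k))| < kap))
  <= 3 / 4 :> R.
Proof.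
move=> il it lt kapT; set f := fun x => _.
pose q x := sg R (x t) * d + bil T (fun k => sg R (x k)) (fun k => sg R (x k)).
have fE x : f x = ind (`|q x| < kap) by [].
have f1 x : f x <= 1 by rewrite fE ind_le1.
rewrite (expect_flip i) (_ : expect _ = expect (fun x => (f x + f (flip i x)) / 2)) //.
rewrite (expect_flip l); apply: expect_le => x.
suff : [|| kap <= `|q x|, kap <= `|q (flip i x)|, kap <= `|q (flip l x)|
         | kap <= `|q (flip i (flip l x))|].
  have := f1 x; have := f1 (flip i x); have := f1 (flip l x).
  have := f1 (flip i (flip l x)); rewrite !fE => ? ? ? ?.
  have ind0 : ind false = 0 :> R by [].
  by case/or4P => h; move: h; rewrite leNgt => /negbTE h; rewrite h ind0; lra.
pose s k := sg R (x k).
pose u k := if k == i then - (2 * s i) else 0 : R.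
pose v k := if k == l then - (2 * s l) else 0 : R.
have Ei k : sg R (flip i x k) = s k + u k.
  rewrite /u /s ffunE eq_sym; have [->|_] := eqVneq k i; last by rewrite addr0.
  by rewrite addTb sgN; lra.
have El k : sg R (flip l x k) = s k + v k.
  rewrite /v /s ffunE eq_sym; have [->|_] := eqVneq k l; last by rewrite addr0.
  by rewrite addTb sgN; lra.
have Eil k : sg R (flip i (flip l x) k) = (s k + v k) + u k.
  rewrite ffunE /u eq_sym; have [->|_] := eqVneq k i; last by rewrite addFb El addr0.
  rewrite addTb sgN El /v (negbTE il) addr0; lra.
have qE (y : {ffun I -> bool}) (g : I -> R) : (forall k, sg R (y k) = g k) ->
    q y = g t * d + bil T g g.
  by move=> yg; rewrite /q yg (eq_bil T yg yg).
have key : q x - q (flip i x) - q (flip l x) + q (flip i (flip l x))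
    = 4 * (s i * s l) * (T i l + T l i).
  rewrite (qE x s) // (qE _ _ Ei) (qE _ _ El) (qE _ _ Eil).
  rewrite !(bilDl, bilDr) /u /v [t == i]eq_sym [t == l]eq_sym (negbTE it) (negbTE lt).
  rewrite !bil_delta; ring.
have : 4 * kap <= `|q x - q (flip i x) - q (flip l x) + q (flip i (flip l x))|.
  by rewrite key !normrM !sg_norm normr_nat !mulr1 ler_pM2l.
have := ler_normD (q x - q (flip i x) - q (flip l x)) (q (flip i (flip l x))).
have := ler_normB (q x - q (flip i x)) (q (flip l x)).
have := ler_normB (q x) (q (flip i x)).
case: (leP kap `|q x|) => //= ?; case: (leP kap `|q (flip i x)|) => //= ?.
case: (leP kap `|q (flip l x)|) => //= ?; case: (leP kap _) => //= ?; lra.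
Qed.

End Bilinear.

Section NewVertex.
Context (R : realFieldType) (I : finType).
Local Notation Omega := {ffun {set I} -> bool}.
Implicit Types (w v : Omega) (A B X Y Z U : {set I}) (x : {ffun I -> bool}).
Local Notation new t x w := (upd t setT x w).

Lemma mat_new t x w k : mat R (new t x w) t k = sg R (x k).
Proof. by rewrite /mat ffunE bit_in ?inE. Qed.

Lemma pm_new t x w X Y : t \in X -> t \in Y ->
  pm (mat R (new t x w)) X Y = pm (mat R w) X Y.
Proof.
move=> tX tY; apply: pm_local => i j iX jY; rewrite /mat ffunE bit_out // => m _.
apply/eqP => e; have := set21 t m; rewrite -e !inE => /orP[/eqP ti|/eqP tj].
  by rewrite -ti tX in iX.
by rewrite -tj tY in jY.
Qed.

Lemma pm_new_row t x w X Y : t \in X -> t \in Y ->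
  pm (mat R (new t x w)) (X :\ t) Y
  = D (mixrow setT (mat R w t) x) (pm (mat R w) X) Y.
Proof.
move=> tX tY; rewrite pm_row // /D; apply: eq_bigr => m _.
by rewrite mat_new /mixrow inE pm_new // in_setU1 tY orbT.
Qed.

Lemma pm_new_both t x w A B : t \in A -> t \in B ->
  pm (mat R (new t x w)) (A :\ t) (B :\ t)
  = sg R (x t) * pm (mat R w) A B
    + bil (fun k m => if (k \notin A) && (m \notin B)
                      then pm (mat R w) (k |: A) (m |: B) else 0)
        (fun k => sg R (x k)) (fun k => sg R (x k)).
Proof.
move=> tA tB; rewrite (@pm_both _ _ _ _ _ t) ?setD11 // !setD1K // mat_new pm_new //.
congr (_ + _); rewrite /bil [LHS]big_mkcond; apply: eq_bigr => k _.
case: ifP => kA; last by rewrite big1 // => m _; rewrite mulr0.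
rewrite big_mkcond; apply: eq_bigr => m _; case: ifP => mB; last by rewrite mulr0.
by rewrite matC !mat_new pm_new // in_setU1 ?tA ?tB orbT.
Qed.

Lemma row_survives U t w X Y : t \in U -> U \subset X -> U \subset Y ->
  expect (fun x => ind (~~ [exists j in Y :\: U,
    `|pm (mat R w) X Y| <= `|pm (mat R (new t x w)) (X :\ t) (Y :\ j)|]))
  <= 2^-1 ^+ #|Y :\: U| :> R.
Proof.
move=> tU UX UY.
have dT : [disjoint [set: I] & (finset.set0 : {set I})] by rewrite disjoints_subset setC0.
have := @star_step R I setT finset.set0 (mat R w t) (pm (mat R w) X) dT Y (Y :\: U) (subsetT _) (subsetDl _ _).
apply: le_trans; apply: ler_expect => x; rewrite ler_nat.
case: existsP => //= no; rewrite lt0b; apply/existsP => -[j /andP[jYU hj]]; apply: no.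
exists j; rewrite jYU /=; move: hj; rewrite !set0U pm_new_row ?(subsetP UX) //.
rewrite !inE (subsetP UY) // andbT; apply: contraTneq jYU => <-.
by rewrite inE tU.
Qed.

Lemma both_survives t w A B i l (kap : R) : t \in A -> t \in B ->
  i \notin A -> l \notin B -> i != l ->
  kap <= `|pm (mat R w) (i |: A) (l |: B)
           + (if (l \notin A) && (i \notin B) then pm (mat R w) (l |: A) (i |: B) else 0)| ->
  expect (fun x => ind (`|pm (mat R (new t x w)) (A :\ t) (B :\ t)| < kap)) <= 3 / 4 :> R.
Proof.
move=> tA tB iA lB il hk.
have it : i != t by apply: contraNneq iA => ->.
have lt : l != t by apply: contraNneq lB => ->.
set T := fun k m => if (k \notin A) && (m \notin B)
                      then pm (mat R w) (k |: A) (m |: B) else 0.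
have := @expect_quad R I T (pm (mat R w) A B) t i l kap il it lt.
rewrite {1}/T iA lB => /(_ hk); apply: le_trans.
by apply: ler_expect => x; rewrite pm_new_both.
Qed.

(* If a = pm(X, Y), b and c come from the three ways of splitting the four
   vertices {i1, i2, l1, l2} in two pairs, one of a + b, a + c, b + c has modulus
   at least |a| / 2 since (a + b) + (a + c) - (b + c) = 2 a. *)
Lemma three_terms (a b c : R) :
  [|| `|a| / 2 <= `|a + b|, `|a| / 2 <= `|a + c| | `|a| / 2 <= `|b + c|].
Proof.
have := ler_normB (a + b + (a + c)) (b + c); have := ler_normD (a + b) (a + c).
have -> : a + b + (a + c) - (b + c) = 2 * a by ring.
rewrite normrM normr_nat.
case: (leP _ `|a + b|) => //= ?; case: (leP _ `|a + c|) => //= ?.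
by case: leP => //= ?; have := normr_ge0 a; lra.
Qed.

Lemma large_minor_both U t w r (a : R) : t \in U -> (2 <= r)%N -> 0 < a ->
  large_minor U (#|U| + r) a w ->
  expect (fun x => ind (~~ large_minor (U :\ t) (#|U :\ t| + r.-1) (a / 4) (new t x w)))
  <= 3 / 4 :> R.
Proof.
move=> tU r2 a0 /existsP[X /existsP[Y /and4P[UX UY /eqP cX ha]]].
have pm0 : pm (mat R w) X Y != 0.
  by apply: contraTneq ha => ->; rewrite expr0n /= -ltNge.
have cY : #|Y| = (#|U| + r)%N by rewrite (pm_homog pm0).
have tX := subsetP UX t tU; have tY := subsetP UY t tU.
pose al := pm (mat R w) X Y.
have al2 : a / 4 <= (`|al| / 2) ^+ 2.
  have -> : (`|al| / 2) ^+ 2 = al ^+ 2 / 4 by rewrite -[al ^+ 2]real_normK ?num_real //; field.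
  by rewrite ler_pM2r // invr_gt0.
have finish A B i l : t \in A -> t \in B -> U \subset A -> U \subset B ->
    #|A| = (#|U| + r.-1)%N ->
    i \notin A -> l \notin B -> i != l ->
    `|al| / 2 <= `|pm (mat R w) (i |: A) (l |: B)
           + (if (l \notin A) && (i \notin B) then pm (mat R w) (l |: A) (i |: B) else 0)| ->
    expect (fun x => ind (~~ large_minor (U :\ t) (#|U :\ t| + r.-1) (a / 4) (new t x w)))
    <= 3 / 4 :> R.
  move=> tA tB UA UB cA iA lB il hk.
  apply: le_trans (both_survives tA tB iA lB il hk); apply: ler_expect => x.
  rewrite ler_nat; case: ltP => //= [_|hx]; first exact: leq_b1.
  rewrite leqn0 eqb0 negbK; apply/existsP; exists (A :\ t); apply/existsP; exists (B :\ t).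
  rewrite !setSD //=; apply/andP; split.
    by rewrite -(eqn_add2l 1) addnA; have := cardsD1 t A; have := cardsD1 t U;
      rewrite tA tU => <- <-; rewrite cA.
  apply: le_trans al2 _; rewrite -[leRHS]real_normK ?num_real //.
  by rewrite lerXn2r ?nnegrE // divr_ge0.
have cXU : #|X :\: U| = r by rewrite cardsDS // cX addKn.
have cYU : #|Y :\: U| = r by rewrite cardsDS // cY addKn.
have cD1 i : i \in X -> #|X :\ i| = (#|U| + r.-1)%N.
  move=> iX; have := cardsD1 i X; rewrite iX cX add1n.
  by move: r2; clear; case: r => //= r _; rewrite addnS => -[].
(* If l is in X or i is in Y, the mirrored term is absent and the symmetric coefficient is the given
   minor itself. *)
have [/existsP[i /existsP[l /and4P[iXU lYU il c]]]|/existsPn none] :=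
  boolP [exists i, exists l, [&& i \in X :\: U, l \in Y :\: U, i != l & (l \in X) || (i \in Y)]].
  move: (iXU) (lYU); rewrite !inE => /andP[iU iX] /andP[lU lY].
  have ti : t != i by apply: contraNneq iU => <-.
  have tl : t != l by apply: contraNneq lU => <-.
  apply: (finish (X :\ i) (Y :\ l) i l) => //.
  - by rewrite !inE ti.
  - by rewrite !inE tl.
  - by rewrite subsetD1 UX.
  - by rewrite subsetD1 UY.
  - exact: cD1.
  - by rewrite setD11.
  - by rewrite setD11.
  - rewrite !setD1K // !inE !negb_and !negbK [l == i]eq_sym (negbTE il) /=.
    have -> : (l \notin X) && (i \notin Y) = false.
      by move: c; case: (l \in X) => //=; move=> ->.
    by rewrite addr0 -/al ler_pdivrMr // ler_peMr // ler1n.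
(* Otherwise the leftover rows and columns are different vertices and the mirrored minors [be], [ga]
   may cancel [al]; [three_terms] then selects one of three choices of A, B and the pair. *)
have out i l : i \in X :\: U -> l \in Y :\: U -> i != l -> (l \notin X) && (i \notin Y).
  by move=> iX lY il; have /existsPn/(_ l) := none i; rewrite iX lY il /= negb_or.
have [i1 [i2 [i1X i2X i12]]] : exists i1 i2, [/\ i1 \in X :\: U, i2 \in X :\: U & i1 != i2].
  by apply/card_gt1P; rewrite cXU.
have [l1 [l2 [l1Y l2Y l12]]] : exists l1 l2, [/\ l1 \in Y :\: U, l2 \in Y :\: U & l1 != l2].
  by apply/card_gt1P; rewrite cYU.
have neq i l : i \in X :\: U -> l \in Y :\: U -> i != l.
  move=> iX lY; apply/eqP => il; have iY : i \in Y :\: U by rewrite il.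
  have [k kY ik] : exists2 k, k \in Y :\: U & i != k.
    by have [e|ne] := eqVneq i l1; [exists l2 => //; rewrite e|exists l1].
  by have /andP[_] := out i k iX kY ik; move: iY; rewrite inE => /andP[_ ->].
have XY i l : i \in X :\: U -> l \in Y :\: U -> (l \notin X) /\ (i \notin Y).
  by move=> iX lY; apply/andP; apply: out => //; exact: neq.
have [l1X i2Y] := XY _ _ i2X l1Y; have [l2X _] := XY _ _ i2X l2Y.
have i2l1 := neq _ _ i2X l1Y; have i2l2 := neq _ _ i2X l2Y.
have {}inX i : i \in X :\: U -> i \in X /\ t != i.
  by rewrite inE => /andP[iU iX]; split=> //; apply: contraNneq iU => <-.
have {}inY i : i \in Y :\: U -> i \in Y /\ t != i.
  by rewrite inE => /andP[iU iX]; split=> //; apply: contraNneq iU => <-.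
have notU i : (i \in X :\: U) || (i \in Y :\: U) -> i \notin U.
  by rewrite !inE => /orP[] /andP[].
have [i2X' ti2] := inX _ i2X; have [l1Y' tl1] := inY _ l1Y; have [l2Y' tl2] := inY _ l2Y.
have i2U : i2 \notin U by rewrite notU // i2X.
have l1U : l1 \notin U by rewrite notU // l1Y orbT.
have l2U : l2 \notin U by rewrite notU // l2Y orbT.
pose be := pm (mat R w) (l1 |: X :\ i2) (i2 |: Y :\ l1).
pose ga := pm (mat R w) (l2 |: X :\ i2) (i2 |: Y :\ l2).
have UXi : U \subset X :\ i2 by rewrite subsetD1 UX.
have tXi : t \in X :\ i2 by rewrite !inE ti2.
have eqs := (negbTE l12, negbTE i2l1, negbTE i2l2, eq_sym l1 i2, eq_sym l2 i2, eq_sym l2 l1).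
have /or3P[h|h|h] := three_terms al be ga.
- apply: (finish (X :\ i2) (Y :\ l1) i2 l1) => //; rewrite ?setD11 ?subsetD1 ?UY //.
  + by rewrite !inE tl1.
  + exact: cD1.
  + by rewrite !setD1K // !inE (negbTE l1X) (negbTE i2Y) !andbF.
- apply: (finish (X :\ i2) (Y :\ l2) i2 l2) => //; rewrite ?setD11 ?subsetD1 ?UY //.
  + by rewrite !inE tl2.
  + exact: cD1.
  + by rewrite !setD1K // !inE (negbTE l2X) (negbTE i2Y) !andbF.
have E1 : l2 |: (i2 |: (Y :\ l1 :\ l2)) = i2 |: Y :\ l1.
  by rewrite setUCA setD1K // !inE !eqs l2Y'.
have E2 : l1 |: (i2 |: (Y :\ l1 :\ l2)) = i2 |: Y :\ l2.
  rewrite setUCA; congr (_ |: _); apply/setP => k; rewrite !inE.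
  by have [->|_] := eqVneq k l1; rewrite ?l1Y' ?andbT ?eqs //= andbT.
apply: (finish (X :\ i2) (i2 |: (Y :\ l1 :\ l2)) l1 l2) => //.
- by rewrite !inE tl1 tl2 tY orbT.
- apply/subsetP => k kU; rewrite !inE (subsetP UY) // andbT.
  by rewrite (contraNneq _ l2U) ?(contraNneq _ l1U) ?orbT // => <-.
- exact: cD1.
- by rewrite !inE (negbTE l1X) andbF.
- by rewrite !inE !eqxx /= orbF eqs.
rewrite E1 E2 !inE (negbTE l2X) !andbF /= !eqs /= eqxx /=.
by rewrite -/be -/ga.
Qed.

(** Only the row of t is spent; its column becomes an ordinary leftover in place of column j. Hence
    U shrinks, the defect stays r and the size a is kept. Failure means that r trials all fail. *)
Lemma large_minor_row U t w r (a : R) : t \in U -> 0 < a ->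
  large_minor U (#|U| + r) a w ->
  expect (fun x => ind (~~ large_minor (U :\ t) (#|U :\ t| + r) a (new t x w)))
  <= 2^-1 ^+ r :> R.
Proof.
move=> tU a0 /existsP[X /existsP[Y /and4P[UX UY /eqP cX ha]]].
have pm0 : pm (mat R w) X Y != 0.
  by apply: contraTneq ha => ->; rewrite expr0n /= -ltNge.
have cYU : #|Y :\: U| = r by rewrite cardsDS // (pm_homog pm0) cX addKn.
rewrite -cYU; apply: le_trans (row_survives w tU UX UY); apply: ler_expect => x.
rewrite ler_nat; case: existsP => [[j /andP[jYU hj]]|_] /=; last exact: leq_b1.
rewrite leqn0 eqb0 negbK; apply/existsP; exists (X :\ t); apply/existsP; exists (Y :\ j).
apply/and4P; split.
- exact: setSD.
- apply/subsetP => k; rewrite !inE => /andP[_ kU]; rewrite (subsetP UY) // andbT.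
  by apply: contraTneq jYU => <-; rewrite inE kU.
- rewrite -(eqn_add2l 1) addnA; have := cardsD1 t X; have := cardsD1 t U.
  by rewrite tU (subsetP UX) // => <- <-; rewrite cX cYU.
- apply: le_trans ha _; rewrite -[leLHS]real_normK ?num_real //.
  by rewrite -[leRHS]real_normK ?num_real // lerXn2r ?nnegrE.
Qed.

End NewVertex.

Section Descent.
Context (R : realFieldType) (I : finType).
Local Notation Omega := {ffun {set I} -> bool}.
Implicit Types (w v : Omega) (A B X Y U : {set I}) (ts : seq I).

(** The bits of all entries in a row or column of U; minors avoiding U on both sides read none of
    them. *)
Definition touch U : {set {set I}} := [set p : {set I} | p :&: U != finset.set0].

Lemma touch_sub U B : U \subset B -> touch U \subset touch B.
Proof.
move=> UB; apply/subsetP => p; rewrite !inE; apply: contraNneq => pB.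
by rewrite -subset0 -pB setIS.
Qed.

Lemma set2_touch U t m : t \in U -> [set t; m] \in touch U.
Proof. by move=> tU; rewrite inE; apply/set0Pn; exists t; rewrite !inE eqxx. Qed.

Lemma touch_mix U w v X Y : U \subset X -> U \subset Y ->
  pm (mat R (mix (touch U) v w)) X Y = pm (mat R w) X Y.
Proof.
move=> UX UY; apply: pm_local => i j iX jY; rewrite /mat ffunE inE; case: set0Pn => // -[k].
rewrite !inE => /andP[/orP[]/eqP-> kU].
  by rewrite (subsetP UX) in iX.
by rewrite (subsetP UY) in jY.
Qed.

Lemma large_minor_mix U c (a : R) w v :
  large_minor U c a (mix (touch U) v w) = large_minor U c a w.
Proof.
apply: eq_existsb => X; apply: eq_existsb => Y.
by have [UX|] //= := boolP (U \subset X); case: (boolP (U \subset Y)) => //= UY; rewrite touch_mix.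
Qed.

Lemma ind_case (b : bool) (x y z : R) :
  (b -> x <= y) -> (~~ b -> x <= y + z) -> x <= y + ind (~~ b) * z.
Proof.
by case: b => /= [/(_ isT) h _|_ /(_ isT) h]; rewrite ?mul0r ?addr0 ?mul1r.
Qed.

(* A new vertex lowers the defect with probability at least 1/4, which halves the
   weight 2^d; hence the factor 7/8 = 3/4 + (1/4) (1/2) per vertex. *)
Lemma descent U ts w r' d (a : R) : uniq ts -> {subset ts <= U} -> (0 < r')%N -> 0 < a ->
  large_minor U (#|U| + (r' + d)) a w ->
  cexp (touch U) (fun v => ind (~~ large_minor (U :\: [set t in ts])
      (#|U :\: [set t in ts]| + r') (a / 4 ^+ d) v)) w
  <= (2 ^+ d - 1) * (7 / 8) ^+ size ts + (size ts)%:R * 2^-1 ^+ r' :> R.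
Proof.
move=> uts tsU r0 a0 lm.
have p2 e : 1 <= 2 ^+ e :> R by rewrite exprn_ege1 ?ler1n.
elim: ts U w d a uts tsU a0 lm => [|t ts IH] U w d a /=.
  move=> _ _ a0 lm; rewrite mul0r addr0 expr0 mulr1.
  have U0 : U :\: [set t in [::]] = U by rewrite set_nil setD0.
  case: d lm => [|d] lm.
    rewrite subrr -(expect_cst {set I} (0 : R)); apply: ler_expect => v.
    by rewrite U0 expr0 divr1 large_minor_mix; move: lm; rewrite addn0 => ->.
  apply: expect_le => v; apply: le_trans (ind_le1 R _) _.
  by have := p2 d; rewrite exprS; lra.
move=> /andP[tts uts] tsU a0 lm.
have tU : t \in U by apply: tsU; rewrite mem_head.
have tsU' : {subset ts <= U :\ t}.
  move=> k kts; rewrite !inE tsU ?andbT; last by rewrite inE kts orbT.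
  by apply: contraNneq tts => <-.
rewrite setD_cons; set Uf := _ :\: _ in IH *.
pose q : R := (7 / 8) ^+ size ts.
have q0 : 0 <= q by rewrite exprn_ge0 // divr_ge0.
pose e : R := (size ts)%:R * 2^-1 ^+ r'.
have h0 k : 0 <= 2^-1 ^+ k :> R by rewrite exprn_ge0 // invr_ge0.
have e0 : 0 <= e by rewrite mulr_ge0.
set F := fun v => _.
rewrite (cexp_sub _ _ (touch_sub (subsetDl U [set t]))).
rewrite (@cexp_refresh _ _ _ t setT); last by move=> m _; apply: set2_touch.
apply: expect_le => v; move: (lm); rewrite -(large_minor_mix _ _ _ w v).
move: (mix _ v w) => {v}w' lm'.
have F1 x : cexp (touch (U :\ t)) F x <= 1.
  by apply: expect_le => v; apply: ind_le1.
have nS : (size ts).+1%:R * 2^-1 ^+ r' = 2^-1 ^+ r' + e :> R.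
  by rewrite -natr1 mulrDl mul1r addrC.
rewrite nS exprS -/q.
case: d lm lm' @F F1 => [|d] lm lm' F F1.
  have st := large_minor_row tU a0 lm'; rewrite addn0 in st.
  apply: le_trans (_ : expect (fun x => e + ind (~~ large_minor (U :\ t) (#|U :\ t| + r') a
      (upd t setT x w')) * 1) <= _); last first.
    rewrite expectD expectZr expect_cst mulr1.
    by rewrite subrr mul0r add0r addrC lerD2r.
  apply: ler_expect => x; apply: ind_case => [lx|_].
    have := IH _ _ 0%N a uts tsU' a0; rewrite addn0 => /(_ _ lx).
    by rewrite subrr mul0r add0r.
  by apply: le_trans (F1 _) _; rewrite lerDr.
have a40 : 0 < a / 4 by rewrite divr_gt0.
have r2 : (2 <= r' + d.+1)%N by move: r0; clear; lia.
have st1 := large_minor_both tU r2 a0 lm'; rewrite addnS /= in st1.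
have st2 := large_minor_row tU a0 lm'.
pose g k : R := (2 ^+ k - 1) * q.
have g0 k : 0 <= g k by rewrite mulr_ge0 // subr_ge0.
have gd : 0 <= g d.+1 - g d by rewrite /g -mulrBl mulr_ge0 // exprS; have := p2 d; lra.
pose lm1 x := large_minor (U :\ t) (#|U :\ t| + (r' + d)) (a / 4) (upd t setT x w').
pose lm2 x := large_minor (U :\ t) (#|U :\ t| + (r' + d.+1)) a (upd t setT x w').
apply: le_trans (_ : expect (fun x => g d + e + ind (~~ lm1 x) * (g d.+1 - g d)
   + ind (~~ lm2 x) * 1) <= _).
  apply: ler_expect => x; apply: ind_case => [l2|_]; last first.
    apply: le_trans (F1 _) _; rewrite lerDr addr_ge0 ?(addr_ge0 (g0 _)) ?mulr_ge0 ?ler0n //.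
  apply: ind_case => [l1|_].
    have aE : a / 4 / 4 ^+ d = a / 4 ^+ d.+1 by rewrite exprS invfM mulrA.
    by have := IH _ _ d (a / 4) uts tsU' a40 l1; rewrite aE.
  by rewrite addrAC addrCA subrr addr0; exact: IH _ _ d.+1 a uts tsU' a0 l2.
rewrite !expectD !expect_cst !expectZr ?expect_cst -/e mulr1.
have l1 : expect (fun x => ind (~~ lm1 x)) * (g d.+1 - g d) <= 3 / 4 * (g d.+1 - g d).
  exact: ler_wpM2r.
have l2 : expect (fun x => ind (~~ lm2 x)) <= 2^-1 ^+ r' :> R.
  apply: le_trans st2 _; rewrite ler_wiXn2l ?invr_ge0 ?invf_le1 ?ler1n // leq_addr.
  by [].
apply: le_trans (lerD (lerD (lexx _) l1) l2) _.
have gE : g d.+1 = g d + 2 ^+ d * q by rewrite /g exprS; ring.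
have -> : g d = 2 ^+ d * q - q by rewrite /g; ring.
by rewrite gE /g exprS; lra.
Qed.
(** Since (7/8)^16 <= 1/4, sixteen vertices per unit of defect turn 2^d into at most 2^-d. A stage
    consumes at most 48 d vertices. *)
Lemma halving_step d : (0 < d)%N ->
  (2 ^+ d - 1) * (7 / 8) ^+ (16 * d) + (48 * d)%:R * 2^-1 ^+ d
    <= 49 * (d%:R * 2^-1 ^+ d) :> R.
Proof.
move=> d0; have h0 : 0 <= 2^-1 ^+ d :> R by rewrite exprn_ge0 // invr_ge0.
have q0 : 0 <= (7 / 8) ^+ (16 * d) :> R by rewrite exprn_ge0 // divr_ge0.
have p : 2 ^+ d * (7 / 8) ^+ (16 * d) <= 2^-1 ^+ d :> R.
  rewrite exprM -exprMn lerXn2r ?nnegrE ?invr_ge0 //.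
    by rewrite mulr_ge0 // exprn_ge0 // divr_ge0.
  have : (7 / 8) ^+ 2 <= 49 / 64 :> R by rewrite !expr2; lra.
  rewrite [in (7 / 8) ^+ 16](_ : 16%N = (2 * 8)%N) // exprM => le1.
  have : ((7 / 8) ^+ 2) ^+ 8 <= (49 / 64) ^+ 8 :> R.
    by rewrite lerXn2r ?nnegrE ?exprn_ge0 ?divr_ge0 // ler0n.
  rewrite [X in _ <= X](_ : _ = (49 / 64) * (49 / 64) * (49 / 64) * (49 / 64)
    * ((49 / 64) * (49 / 64) * (49 / 64) * (49 / 64))); last by ring.
  by lra.
have d1 : 2^-1 ^+ d <= d%:R * 2^-1 ^+ d :> R by rewrite ler_peMl // ler1n.
by rewrite natrM; lra.
Qed.

(** Halving the defect makes the errors d 2^-d of the stages a geometric sum dominated by the last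
    stage, at defect about u. Surplus vertices are absorbed by row steps, so exactly the vertices of
    [ts] are consumed. *)
Lemma halving u h U ts (a : R) w : (2 <= u)%N -> uniq ts -> {subset ts <= U} ->
  (16 * (u * 2 ^ h) <= size ts <= 32 * (u * 2 ^ h))%N -> 0 < a ->
  large_minor U (#|U| + u * 2 ^ h) a w ->
  cexp (touch U) (fun v => ind (~~ large_minor (U :\: [set t in ts])
      (#|U :\: [set t in ts]| + u) (a / 4 ^+ (u * (2 ^ h).-1)) v)) w
  <= 130 * (u%:R * 2^-1 ^+ u) :> R.
Proof.
move=> u2; pose s i : R := (u * 2 ^ i)%:R * 2^-1 ^+ (u * 2 ^ i).
have h0 k : 0 <= 2^-1 ^+ k :> R by rewrite exprn_ge0 // invr_ge0.
have s0 i : 0 <= s i by rewrite mulr_ge0.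
have d0 i : (2 <= u * 2 ^ i)%N by rewrite (leq_trans u2) // leq_pmulr // expn_gt0.
have dS i : (u * 2 ^ i.+1 = 2 * (u * 2 ^ i))%N by rewrite expnS; lia.
have sS i : s i.+1 <= s i / 2.
  rewrite /s dS natrM [(2 * _)%N]mulSn mul1n exprD.
  have : 2^-1 ^+ (u * 2 ^ i) <= 2^-1 ^+ 2 :> R.
    by rewrite ler_wiXn2l ?invr_ge0 ?invf_le1 ?ler1n.
  have -> : 2^-1 ^+ 2 = 4^-1 :> R by rewrite exprVn -natrX.
  set x : R := (u * 2 ^ i)%:R; set y := 2^-1 ^+ _ => y4.
  have : x * y * y <= x * y * 4^-1 by rewrite ler_wpM2l // mulr_ge0 ?h0 ?ler0n.
  by lra.
(* The 32 pays for the vertices consumed at the final defect u. Since s (i + 1) <= s i / 2, the cost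
   49 s i of a stage is at most 98 (s i - s (i + 1)), which telescopes. *)
move=> uts tsU cts a0 lm; apply: le_trans (_ : 32 * s 0%N + 98 * (s 0%N - s h) <= _); last first.
  by have := s0 h; rewrite /s muln1; lra.
elim: h U ts a w uts tsU cts a0 lm => [|h IH] U ts a w uts tsU cts a0 lm.
  rewrite subrr mulr0 addr0 muln0 expr0.
  move: cts lm; rewrite muln1 -[X in (_ + X)%N]addn0 => /andP[_ cts] lm.
  have u0 : (0 < u)%N by apply: leq_trans u2.
  have := descent uts tsU u0 a0 lm; rewrite expr0 subrr mul0r add0r => /le_trans; apply.
  by rewrite /s muln1 mulrA ler_wpM2r // -natrM ler_nat.
pose d := (u * 2 ^ h)%N; have dd : (0 < d)%N by have := d0 h; rewrite -/d; clear; lia.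
have : (16 * d + 16 * d <= size ts <= 16 * d + 48 * d)%N.
  by move: cts; rewrite dS -/d; clear; lia.
case/andP=> lo hi.
(* The last 16 d vertices are kept for the later stages; between 16 d and 48 d remain for the stage
   from 2 d to d. *)
pose ts1 := take (size ts - 16 * d) ts; pose ts2 := drop (size ts - 16 * d) ts.
have sz1 : size ts1 = (size ts - 16 * d)%N by rewrite size_takel // leq_subr.
have sz2 : size ts2 = (16 * d)%N by rewrite size_drop; move: lo; clear; lia.
have tsE : ts1 ++ ts2 = ts by exact: cat_take_drop.
have /and3P[u1 /hasPn dis u2'] : [&& uniq ts1, ~~ has (mem ts1) ts2 & uniq ts2].
  by rewrite -cat_uniq tsE.
have s1U : {subset ts1 <= U} by move=> t tts; apply: tsU; rewrite -tsE mem_cat tts.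
pose U1 := U :\: [set t in ts1].
have s2U : {subset ts2 <= U1}.
  move=> t tts; rewrite !inE; apply/andP; split; first exact: dis.
  by apply: tsU; rewrite -tsE mem_cat tts orbT.
have UE : U :\: [set t in ts] = U1 :\: [set t in ts2].
  apply/setP => t; rewrite !inE -tsE mem_cat negb_or andbA; congr (_ && _).
  exact: andbC.
have aE : a / 4 ^+ (u * (2 ^ h.+1).-1) = a / 4 ^+ d / 4 ^+ (u * (2 ^ h).-1).
  rewrite -mulrA -invfM -exprD; congr (_ / _ ^+ _).
  rewrite /d -mulnDr expnS; congr (_ * _)%N; have : (0 < 2 ^ h)%N by rewrite expn_gt0.
  by move: (2 ^ h)%N; clear; lia.
rewrite UE aE; set F := fun v => _.
rewrite (cexp_sub _ _ (touch_sub (subsetDl U [set t in ts1]))) -/U1.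
have ad0 : 0 < a / 4 ^+ d by rewrite divr_gt0 // exprn_gt0.
pose lm1 v := large_minor U1 (#|U1| + d) (a / 4 ^+ d) v.
pose c : R := 32 * s 0%N + 98 * (s 0%N - s h).
have c0 : 0 <= c.
  have sm i : s i <= s 0%N.
    by elim: i => // i IHi; have := sS i; have := s0 i; move: IHi; lra.
  by rewrite addr_ge0 ?mulr_ge0 // subr_ge0.
apply: le_trans (_ : cexp (touch U) (fun v => c + ind (~~ lm1 v)) w <= _).
  apply: ler_cexp => v; rewrite -[ind _]mulr1; apply: ind_case => l1.
    apply: IH => //; rewrite -/d sz2; move: dd; clear; lia.
  apply: le_trans (_ : 1 <= _); last by rewrite lerDr.
  by apply: expect_le => ?; apply: ind_le1.
rewrite /cexp expectD expect_cst.
have lmd : large_minor U (#|U| + (d + d)) a w by move: lm; rewrite dS -/d mul2n addnn.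
have := descent u1 s1U dd a0 lmd; rewrite -/U1 => de.
have de2 : expect (fun v => ind (~~ lm1 (mix (touch U) v w))) <= 49 * s h.
  apply: le_trans de _; apply: le_trans (halving_step dd); apply: lerD.
    rewrite ler_wpM2l ?subr_ge0 ?exprn_ege1 ?ler1n //.
    by rewrite ler_wiXn2l ?divr_ge0 ?ler_pdivrMr ?mul1r ?ler_nat // sz1; move: lo; clear; lia.
  by rewrite ler_wpM2r // ler_nat sz1; move: hi; clear; lia.
by have := sS h; move: de2; rewrite /c; lra.
Qed.

End Descent.

(** * Removing the auxiliary rows and columns *)

Section Over.
Context (R : realFieldType) (I : finType).
Local Notation Omega := {ffun {set I} -> bool}.
Implicit Types (w v : Omega) (A B C S X Y U : {set I}) (ts : seq I).

Definition over Y0 (Phi : ({set I} -> R) -> R) :=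
  forall f g, (forall Y : {set I}, Y0 \subset Y -> f Y = g Y) -> Phi f = Phi g.

Lemma eq_chain_over Y0 C ys f g Phi : over Y0 Phi ->
  (forall Y : {set I}, Y0 \subset Y -> f Y = g Y) ->
  chain C ys f Phi = chain C ys g Phi.
Proof.
move=> oPhi; elim: ys f g => [|y ys IH] f g fg /=; first exact: oPhi.
apply: eq_expect => x; apply: IH => Y Y0Y; apply: eq_bigr => m _.
by rewrite fg // (subset_trans Y0Y) // subsetUr.
Qed.

(** The mirror entries are hidden on the column side here: they lie in columns t of Y0, which are
    removed from every minor that [Phi] reads. *)
Lemma rerow_chain_over Y0 C X ts w Phi : over Y0 Phi ->
  uniq ts -> {subset ts <= X} -> {subset ts <= Y0} -> (forall t, t \in ts -> t \notin C) ->
  rerow C ts w (fun v => Phi (pm (mat R v) (X :\: [set t in ts])))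
  = chain C [seq mat R w t | t <- ts] (pm (mat R w) X) Phi.
Proof.
move=> oPhi; elim: ts X w => [|t ts IH] X w /=.
  move=> _ _ _ _; by rewrite set_nil setD0.
move=> /andP[tts uts] tsX tsY tsC; apply: eq_expect => x.
have tX : t \in X by rewrite tsX // mem_head.
have tY : t \in Y0 by rewrite tsY // mem_head.
have tC : t \notin C by rewrite tsC // mem_head.
rewrite setD_cons IH //; last first.
- by move=> t' t'ts; apply: tsC; rewrite inE t'ts orbT.
- by move=> t' t'ts; apply: tsY; rewrite inE t'ts orbT.
- move=> t' t'ts; rewrite !inE tsX ?inE ?t'ts ?orbT // andbT.
  by apply: contraNneq tts => <-.
rewrite map_mat_upd // => [|t' t'ts]; last by apply: tsC; rewrite inE t'ts orbT.
apply: (@eq_chain_over Y0 C _ _ _ Phi oPhi) => Y Y0Y; have tY' := subsetP Y0Y t tY.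
rewrite pm_row // mat_upd_row /D; apply: eq_bigr => m _; congr (_ * _).
apply: pm_local => i j iX; rewrite in_setU1 negb_or => /andP[_ jY].
rewrite /mat ffunE bit_out // => k kC; apply/eqP => e; have := set21 t k.
rewrite -e !inE => /orP[/eqP ti|/eqP tj]; first by rewrite -ti tX in iX.
by rewrite -tj tY' in jY.
Qed.

Lemma rerow_le1 C ts w (F : Omega -> R) : (forall v, F v <= 1) -> rerow C ts w F <= 1.
Proof. by move=> F1; elim: ts w => //= t ts IH w; apply: expect_le. Qed.

Lemma pm_matC w X Y : pm (mat R w) X Y = pm (mat R w) Y X.
Proof. by rewrite -pm_tr; apply: pm_local => i j _ _; rewrite matC. Qed.

Lemma over_lost Y0 (K : R) : over Y0 (lost Y0 K).
Proof. by move=> f g fg; rewrite /lost /heavy setU0 fg. Qed.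

End Over.

(** Two games: the rows of [lb] remove the leftover columns Y :\: U; then, after transposition, the
    columns of [la] are exposed as rows and remove X :\: U. Neither game lowers a. *)
Lemma two_sided (R : archiRealFieldType) (th : R) : 0 < th -> exists u0 : nat,
  forall (I : finType) (la lb : seq I) (S U : {set I}) u (a : R) w,
    (u0 <= u)%N -> size la = u -> size lb = u -> uniq (la ++ lb) ->
    (forall t, t \in la ++ lb -> t \notin S) ->
    U = S :|: [set t in la] :|: [set t in lb] ->
    large_minor U (#|U| + u) a w ->
    cexp (touch U) (fun v => ind (~~
      (a <= pm (mat R v) (S :|: [set t in lb]) (S :|: [set t in la]) ^+ 2))) w <= th.
Proof.
move=> th0; have th2 : 0 < th / 2 by rewrite divr_gt0.
have [u0 game] := game_lost th2; exists u0 => I la lb S U u a w uu0 sla slb.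
rewrite cat_uniq => /and3P[ula /hasPn dis ulb] nS UE.
move=> /existsP[X /existsP[Y /and4P[UX UY /eqP cX ha]]].
have [a0|a0] := leP a 0.
  apply: expect_le => v; rewrite (le_trans a0) ?sqr_ge0 //; exact: ltW.
have pm0 : pm (mat R w) X Y != 0.
  by apply: contraTneq ha => ->; rewrite expr0n /= -ltNge.
have cY : #|Y| = (#|U| + u)%N by rewrite (pm_homog pm0).
pose K := `|pm (mat R w) X Y|.
have KE : a <= K ^+ 2 by rewrite real_normK ?num_real.
have [laU lbU] : {subset la <= U} /\ {subset lb <= U}.
  split; first by move=> t tl; rewrite UE !inE tl orbT.
  by move=> t tl; rewrite UE !inE tl orbT.
have facts k : [&& (k \in U) == [|| k \in S, k \in la | k \in lb], (k \in U) ==> (k \in X),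
    (k \in lb) ==> (k \notin la), (k \in lb) ==> (k \notin S) & (k \in la) ==> (k \notin S)].
  apply/and5P; split; [|exact/implyP/(subsetP UX)|exact/implyP/dis|apply/implyP => kl..].
  - by rewrite UE !inE orbA.
  - by apply: nS; rewrite mem_cat kl orbT.
  - by apply: nS; rewrite mem_cat kl.
have cXU : #|X :\: U| = u by rewrite cardsDS // cX addKn.
have cYU : #|Y :\: U| = u by rewrite cardsDS // cY addKn.
have lostE (Y0 : {set I}) f : lost Y0 K f = ind (~~ (K <= `|f Y0|)) :> R.
  by rewrite /lost /heavy setU0.
have stage (ts : seq I) (C X' Y0 : {set I}) v : size ts = u -> uniq ts -> {subset ts <= U} ->
    {subset ts <= X'} -> {subset ts <= Y0} -> [disjoint C & Y0] -> #|C| = u ->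
    K <= `|pm (mat R v) X' (Y0 :|: C)| ->
    rerow C ts v (fun v' => lost Y0 K (pm (mat R v') (X' :\: [set t in ts])))
    <= th / 2.
  move=> sts uts tsU tsX tsY CY cC hK.
  have tsC t : t \in ts -> t \notin C.
    by move=> /tsY tY; apply/negP => tC; have := disjointFr CY tC; rewrite tY.
  have := @rerow_chain_over R I Y0 C X' ts v _ (@over_lost R I Y0 K) uts tsX tsY tsC.
  move=> ->.
  by apply: game => //; rewrite ?cC ?size_map.
set F := fun v => _.
pose F1 v : R := lost U K (pm (mat R v) (X :\: [set t in lb])).
rewrite (@cexp_rerow _ _ (touch U) la (X :\: U)); last first.
  by move=> t m tla _; apply/set2_touch/laU.
apply: le_trans (_ : cexp (touch U) (fun v => th / 2 + F1 v) w <= _).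
  apply: ler_cexp => v; rewrite -[F1 v]mulr1 /F1 lostE; apply: ind_case => [h1|_]; last first.
    apply: le_trans (_ : 1 <= _); last by rewrite lerDr ltW.
    by apply: rerow_le1 => v'; apply: ind_le1.
  have XE : S :|: [set t in la] :|: (X :\: U) = X :\: [set t in lb].
    apply/setP => k; have := facts k; rewrite !inE.
    by case: (k \in la); case: (k \in lb); case: (k \in S); case: (k \in U); case: (k \in X).
  have UaE : U :\: [set t in la] = S :|: [set t in lb].
    apply/setP => k; have := facts k; rewrite !inE.
    by case: (k \in la); case: (k \in lb); case: (k \in S); case: (k \in U); case: (k \in X).
  have := @stage la (X :\: U) U (S :|: [set t in la]) v sla ula laU laU.
  rewrite UaE XE pm_matC => st; apply: le_trans (st _ _ cXU h1).
  - apply: ler_rerow => v'; rewrite lostE ler_nat; case: (leP K) => hK /=; last exact: leq_b1.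
    rewrite leqn0 eqb0 negbK; apply: le_trans KE _.
    by rewrite -[leRHS]real_normK ?num_real // lerXn2r ?nnegrE ?normr_ge0.
  - by move=> t tl; rewrite !inE tl orbT.
  - rewrite disjoint_sym disjoints_subset; apply/subsetP => k; rewrite UE !inE.
    by move=> /orP[]->; rewrite ?orbT.
rewrite /cexp expectD expect_cst -/(cexp _ _ _) [th in _ <= th](splitr th) lerD2l.
rewrite -/(cexp (touch U) F1 w) (@cexp_rerow _ _ (touch U) lb (Y :\: U)); last first.
  by move=> t m tla _; apply/set2_touch/lbU.
apply: expect_le => v; apply: (stage lb (Y :\: U) X U) => //.
- by move=> t tl; apply/(subsetP UX)/lbU.
- by rewrite disjoint_sym disjoints_subset setCD subsetUr.
- by rewrite setUC setDE setUIl [~: U :|: U]setUC setUCr setIT (setUidPl UY) touch_mix.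
Qed.

(** * A quadratic small-ball estimate *)

Lemma sqr_expect_le (R : realFieldType) (J : finType) (f : {ffun J -> bool} -> R) :
  expect f ^+ 2 <= expect (fun v => f v ^+ 2).
Proof.
have : 0 <= expect (fun v => (f v - expect f) ^+ 2) by apply: expect_ge0 => v; exact: sqr_ge0.
rewrite (@eq_expect _ _ _ (fun v => f v ^+ 2 - (2 * expect f) * f v + expect f ^+ 2)); last first.
  by move=> v; ring.
rewrite expectD expectB expectZ expect_cst; have -> : 2 * expect f * expect f = 2 * expect f ^+ 2 by ring.
by lra.
Qed.

Lemma expect_exchange (R : realFieldType) (J J' : finType)
    (f : {ffun J -> bool} -> {ffun J' -> bool} -> R) :
  expect (fun v => expect (f v)) = expect (fun w => expect (fun v => f v w)).
Proof. exact: mean_exchange. Qed.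

Lemma expect_sum (R : realFieldType) (J K : finType) (V : {set K})
    (f : K -> {ffun J -> bool} -> R) :
  expect (fun v => \sum_(m in V) f m v) = \sum_(m in V) expect (f m).
Proof. exact: mean_sum. Qed.

Lemma bil_sym (R : realFieldType) (I : finType) (T : I -> I -> R) a b :
  bil T a b + bil T b a = \sum_m b m * \sum_k a k * (T k m + T m k).
Proof.
rewrite /bil exchange_big /= -big_split; apply: eq_bigr => m _ /=.
by rewrite mulr_sumr -big_split; apply: eq_bigr => k _ /=; ring.
Qed.

(* Decoupling: two outcomes that agree on V and are independent outside V have a
   difference of quadratic forms that is linear in the signs of V. *)
Lemma quad_small_ball (R : realFieldType) (I : finType) (V : {set I}) (T : I -> I -> R)
    (t : I) (d r : R) (L : nat) : (0 < L)%N -> #|V| = (2 * L ^ 2)%N ->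
  (forall m, m \in V -> (L ^ 2 <= #|[set k | (k \notin V) && (2 * r <= `|T k m + T m k|)%R]|)%N) ->
  expect (fun x => ind (`|sg R (x t) * d
     + bil T (fun k => sg R (x k)) (fun k => sg R (x k))| < r)) ^+ 2 <= 6 / L%:R :> R.
Proof.
move=> L0 cV many.
pose q x := sg R (x t) * d + bil T (fun k => sg R (x k)) (fun k => sg R (x k)).
pose f x : R := ind (`|q x| < r); rewrite -[X in X ^+ 2]/(expect f).
pose o v k : R := if k \in V then 0 else sg R (v k).
pose h w k : R := if k \in V then sg R (w k) else 0.
pose u v v' m : R := if m \in V then \sum_k (o v k - o v' k) * (T k m + T m k) else 0.
pose c0 v v' := (if t \in V then 0 else (sg R (v t) - sg R (v' t)) * d)
  + (bil T (o v) (o v) - bil T (o v') (o v')).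
have qE v v' w : q (mix (~: V) v w) - q (mix (~: V) v' w) = c0 v v' + \sum_m sg R (w m) * u v v' m.
  have mE y k : sg R (mix (~: V) y w k) = o y k + h w k.
    by rewrite ffunE inE /o /h; case: (k \in V); rewrite ?add0r ?addr0.
  have q1 y : q (mix (~: V) y w) = (if t \in V then sg R (w t) else sg R (y t)) * d
      + (bil T (o y) (o y) + bil T (h w) (h w) + (bil T (o y) (h w) + bil T (h w) (o y))).
    rewrite /q (eq_bil T (mE y) (mE y)) bilDl !bilDr ffunE inE.
    by case: (t \in V) => /=; ring.
  have uE : \sum_m sg R (w m) * u v v' m =
      (bil T (o v) (h w) + bil T (h w) (o v)) - (bil T (o v') (h w) + bil T (h w) (o v')).
    rewrite !bil_sym -sumrB; apply: eq_bigr => m _; rewrite -mulrBr /u /h.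
    case: (m \in V); last by rewrite mulr0 mul0r.
    by rewrite -sumrB; congr (_ * _); apply: eq_bigr => k _; rewrite mulrBl.
  by rewrite !q1 uE /c0; case: (t \in V); ring.
have Lpos : 0 < L%:R :> R by rewrite ltr0n.
pose A v v' := [set m in V | 2 * r <= `|u v v' m|].
(* Each u v v' m is a linear form in the signs outside V with L^2 coefficients of size at least 2 r,
   hence small with probability at most 2 / L. By Markov, half of the 2 L^2 indices are small with
   probability at most 4 / L. *)
have bad v' : expect (fun v => ind (~~ (L ^ 2 <= #|A v v'|)%N)) <= 4 / L%:R :> R.
  pose fails v : R := \sum_(m in V) ind (`|u v v' m| < 2 * r).
  have L2 : 0 < (L ^ 2)%:R :> R by rewrite ltr0n expn_gt0 L0.
  apply: le_trans (_ : expect (fun v => ind ((L ^ 2)%:R <= fails v)) <= _).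
    apply: ler_expect => v; rewrite ler_nat; case: (leqP (L ^ 2) #|A v v'|) => //= few.
    rewrite lt0b /fails -natr_sum ler_nat.
    have : (\sum_(m in V) nat_of_bool (2 * r <= `|u v v' m|)%R = #|A v v'|)%N.
      by rewrite -sum1_card -big_mkcondr; apply: eq_bigl => m; rewrite !inE.
    have : (\sum_(m in V) (nat_of_bool (2 * r <= `|u v v' m|)%R
             + nat_of_bool (`|u v v' m| < 2 * r)%R) = #|V|)%N.
      by rewrite -sum1_card; apply: eq_bigr => m _; case: leP.
    rewrite big_split /= cV; move: few; clear; lia.
  apply: le_trans (mean_markov L2 _) _ => [v _|]; first by apply: sumr_ge0.
  rewrite -/(expect _) /fails expect_sum ler_pdivrMr //.
  apply: le_trans (_ : \sum_(m in V) (2 / L%:R : R) <= _); last first.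
    rewrite sumr_const cV -mulr_natr natrM le_eqVlt; apply/orP; left; apply/eqP; ring.
  apply: ler_sum => m mV.
  pose uk k : R := if k \in V then 0 else T k m + T m k.
  pose w0 : R := - \sum_k o v' k * (T k m + T m k).
  apply: le_trans (@small_ball_scalar R I uk w0 (2 * r) _ L L0 (many m mV) _).
    apply: ler_expect => v; rewrite /u mV (_ : \sum_k _ = w0 + \sum_i sg R (v i) * uk i) //.
    rewrite /w0 addrC -sumrB; apply: eq_bigr => k _; rewrite mulrBl /o /uk.
    by case: (k \in V); rewrite ?mul0r ?mulr0.
  by move=> k; rewrite inE /uk => /andP[/negbTE ->].
rewrite (expect_mix (~: V)).
(* The square produces two copies v, v' outside V sharing the signs on V. If both values are below
   r, their difference is below 2 r. *)
apply: le_trans (sqr_expect_le _) _.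
rewrite (_ : expect _ = expect (fun w => expect (fun v' => expect (fun v =>
   f (mix (~: V) v w) * f (mix (~: V) v' w))))); last first.
  apply: eq_expect => w; rewrite expr2 -expectZr; apply: eq_expect => v'.
  by rewrite mulrC -expectZr.
rewrite expect_exchange; apply: expect_le => v'; rewrite expect_exchange.
apply: le_trans (_ : expect (fun v => 2 / L%:R + ind (~~ (L ^ 2 <= #|A v v'|)%N)) <= _); last first.
  rewrite expectD expect_cst.
  have -> : 6 / L%:R = 2 / L%:R + 4 / L%:R :> R by ring.
  by rewrite lerD2l bad.
apply: ler_expect => v.
rewrite -[ind (~~ _)]mulr1; apply: ind_case => [big|_]; last first.
  apply: le_trans (_ : 1 <= _); last by rewrite lerDr divr_ge0.
  by apply: expect_le => w; rewrite mulr_ile1 ?ind_le1.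
apply: le_trans (@small_ball_scalar R I (u v v') (c0 v v') (2 * r) _ L L0 big _); last first.
  by move=> m; rewrite inE => /andP[].
apply: ler_expect => w; rewrite -qE /f -natrM mulnb ler_nat.
case: (ltP _ (2 * r)) => [_|]; first exact: leq_b1.
rewrite leqn0 eqb0; apply: contraL => /andP[a b]; rewrite -ltNge.
by apply: le_lt_trans (ler_normB _ _) _; move: a b; lra.
Qed.

Lemma mean_swap13 (R : realFieldType) (I : finType) (C : {set I}) (f : I -> I -> I -> R) :
  mean C (fun c => mean C (fun b => mean C (fun a => f a b c)))
  = mean C (fun c => mean C (fun b => mean C (fun a => f c b a))).
Proof.
transitivity (mean C (fun c => mean C (fun a => mean C (fun b => f a b c)))).
  by apply: eq_mean => c _; exact: mean_exchange.
by rewrite mean_exchange; apply: eq_mean => a _; exact: mean_exchange.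
Qed.

(** * Densities of large minors through one quadratic form *)

Section QuadraticPhase.
Context (R : realFieldType) (I : finType).
Local Notation Omega := {ffun {set I} -> bool}.
Implicit Types (w v : Omega) (A B C S X Y U : {set I}) (s : seq I) (K : R).

(** A single tuple encodes both q-sets A and B, so that elements are exchanged between them by
    permuting coordinates. *)
Fixpoint evens s : {set I} :=
  if s is a :: s' then (if s' is _ :: s'' then a |: evens s'' else finset.set0) else finset.set0.

Fixpoint odds s : {set I} :=
  if s is _ :: s' then (if s' is b :: s'' then b |: odds s'' else finset.set0) else finset.set0.

Lemma evens_odds_sub s k : (k \in evens s -> k \in s) /\ (k \in odds s -> k \in s).
Proof.
have [n] := ubnP (size s); elim: n s => // n IH [|a [|b s]] /=; try by split; rewrite inE.
rewrite ltnS => /ltnW/IH [ev od]; rewrite !inE; split=> /orP[->|]; rewrite ?orbT //.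
  by move/ev ->; rewrite !orbT.
by move/od ->; rewrite !orbT.
Qed.

Definition good w S K s :=
  [&& uniq s, all (fun k => k \notin S) s &
      K <= `|pm (mat R w) (S :|: odds s) (S :|: evens s)|].

(** The modulus is that of the symmetric coefficient T k m + T m k in the quadratic form of the next
    vertex. *)
Definition sgood w S K k m s :=
  [&& uniq [:: k, m & s], all (fun k => k \notin S) [:: k, m & s] &
      K <= `|pm (mat R w) (S :|: (m |: odds s)) (S :|: (k |: evens s))
             + pm (mat R w) (S :|: (k |: odds s)) (S :|: (m |: evens s))|].

Definition dens w S K q : R := tavg setT q.*2 (fun s => ind (good w S K s)).

Definition sdeg w S K s : R :=
  mean setT (fun m => mean setT (fun k => ind (sgood w S K k m s))).

Lemma sgood_perm w S K k m s k' m' s' :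
  perm_eq [:: k', m' & s'] [:: k, m & s] ->
  uniq [:: k, m & s] -> all (fun k => k \notin S) [:: k, m & s] ->
  sgood w S K k' m' s' = (K <= `|pm (mat R w) (S :|: (m' |: odds s')) (S :|: (k' |: evens s'))
             + pm (mat R w) (S :|: (k' |: odds s')) (S :|: (m' |: evens s'))|).
Proof.
by move=> p us aS; rewrite /sgood (perm_uniq p) us (perm_all _ p) aS.
Qed.

Lemma good_sgood w S K k m k2 m2 s :
  ind (good w S K [:: k, m, k2, m2 & s])
  <= ind (sgood w S (K / 2) k m [:: k2, m2 & s])
   + ind (sgood w S (K / 2) k m2 [:: k2, m & s])
   + ind (sgood w S (K / 2) m m2 [:: k2, k & s]) :> R.
Proof.
case: (boolP (good _ _ _ _)) => [|_]; last by rewrite !addr_ge0.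
move=> /and3P[us aS hK].
have p0 : perm_eq [:: k, m, k2, m2 & s] [:: k, m, k2, m2 & s] by [].
have p1 : perm_eq [:: k, m2, k2, m & s] [:: k, m, k2, m2 & s].
  by apply/seq.permP => p /=; lia.
have p2 : perm_eq [:: m, m2, k2, k & s] [:: k, m, k2, m2 & s].
  by apply/seq.permP => p /=; lia.
rewrite (sgood_perm _ _ p0) // (sgood_perm _ _ p1) // (sgood_perm _ _ p2) //=.
set b := pm _ (S :|: (k |: (m2 |: _))) (S :|: (m |: (k2 |: _))).
set c := pm _ (S :|: (k |: (m |: _))) (S :|: (m2 |: (k2 |: _))).
rewrite [m2 |: (m |: _)]setUCA [m2 |: (k |: _)]setUCA [m |: (k |: _)]setUCA -/b -/c.
move: hK => /=; set a := pm _ _ _ => hK.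
have le1 (x : R) : `|a| / 2 <= x -> K / 2 <= x.
  by apply: le_trans; rewrite ler_pM2r // invr_gt0.
rewrite -!natrD ler_nat; case/or3P: (three_terms a b c) => /le1 ->.
- by rewrite -addnA leq_addr.
- by rewrite addnAC leq_addl.
- by rewrite leq_addl.
Qed.

(** Permuting coordinates preserves averages, so the three pairings of [three_terms] have equal
    means, whence the factor 3. For a single pair the two terms of the coefficient are transposes of
    each other, hence equal. *)
Lemma sym_dense w S K q :
  dens w S K q.+1 <= 3 * tavg setT q.*2 (sdeg w S (K / 2)).
Proof.
case: q => [|q].
  rewrite /dens /sdeg /=; apply: le_trans (_ : mean setT (fun m => mean setT
      (fun k => ind (sgood w S (K / 2) k m [::]))) <= _).
    apply: ler_mean => m _; apply: ler_mean => k _; rewrite ler_nat.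
    case: (boolP (good _ _ _ _)) => // /and3P[us aS hK].
    rewrite lt0b (sgood_perm _ _ (perm_refl _) us aS) /= [X in _ + X]pm_matC.
    have nn (y : R) : `|y + y| = 2 * `|y|.
      by rewrite (_ : y + y = 2 * y) ?normrM ?normr_nat //; ring.
    rewrite nn.
    by move: hK => /=; set x := `| _ |; have := normr_ge0 _ : 0 <= x; lra.
  rewrite ler_peMl ?ler1n // mean_ge0 // => m _; apply: mean_ge0 => k _; exact: ler0n.
rewrite /dens /sdeg !doubleS /= -tavgZ; apply: ler_tavg => s _ _.
set m4 := mean _ _; pose F k m k2 m2 : R := ind (sgood w S (K / 2) k m [:: k2, m2 & s]).
pose E (G : I -> I -> I -> I -> R) := mean [set: I] (fun m2 => mean setT (fun k2 => mean setT (fun m =>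
  mean setT (fun k => G k m k2 m2)))).
rewrite -[X in 3 * X]/(E F).
have E1 : E (fun k m k2 m2 => F k m2 k2 m) = E F.
  exact: esym (mean_swap13 setT (fun m k2 m2 => mean setT (fun k => F k m k2 m2))).
have E2 : E (fun k m k2 m2 => F m m2 k2 k) = E F.
  rewrite -E1; apply: eq_mean => m2 _; apply: eq_mean => k2 _.
  exact: mean_exchange.
have -> : 3 * E F = E F + E (fun k m k2 m2 => F k m2 k2 m) + E (fun k m k2 m2 => F m m2 k2 k).
  by rewrite E1 E2; ring.
rewrite /E -!meanD /m4; apply: ler_mean => m2 _.
rewrite -!meanD; apply: ler_mean => k2 _.
rewrite -!meanD; apply: ler_mean => m _.
rewrite -!meanD; apply: ler_mean => k _.
exact: good_sgood.
Qed.

End QuadraticPhase.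

Lemma mean_setT_ind (R : realFieldType) (I : finType) (p : pred I) (c : R) :
  c <= mean [set: I] (fun k => ind (p k)) -> c * #|I|%:R <= #|[set k | p k]|%:R.
Proof.
have [I0|I0] := eqVneq #|I| 0%N; first by move=> _; rewrite I0 mulr0.
rewrite /mean cardsT ler_pdivlMr ?ltr0n ?lt0n // -natr_sum big_mkcond /=.
rewrite (eq_bigr (fun k => if p k then 1%N else 0%N)) => [|k _]; last by rewrite inE; case: (p k).
by rewrite -big_mkcond sum1_card cardsE.
Qed.

Section Step.
Context (R : archiRealFieldType).

(** V consists of 2 L^2 indices of degree at least c / 2; of the 3 L^2 partners of each, L^2 lie
    outside V. The factor between K / 2 and K / 4 is the 2 r of [quad_small_ball]. *)
Lemma pair_survives (I : finType) (t : I) (S : {set I}) (w : {ffun {set I} -> bool})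
    (K c e : R) (L : nat) s : (0 < L)%N -> 0 < c -> 0 <= e -> 6 / L%:R <= e ^+ 2 ->
  (3 * L ^ 2)%:R <= c / 2 * #|I|%:R -> t \notin S ->
  c <= sdeg w (t |: S) (K / 2) s ->
  expect (fun x => ind (~~ good (upd t setT x w) S (K / 4) s)) <= e.
Proof.
move=> L0 c0 e0 Le nL tS cs; set S' := t |: S in cs.
have n0 : (0 < #|I|)%N by apply/card_gt0P; exists t.
have I0 : [set: I] != finset.set0 by apply/set0Pn; exists t; rewrite inE.
have c2 : 0 <= c / 2 by rewrite divr_ge0 // ltW.
pose p m k := sgood w S' (K / 2) k m s.
pose dg m : R := mean setT (fun k => ind (p m k)).
have : c / 2 <= mean setT (fun m => ind (c / 2 <= dg m)).
  apply: mean_dense => // [m _|]; first by apply: mean_le => // k _; exact: ind_le1.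
  by rewrite mulr2n; move: cs; rewrite /sdeg -/(mean _ dg); lra.
move=> /mean_setT_ind/(le_trans nL); rewrite ler_nat => many.
have [V VM cV] : exists2 V : {set I}, V \subset [set m | c / 2 <= dg m] & #|V| = (2 * L ^ 2)%N.
  by apply: subset_card; apply: leq_trans many; rewrite leq_mul2r orbT.
have row m : m \in V -> (L ^ 2 <= #|[set k | (k \notin V) && p m k]|)%N.
  move=> /(subsetP VM); rewrite inE => /mean_setT_ind/(le_trans nL); rewrite ler_nat => km.
  have -> : [set k | (k \notin V) && p m k] = [set k | p m k] :\: V.
    by apply/setP => k; rewrite !inE.
  have := cardsID V [set k | p m k]; have := subset_leq_card (subsetIr [set k | p m k] V).
  rewrite cV; move: km; clear; lia.
have [m0 m0V] : exists m, m \in V.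
  by apply/set0Pn; rewrite -card_gt0 cV muln_gt0 expn_gt0 L0.
have [k0] : exists k, k \in [set k | (k \notin V) && p m0 k].
  by apply/set0Pn; rewrite -card_gt0 (leq_trans _ (row _ m0V)) // expn_gt0 L0.
rewrite inE => /andP[_ /and3P[/and3P[_ _ us0] /and3P[_ _ aS0] _]].
have us : uniq s := us0; have aS' : all (fun k => k \notin S') s := aS0.
have aS : all (fun k => k \notin S) s.
  by apply: sub_all aS' => k; rewrite !inE negb_or => /andP[].
have ts : t \notin s.
  by apply/negP => /(allP aS'); rewrite !inE eqxx.
have rem (A : {set I}) : (A \subset [set k in s]) -> (S' :|: A) :\ t = S :|: A.
  move=> As; apply/setP => k; rewrite !inE; have [->|//] := eqVneq k t.
  rewrite (negbTE tS) /=; apply/esym/negbTE; apply: contra ts => /(subsetP As).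
  by rewrite inE.
have es : evens s \subset [set k in s] by apply/subsetP => k /(evens_odds_sub s k).1; rewrite inE.
have os : odds s \subset [set k in s] by apply/subsetP => k /(evens_odds_sub s k).2; rewrite inE.
pose A := S' :|: odds s; pose B := S' :|: evens s.
have tA : t \in A by rewrite !inE eqxx.
have tB : t \in B by rewrite !inE eqxx.
pose T k m := if (k \notin A) && (m \notin B) then pm (mat R w) (k |: A) (m |: B) else 0.
have hT m : m \in V ->
    (L ^ 2 <= #|[set k | (k \notin V) && (2 * (K / 4) <= `|T k m + T m k|)%R]|)%N.
  move=> mV; apply: leq_trans (row m mV) _; apply: subset_leq_card; apply/subsetP => k.
  rewrite !inE => /andP[-> /and3P[]] /=.
  rewrite inE negb_or -!andbA => /and4P[km ks ms _] /and3P[kS mS _] hK.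
  have nin j : j \notin S' -> j \notin s -> (j \notin A) /\ (j \notin B).
    move=> jS js; split; rewrite in_setU negb_or jS /=; apply: contra js.
      exact: (evens_odds_sub s j).2.
    exact: (evens_odds_sub s j).1.
  have [kA kB] := nin k kS ks; have [mA mB] := nin m mS ms.
  rewrite /T kA mB mA kB /= addrC; move: hK; rewrite /A /B !(setUCA _ S').
  by have -> : 2 * (K / 4) = K / 2 by field.
have := quad_small_ball t (pm (mat R w) A B) L0 cV hT.
move=> /le_trans/(_ Le); rewrite ler_pXn2r // ?nnegrE; last first.
  by apply: expect_ge0.
apply: le_trans; apply: ler_expect => x; rewrite /good us aS /= -ltNge.
by rewrite -(rem _ os) -(rem _ es) pm_new_both.
Qed.

(** [sym_dense] gives mean degree del / 3 = 2 c, so a share c = del / 6 of the tuples has degree at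
    least c. Outside an event of probability th, less than del / 12 of this share is lost. *)
Lemma quad_step (del th : R) : 0 < del -> 0 < th -> exists n0 : nat,
  forall (I : finType) (t : I) (S : {set I}) w K q,
    (n0 <= #|I|)%N -> t \notin S -> del <= dens w (t |: S) K q.+1 ->
    expect (fun x => ind (~~ (del / 12 <= dens (upd t setT x w) S (K / 4) q))) <= th.
Proof.
move=> del0 th0; pose c := del / 6; pose e := th * (del / 12).
have e0 : 0 < e by rewrite mulr_gt0 // divr_gt0.
have c0 : 0 < c by rewrite divr_gt0.
have [L L0 HL] := @ex_div_le R 6 (e ^+ 2) (exprn_gt0 _ e0).
have [n0 n00 Hn0] := @ex_nat_ge R ((3 * L ^ 2)%:R / (c / 2)).
exists n0 => I t S w K q n0I tS dense.
have nL : (3 * L ^ 2)%:R <= c / 2 * #|I|%:R.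
  rewrite mulrC -ler_pdivrMr ?divr_gt0 //; apply: le_trans Hn0 _.
  by rewrite ler_nat.
have I0 : [set: I] != finset.set0 by apply/set0Pn; exists t; rewrite inE.
pose gd s := c <= sdeg w (t |: S) (K / 2) s.
have hgood : c <= tavg setT q.*2 (fun s => ind (gd s)).
  apply: tavg_dense => // [s||]; last exact: ltW.
    by apply: mean_le => // m _; apply: mean_le => // k _; exact: ind_le1.
  by have := le_trans dense (sym_dense w (t |: S) K q); rewrite mulr2n /c; lra.
pose bad x : R := tavg setT q.*2 (fun s => ind (gd s && ~~ good (upd t setT x w) S (K / 4) s)).
have Ebad : expect bad <= e.
  rewrite /bad /expect tavg_mean; apply: tavg_le => [|s]; first exact: ltW.
  have [gs|_] := boolP (gd s); last by apply: mean_le => [|x _]; rewrite ?ltW.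
  exact: (@pair_survives I t S w K c e L s L0 c0 (ltW e0) HL nL tS gs).
have del12 : 0 < del / 12 by rewrite divr_gt0.
apply: le_trans (_ : expect (fun x => ind (del / 12 <= bad x)) <= _).
  apply: ler_expect => x; rewrite ler_nat.
  case: (leP (del / 12) (bad x)) => [_|few]; first exact: leq_b1.
  rewrite leqn0 eqb0 negbK.
  have : tavg setT q.*2 (fun s => ind (gd s)) <=
     tavg setT q.*2 (fun s => ind (good (upd t setT x w) S (K / 4) s)
       + ind (gd s && ~~ good (upd t setT x w) S (K / 4) s)) :> R.
    apply: ler_tavg => s _ _.
    by case: (gd s); case: good; rewrite /= ?addr0 ?add0r.
  by rewrite tavgD -/(bad x) -/(dens _ _ _ _) => h; move: h hgood few; rewrite /c; lra.
apply: le_trans (mean_markov del12 _) _ => [x _|]; first exact: tavg_ge0.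
by rewrite ler_pdivrMr.
Qed.

Lemma quad_phase q (del th : R) : 0 < del -> 0 < th -> exists n0 : nat,
  forall (I : finType) (ss : seq I) (K : R), (n0 <= #|I|)%N -> size ss = q -> uniq ss ->
    expect (fun w : {ffun {set I} -> bool} => ind (~~ (K / 4 ^+ q <= `|pm (mat R w) finset.set0 finset.set0|)) : R)
    <= expect (fun w => ind (~~ (del <= dens w [set t in ss] K q))) + th.
Proof.
elim: q del th => [|q IH] del th del0 th0.
  exists 0%N => I [|//] K _ _ _; rewrite -[leLHS]addr0 lerD ?(ltW th0) //.
  rewrite set_nil.
  apply: ler_expect => w; rewrite ler_nat expr0 divr1 /dens /= /good /= setU0.
  by case: (K <= _) => //=; rewrite -ltNge del0.
have del12 : 0 < del / 12 by rewrite divr_gt0.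
have th2 : 0 < th / 2 by rewrite divr_gt0.
have [n1 H1] := IH _ _ del12 th2; have [n2 H2] := quad_step del0 th2.
exists (maxn n1 n2) => I [//|t ss] K; rewrite geq_max => /andP[n1I n2I] [sss] /andP[tss uss].
have -> : K / 4 ^+ q.+1 = K / 4 / 4 ^+ q by rewrite exprS invfM mulrA.
apply: le_trans (H1 I ss (K / 4) n1I sss uss) _.
rewrite [X in _ <= _ + X]splitr addrA lerD2r.
have tS : t \notin [set t in ss] by rewrite inE.
rewrite -(cexpT _ [ffun=> true]) (@cexp_refresh _ _ _ t setT) => [|m _]; last by rewrite inE.
rewrite cexpT -(expect_cst {set I} (th / 2)) -expectD; apply: ler_expect => w.
have -> : [set t0 in t :: ss] = t |: [set t in ss] by apply/setP => k; rewrite !inE.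
rewrite addrC -[ind _]mulr1; apply: ind_case => [dense|_]; first exact: H2.
apply: le_trans (_ : 1 <= _); last by rewrite lerDr ltW.
by apply: expect_le => x; exact: ind_le1.
Qed.

End Step.

Lemma sqr_le_exp2 n : (4 <= n)%N -> (n ^ 2 <= 2 ^ n)%N.
Proof.
elim: n => // n IH; rewrite leq_eqVlt => /orP[/eqP <- //|]; rewrite ltnS => n4.
apply: leq_trans (_ : 2 * n ^ 2 <= _)%N; last by rewrite [X in (_ <= X)%N]expnS leq_mul2l IH.
rewrite -mulnn -[(n ^ 2)%N]mulnn; move: n4; clear; nia.
Qed.

(** * Assembling the stages of the lower bound *)

Section Lower.
Context (R : archiRealFieldType).

Definition block_fail (m L b : nat) : R :=
  2 ^+ m * (2 / L%:R) ^+ b.+1 + m%:R * (2 * 2^-1 ^+ (3 * m)).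

(** The start is X = Y = everything, with minor 1. Besides U3, the vertices are m for each of the B
    blocks, u m leftovers and [ns] for the descent, where m = 2^h; the constants 17 and 33 encode
    the window 16 u m <= ns <= 32 u m of [halving]. *)
Lemma first_minors (I : finType) (U3 : {set I}) u h L b B :
  (0 < L)%N -> (4 * L ^ 2 < u)%N ->
  (#|U3| + B * 2 ^ h + 17 * (u * 2 ^ h) <= #|I| <= #|U3| + B * 2 ^ h + 33 * (u * 2 ^ h))%N ->
  expect (fun w => ind (~~ large_minor U3 (#|U3| + u)
    (gain R I (2 ^ h) b ^+ B / 4 ^+ (u * (2 ^ h).-1)) w))
  <= B%:R * block_fail (2 ^ h) L b + 130 * (u%:R * 2^-1 ^+ u).
Proof.
move=> L0 Lu; set m := (2 ^ h)%N => /andP[nlo nhi].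
have m0 : (0 < m)%N by rewrite expn_gt0.
have u2 : (2 <= u)%N by have : (0 < L ^ 2)%N by [rewrite expn_gt0 L0]; move: Lu; clear; lia.
pose ns := (#|I| - #|U3| - B * m - u * m)%N.
pose ts := take ns (enum (~: U3)).
have cC : #|~: U3| = (#|I| - #|U3|)%N by have := cardsC U3; lia.
have sts : size ts = ns by rewrite size_takel // -cardE cC /ns; move: nlo; clear; lia.
have uts : uniq ts by rewrite take_uniq // enum_uniq.
have tsU3 t : t \in ts -> t \notin U3.
  by move=> /mem_take; rewrite mem_enum inE.
pose U0 := U3 :|: [set t in ts].
have cU0 : #|U0| = (#|U3| + ns)%N.
  rewrite cardsU (_ : U3 :&: _ = finset.set0) ?cards0 ?subn0; last first.
    by apply/setP => t; rewrite !inE; apply/negbTE/negP => /andP[tU /tsU3]; rewrite tU.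
  by rewrite cardsE (card_uniqP uts) sts.
have U0E : U0 :\: [set t in ts] = U3.
  apply/setP => t; rewrite !inE; case: (boolP (t \in ts)) => [/tsU3/negbTE ->//|].
  by rewrite orbF.
have cCU0 : #|~: U0| = (B * m + u * m)%N.
  by have := cardsC U0; rewrite cU0 /ns; move: nlo; clear; lia.
have [T TU cT] : exists2 T : {set I}, T \subset ~: U0 & #|T| = m.
  apply: subset_card; rewrite cCU0 -mulnDl leq_pmull //; move: u2; clear; lia.
pose a0 := gain R I m b ^+ B.
have I0 : (0 < #|I|)%N by move: nlo u2 m0; rewrite /m; clear; nia.
have a00 : 0 < a0.
  rewrite exprn_gt0 // !divr_gt0 ?exprn_gt0 ?mulr_gt0 // ltr0n muln_gt0 //=.
pose F0 w : R := ind (~~ large_minor U0 (#|U0| + u * m) a0 w).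
rewrite (expect_mix (touch U0)) -/(cexp _ _ _).
apply: le_trans (_ : expect (fun w => 130 * (u%:R * 2^-1 ^+ u) + F0 w) <= _).
  apply: ler_expect => w; rewrite -[F0 w]mulr1; apply: ind_case => [lm|_]; last first.
    apply: le_trans (_ : 1 <= _); last by rewrite lerDr !mulr_ge0 ?exprn_ge0 ?invr_ge0.
    by apply: expect_le => v; exact: ind_le1.
  have tsU0 : {subset ts <= U0} by move=> t tts; rewrite !inE tts orbT.
  have szs : (16 * (u * 2 ^ h) <= size ts <= 32 * (u * 2 ^ h))%N.
    by rewrite sts /ns -/m; move: nlo nhi; clear; lia.
  by have := halving u2 uts tsU0 szs a00 lm; rewrite U0E.
rewrite expectD expect_cst addrC lerD2r.
have := @growth_blocks R I m L b U0 m0 L0 B setT setT T [ffun=> true] 1.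
rewrite subsetT cT !subsetT setTI pm_full expr1n ltr01 lexx => H.
have -> : expect F0 = cexp (inner setT) F0 [ffun=> true].
  rewrite (_ : inner setT = setT) ?cexpT //.
  by apply/setP => p; rewrite !inE subsetT.
apply: le_trans (H _ _ _ _ _ _ _ _ _) => //.
- apply: ler_cexp => v; rewrite /F0 cardsT mul1r -/a0.
  rewrite (_ : (#|I| - B * m = #|U0| + u * m)%N) // cU0 /ns; move: nlo; clear; lia.
- by rewrite disjoint_sym disjoints_subset.
- rewrite (_ : setT :\: T :\: U0 = ~: U0 :\: T); last first.
    by apply/setP => t; rewrite !inE andbC andbT.
  rewrite cardsDS // cCU0 cT.
  by move: Lu m0; set x := (L ^ 2)%N; clear; nia.
Qed.

Lemma minor_survives (th : R) : 0 < th -> exists u0 : nat,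
  forall (I : finType) (la lb ss : seq I) u h L b B,
    (u0 <= u)%N -> size la = u -> size lb = u -> size ss = u -> uniq (ss ++ la ++ lb) ->
    (0 < L)%N -> (4 * L ^ 2 < u)%N ->
    (3 * u + B * 2 ^ h + 17 * (u * 2 ^ h) <= #|I| <= 3 * u + B * 2 ^ h + 33 * (u * 2 ^ h))%N ->
  expect (fun w : {ffun {set I} -> bool} =>
    ind (~~ (gain R I (2 ^ h) b ^+ B / 4 ^+ (u * (2 ^ h).-1)
      <= pm (mat R w) ([set t in ss] :|: [set t in lb]) ([set t in ss] :|: [set t in la]) ^+ 2)))
  <= B%:R * block_fail (2 ^ h) L b + th.
Proof.
move=> th0; have th2 : 0 < th / 2 by rewrite divr_gt0.
have [u1 Hu1] := two_sided th2; have [u2 u20 Hu2] := @ex_div_le R 130 _ th2.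
exists (maxn u1 (maxn u2 4)) => I la lb ss u h L b B.
rewrite !geq_max => /and3P[u1u u2u u4] sla slb sss; rewrite cat_uniq => /and3P[uss /hasPn dis uab].
move=> L0 Lu nI; pose U3 := [set t in ss] :|: [set t in la] :|: [set t in lb].
have nS t : t \in la ++ lb -> t \notin [set t in ss] by move=> /dis; rewrite inE.
have cU3 : #|U3| = (3 * u)%N.
  have -> : U3 = [set t in ss ++ (la ++ lb)].
    by apply/setP => t; rewrite !inE !mem_cat orbA.
  rewrite cardsE; have /card_uniqP -> : uniq (ss ++ la ++ lb).
    by rewrite cat_uniq uss uab andbT; apply/hasPn.
  by rewrite !size_cat sla slb sss; clear; lia.
set a := gain R I _ _ ^+ _ / _; pose F3 w : R := ind (~~ large_minor U3 (#|U3| + u) a w).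
rewrite (expect_mix (touch U3)) -/(cexp _ _ _).
apply: le_trans (_ : expect (fun w => th / 2 + F3 w) <= _).
  apply: ler_expect => w; rewrite -[F3 w]mulr1; apply: ind_case => [lm|_].
    exact: (Hu1 I la lb [set t in ss] U3 u a w).
  apply: le_trans (_ : 1 <= _); last by rewrite lerDr ltW.
  by apply: expect_le => v; exact: ind_le1.
rewrite expectD expect_cst.
have := @first_minors I U3 u h L b B L0 Lu; rewrite cU3 => /(_ nI).
rewrite -cU3 -/F3 => h1.
suff : 130 * (u%:R * 2^-1 ^+ u) <= th / 2 by move: h1; rewrite /F3; lra.
apply: le_trans Hu2; apply: le_trans (_ : 130 / u%:R <= _); last first.
  by rewrite ler_pM2l // lef_pV2 ?posrE ?ltr0n ?ler_nat // (leq_trans u20).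
have up : 0 < u%:R :> R by rewrite ltr0n (leq_trans _ u4).
rewrite ler_pM2l // exprVn ler_pdivrMr ?exprn_gt0 // mulrC ler_pdivlMr //.
by rewrite -expr2 -!natrX ler_nat sqr_le_exp2.
Qed.

End Lower.

(** * Choice of the parameters *)

(** The conclusion reads Q >= n^(n - 2 n / d) without real powers. Of the exponent 2 n, n / 2 pays
    for rows outside the blocks, n / 2 for bad rows, and n for the constant G, because G^d <= n. *)
Lemma lower_arith (R : realFieldType) (I : finType) (m B b u d E : nat) :
  let n := #|I| in
  let Q := gain R I m b ^+ B / 4 ^+ (u * m.-1) / 16 ^+ u in
  (0 < m)%N -> (0 < n)%N -> (n <= E * (2 * m))%N -> (m * B <= n)%N ->
  (2 * (d * (n - m * B)) <= n)%N -> (4 * d * (b * B) <= n)%N -> (0 < d)%N -> (0 < u)%N ->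
  (0 < E)%N -> (B <= E)%N -> (u * m <= n)%N ->
  ((E * 4 * 2 ^ E * 4 * 16) ^ d <= n)%N ->
  0 < Q /\ n%:R ^+ (d * n) <= n%:R ^+ (2 * n) * Q ^+ d.
Proof.
move=> n Q m0 n0 nE mBn h2 h3 d0 u0 E0 BE umn hG.
have n1 : 1 <= n%:R :> R by rewrite ler1n.
have np : 0 < n%:R :> R by rewrite ltr0n.
pose x : R := (2 * n)%:R * (2 * m)%:R.
have x0 : 0 < x by rewrite mulr_gt0 // ltr0n muln_gt0.
have gE : gain R I m b = (2 * m)%:R ^+ m / x ^+ b / 2 ^+ n by [].
have Q0 : 0 < Q.
  by rewrite /Q gE !divr_gt0 ?exprn_gt0 ?divr_gt0 ?exprn_gt0 ?ltr0n ?muln_gt0.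
have ne (y : R) k : 0 < y -> y ^+ k != 0 by move=> y0; rewrite gt_eqF ?exprn_gt0.
split=> //.
have QE : (2 * m)%:R ^+ (m * B) = Q * (x ^+ (b * B) * 2 ^+ (n * B) * 4 ^+ (u * m.-1) * 16 ^+ u).
  rewrite /Q gE !exprM !expr_div_n; field.
  by rewrite !ne ?exprn_gt0.
pose G : R := E%:R * 4 * 2 ^+ E * 4 * 16.
have key : n%:R ^+ (m * B) <= Q * n%:R ^+ (2 * (b * B)) * G ^+ n.
  have s1 : n%:R ^+ (m * B) <= E%:R ^+ n * (2 * m)%:R ^+ (m * B) :> R.
    apply: le_trans (_ : (E * (2 * m))%:R ^+ (m * B) <= _).
      by rewrite lerXn2r ?nnegrE ?ler0n // ler_nat.
    rewrite natrM exprMn ler_wpM2r ?exprn_ge0 ?ler0n //.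
    by rewrite ler_weXn2l // ler1n.
  have GE : G ^+ n = E%:R ^+ n * 4 ^+ n * (2 ^+ E) ^+ n * 4 ^+ n * 16 ^+ n by rewrite /G !exprMn.
  apply: le_trans s1 _; rewrite QE GE.
  have -> : Q * n%:R ^+ (2 * (b * B)) * (E%:R ^+ n * 4 ^+ n * (2 ^+ E) ^+ n * 4 ^+ n * 16 ^+ n)
    = E%:R ^+ n * (Q * ((4 ^+ n * n%:R ^+ (2 * (b * B))) * (2 ^+ E) ^+ n * 4 ^+ n * 16 ^+ n)) by ring.
  rewrite ler_wpM2l ?exprn_ge0 ?ler0n // ler_wpM2l ?(ltW Q0) //.
  have f16 : 16 ^+ u <= 16 ^+ n :> R.
    by rewrite ler_weXn2l ?ler1n // (leq_trans _ umn) // leq_pmulr.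
  have f4 : 4 ^+ (u * m.-1) <= 4 ^+ n :> R.
    by rewrite ler_weXn2l ?ler1n // (leq_trans _ umn) // leq_mul2l leq_pred orbT.
  have f2 : 2 ^+ (n * B) <= (2 ^+ E) ^+ n :> R.
    by rewrite -exprM [(E * n)%N]mulnC ler_weXn2l ?ler1n // leq_mul2l BE orbT.
  have fx : x ^+ (b * B) <= 4 ^+ n * n%:R ^+ (2 * (b * B)).
    apply: le_trans (_ : (4 * n%:R ^+ 2) ^+ (b * B) <= _).
      rewrite lerXn2r ?nnegrE ?(ltW x0) ?mulr_ge0 ?exprn_ge0 ?ler0n //.
      rewrite /x -natrM -natrX -(natrM _ 4) ler_nat.
      have mn : (m <= n)%N by apply: leq_trans umn; rewrite leq_pmull.
      by rewrite -mulnn; move: mn; clear; nia.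
    rewrite exprMn -exprM ler_wpM2r ?exprn_ge0 ?ler0n //.
    rewrite ler_weXn2l ?ler1n // (leq_trans _ h3) //.
    by rewrite leq_pmull // muln_gt0.
  have xb := ltW x0.
  by do 3![apply: ler_pM; rewrite ?mulr_ge0 ?exprn_ge0 ?ler0n //].
have G0 : 0 <= G by rewrite /G !mulr_ge0 ?exprn_ge0 ?ler0n.
have Gd : G ^+ d <= n%:R.
  by rewrite /G -natrX -!natrM -natrX ler_nat.
move: {QE gE} Q G Q0 key G0 Gd => Q G Q0 key G0 Gd.
have key2 : n%:R ^+ (d * (m * B)) <= Q ^+ d * n%:R ^+ (d * (2 * (b * B))) * n%:R ^+ n.
  rewrite [(d * (m * B))%N]mulnC exprM.
  have := key; rewrite -(ler_pXn2r d0) ?nnegrE ?mulr_ge0 ?exprn_ge0 ?ler0n ?(ltW Q0) //.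
  move/le_trans; apply.
  rewrite !exprMn -[_ ^+ (2 * (b * B)) ^+ d]exprM [(2 * (b * B) * d)%N]mulnC ler_wpM2l //.
    by rewrite mulr_ge0 ?exprn_ge0 ?ler0n // ltW.
  by rewrite -exprM mulnC exprM lerXn2r ?nnegrE ?exprn_ge0 ?ler0n.
have -> : (d * n = d * (m * B) + d * (n - m * B))%N by rewrite -mulnDr subnKC.
rewrite exprD; apply: le_trans (_ : Q ^+ d * n%:R ^+ (d * (2 * (b * B))) * n%:R ^+ n
    * n%:R ^+ (d * (n - m * B)) <= _).
  by rewrite ler_wpM2r ?exprn_ge0 ?ler0n.
rewrite -!mulrA -!exprD [leRHS]mulrC ler_wpM2l ?exprn_ge0 ?(ltW Q0) //.
rewrite ler_weXn2l //; move: h2 h3; move: (b * B)%N (d * (n - m * B))%N => y z.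
by clear; lia.
Qed.

Section PermanentLower.
Context (R : realFieldType) (I : finType).

Lemma evens_odds_card (s : seq I) q : uniq s -> size s = q.*2 ->
  [/\ #|evens s| = q, #|odds s| = q & [disjoint evens s & odds s]].
Proof.
elim: q s => [|q IH] [|a [|b s]] //=.
  by move=> _ _; split; rewrite ?cards0 // disjoints_subset sub0set.
rewrite inE negb_or -andbA => /and4P[ab as' bs us] [/(IH s us)[ev od dis]].
have sub k := evens_odds_sub s k.
have nin k : k \notin s -> (k \notin evens s) && (k \notin odds s).
  by move=> ks; apply/andP; split; apply: contra ks; [exact: (sub k).1|exact: (sub k).2].
have /andP[ae ao] := nin a as'; have /andP[be bo] := nin b bs.
split; first by rewrite cardsU1 ae ev.
  by rewrite cardsU1 bo od.
rewrite disjoints_subset; apply/subsetP => k; rewrite !inE negb_or.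
case/orP => [/eqP->|ke]; first by rewrite ab ao.
rewrite (disjointFr dis ke) andbT; apply: contraTneq ke => ->; exact: be.
Qed.

(** Exchange the averages over tuples and signs, then apply Markov at level 1/2 to the share of bad
    tuples. Tuples with repetitions or meeting S give the term of order 1 / n. *)
Lemma dense_init (S : {set I}) u (K th : R) : 0 <= th -> [set: I] != finset.set0 ->
  (forall A B : {set I}, #|A| = u -> #|B| = u -> [disjoint A & B] ->
     [disjoint A & S] -> [disjoint B & S] ->
     expect (fun w => ind (~~ (K <= `|pm (mat R w) (S :|: B) (S :|: A)|))) <= th) ->
  expect (fun w => ind (~~ (1 / 2 <= dens w S K u)))
  <= 2 * (th + (u.*2 * (u.*2 + #|S|))%:R / #|I|%:R).
Proof.
move=> th0 I0 hS; pose bad w : R := tavg setT u.*2 (fun s => ind (~~ good w S K s)).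
have half : 0 < 1 / 2 :> R by rewrite divr_gt0.
apply: le_trans (_ : expect (fun w => ind (1 / 2 <= bad w)) <= _).
  apply: ler_expect => w; rewrite ler_nat.
  case: (leP (1 / 2) (bad w)) => [_|few]; first exact: leq_b1.
  rewrite leqn0 eqb0 negbK; have : dens w S K u + bad w = 1.
    rewrite -tavgD -[RHS](@tavg_cst R I setT u.*2 1 I0); apply: eq_tavg => s.
    by case: good; rewrite /= ?addr0 ?add0r.
  by move: few; lra.
apply: le_trans (mean_markov half _) _ => [w _|]; first exact: tavg_ge0.
rewrite -/(expect _) div1r invrK mulrC ler_wpM2l //.
rewrite -[#|I|]cardsT -(@tavg_cst R I setT u.*2 th I0).
apply: le_trans (lerD (lexx _) (@tavg_uniq R I setT S u.*2)). rewrite -tavgD /expect tavg_mean.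
apply: ler_tavg => s ss _; rewrite -/(expect _) /good.
have [/andP[us aS]|ns] := boolP (uniq s && all (fun a => a \notin S) s); last first.
  apply: le_trans (_ : 1 <= _); last by rewrite lerDr.
  by apply: expect_le => w; exact: ind_le1.
rewrite addr0 us aS /=; have [ce co dis] := evens_odds_card us ss.
have sub k := evens_odds_sub s k.
apply: hS => //; rewrite disjoints_subset; apply/subsetP => k kE; rewrite inE (allP aS) //.
  exact: (sub k).1.
exact: (sub k).2.
Qed.

End PermanentLower.

(** For L = 2 * 4^s one has 2 / L = 2^(-2s), so its power b + 1 is below 2^(-2m) and beats the 2^m
    choices of bad rows. *)
Lemma block_fail_le (R : archiRealFieldType) m s b : (0 < m)%N -> (m < s * b.+1)%N ->
  block_fail R m (2 * 4 ^ s) b <= 3 / m%:R.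
Proof.
move=> m0 mb; rewrite /block_fail.
have p0 k : 0 < 2 ^+ k :> R by rewrite exprn_gt0.
have -> : 2 / (2 * 4 ^ s)%:R = 2^-1 ^+ (2 * s) :> R.
  rewrite natrM invfM mulrA divff ?pnatr_eq0 // mul1r exprVn natrX exprM.
  by congr (_ ^+ _)^-1; rewrite -natrX.
have h0 k : 0 <= 2^-1 ^+ k :> R by rewrite exprn_ge0 // invr_ge0.
have e1 : 2 ^+ m * (2^-1 ^+ (2 * s)) ^+ b.+1 <= 2^-1 ^+ m :> R.
  rewrite -exprM; apply: le_trans (_ : 2 ^+ m * 2^-1 ^+ (m + m) <= _).
    rewrite ler_wpM2l ?(ltW (p0 _)) // ler_wiXn2l ?invr_ge0 ?invf_le1 ?ler1n //.
    by rewrite -mulnA; move: mb; clear; lia.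
  by rewrite exprD mulrA exprVn divff ?mul1r // gt_eqF.
have mp : 0 < m%:R :> R by rewrite ltr0n.
have m2 : m%:R * 2^-1 ^+ m <= 1 :> R.
  by rewrite exprVn ler_pdivrMr // mul1r -natrX ler_nat ltnW // ltn_expl.
have e2 : m%:R * (2 * 2^-1 ^+ (3 * m)) <= 2 * 2^-1 ^+ m :> R.
  rewrite mulrCA ler_pM2l // (_ : 3 * m = m + (m + m))%N; last by clear; lia.
  rewrite exprD mulrA -[leRHS]mul1r; apply: ler_pM => //; first by rewrite mulr_ge0 ?ler0n.
  by rewrite ler_wiXn2l ?invr_ge0 ?invf_le1 ?ler1n // leq_addr.
rewrite ler_pdivlMr //; apply: le_trans (_ : 3 * (m%:R * 2^-1 ^+ m) <= _).
  have -> : 3 * (m%:R * 2^-1 ^+ m) = (2^-1 ^+ m + 2 * 2^-1 ^+ m) * m%:R :> R by ring.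
  by rewrite ler_wpM2r ?ler0n // lerD.
by rewrite -[leRHS]mulr1 ler_pM2l.
Qed.

Lemma permanent_lower (R : realType) (d : nat) (th : R) : (0 < d)%N -> 0 < th ->
  exists n0 : nat, forall I : finType, (n0 <= #|I|)%N ->
    expect (fun w : {ffun {set I} -> bool} => ind (~~ (#|I|%:R ^+ (d * #|I|)
      <= #|I|%:R ^+ (2 * #|I|) * (pm (mat R w) finset.set0 finset.set0 ^+ 2) ^+ d))) <= th.
Proof.
move=> d0 th0; have th8 : 0 < th / 8 by rewrite divr_gt0.
have th2 : 0 < th / 2 by rewrite divr_gt0.
have half : 0 < 1 / 2 :> R by rewrite divr_gt0.
have [u1 Hu1] := minor_survives th8.
(* Each block tolerates about m / (4 d) bad rows; over all blocks, after the d-th power, they cost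
   at most n^(n/2). L makes more of them unlikely. *)
pose s := (4 * d)%N; pose L := (2 * 4 ^ s)%N.
pose u := (maxn u1 (4 * L ^ 2).+1); have u1u : (u1 <= u)%N by rewrite leq_maxl.
have Lu : (4 * L ^ 2 < u)%N by rewrite leq_maxr.
have L0 : (0 < L)%N by rewrite muln_gt0 expn_gt0.
have u0 : (0 < u)%N by apply: leq_trans Lu.
have [n1 H1] := quad_phase u half th2.
(* At most 3 u + 33 u m <= 36 u m vertices lie outside the blocks, and 72 d u m <= n makes d times
   this number at most n / 2. The number of blocks stays below the constant E. *)
pose Cu := (72 * d * u)%N; pose E := (2 * Cu)%N.
have Cu0 : (0 < Cu)%N by rewrite !muln_gt0 d0.
have th4 : 0 < th / 4 by rewrite divr_gt0.
have [n2 n20 Hn2] := @ex_div_le R (2 * (u.*2 * (u.*2 + u))%:R + 6 * (E * E)%:R) _ th4.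
exists (maxn n1 (maxn n2 (maxn Cu ((E * 4 * 2 ^ E * 4 * 16) ^ d))))%N => I.
set n := #|I|; rewrite !geq_max => /and4P[n1n n2n Cun Gn].
have n0 : (0 < n)%N by apply: leq_trans Cun.
(* The halving asks for a power of 2; this one is within a factor 2 of n / Cu. *)
pose h := trunc_log 2 (n %/ Cu); pose m := (2 ^ h)%N.
have m0 : (0 < m)%N by rewrite expn_gt0.
have /andP[mlo mhi] : (m <= n %/ Cu < 2 * m)%N.
  by rewrite -expnS; apply: trunc_log_bounds => //; rewrite divn_gt0.
have Cm : (Cu * m <= n)%N by rewrite mulnC -leq_divRL.
have nE : (n <= E * m)%N.
  by move: mhi; rewrite ltn_divLR // => /ltnW; rewrite /E; clear; lia.
have um : (72 * (d * (u * m)) <= n)%N by move: Cm; rewrite /Cu -!mulnA.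
have um1 : (72 * (u * m) <= n)%N.
  by apply: leq_trans um; rewrite leq_mul2l leq_pmull.
pose B := ((n - 3 * u - 17 * (u * m)) %/ m)%N.
have lu : (u <= u * m)%N by rewrite leq_pmulr.
have lm : (m <= u * m)%N by rewrite leq_pmull.
have Blo : (B * m <= n - 3 * u - 17 * (u * m))%N by exact: leq_trunc_div.
have Bhi : (n - 3 * u - 17 * (u * m) < B * m + m)%N.
  by rewrite -mulSnr -ltn_divLR.
have nB1 : (3 * u + B * m + 17 * (u * m) <= n)%N.
  by move: Blo um1 lu; clear; lia.
have nB2 : (n <= 3 * u + B * m + 33 * (u * m))%N.
  by move: Bhi lm; clear; lia.
have BE : (B <= E)%N.
  by rewrite -(leq_pmul2r m0) (leq_trans _ nE) // (leq_trans Blo) //; clear; lia.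
pose b := (m %/ s)%N.
have s0 : (0 < s)%N by rewrite muln_gt0.
have bs : (b * s <= m)%N by exact: leq_trunc_div.
have mb : (m < s * b.+1)%N by rewrite mulnC -ltn_divLR.
pose Q : R := gain R I m b ^+ B / 4 ^+ (u * m.-1) / 16 ^+ u.
have mBn : (m * B <= n)%N by move: nB1; rewrite mulnC; clear; lia.
have a1 : (n <= E * (2 * m))%N by apply: leq_trans nE _; rewrite leq_mul2l leq_pmull ?orbT.
have a2 : (2 * (d * (n - m * B)) <= n)%N.
  apply: leq_trans um; have : (n - m * B <= 36 * (u * m))%N.
    by move: nB2 lu; rewrite [(m * B)%N]mulnC; clear; lia.
  by move=> /(leq_mul (leqnn d)); clear; lia.
have a3 : (4 * d * (b * B) <= n)%N.
  apply: leq_trans mBn; rewrite mulnA leq_mul2r mulnC bs orbT //.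
have a4 : (u * m <= n)%N by move: um1; clear; lia.
have E0 : (0 < E)%N by rewrite muln_gt0.
have [Q0 QB] : 0 < Q /\ n%:R ^+ (d * n) <= n%:R ^+ (2 * n) * Q ^+ d.
  exact: (@lower_arith R I m B b u d E m0 n0 a1 mBn a2 a3 d0 u0 E0 BE a4 Gn).
have np : 0 < n%:R :> R by rewrite ltr0n.
have [x0 _] : exists x, x \in I by apply/card_gt0P.
have I0 : [set: I] != finset.set0 by apply/set0Pn; exists x0; rewrite inE.
pose ss := take u (enum I); pose S := [set t in ss].
have un : (u <= n)%N by apply: leq_trans a4; rewrite leq_pmulr.
have sss : size ss = u by rewrite size_takel // -cardE.
have uss : uniq ss by rewrite take_uniq // enum_uniq.
have cS : #|S| = u by rewrite cardsE (card_uniqP uss).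
pose a : R := gain R I m b ^+ B / 4 ^+ (u * m.-1).
have a0 : 0 < a by move: Q0; rewrite /Q -/a pmulr_lgt0 // invr_gt0 exprn_gt0.
pose K := Num.sqrt a.
have K2 : K ^+ 2 = a by rewrite sqr_sqrtr // ltW.
pose f : R := B%:R * block_fail R m L b + th / 8.
have f0 : 0 <= f.
  by rewrite addr_ge0 ?(ltW th8) // mulr_ge0 // addr_ge0 ?mulr_ge0 ?exprn_ge0 ?divr_ge0 ?invr_ge0.
have dense : expect (fun w => ind (~~ (1 / 2 <= dens w S K u)))
    <= 2 * (f + (u.*2 * (u.*2 + u))%:R / n%:R).
  rewrite -[X in (_ + X)%N]cS; apply: dense_init => // X Y cX cY XY XS YS.
  have eX : [set t in enum X] = X by apply/setP => k; rewrite inE mem_enum.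
  have eY : [set t in enum Y] = Y by apply/setP => k; rewrite inE mem_enum.
  have := Hu1 I (enum X) (enum Y) ss u h L b B u1u; rewrite -!cardE cX cY eX eY -/m.
  move=> /(_ erefl erefl sss) H; apply: le_trans (H _ L0 Lu _); last 2 first.
  - rewrite !cat_uniq uss !enum_uniq andbT /=; apply/andP; split.
      apply/hasPn => k; rewrite mem_cat !mem_enum => /orP[] kX.
        by have := disjointFr XS kX; rewrite inE => ->.
      by have := disjointFr YS kX; rewrite inE => ->.
    by apply/hasPn => k; rewrite !mem_enum => kY; rewrite (disjointFl XY).
  - by rewrite -/n nB1 nB2.
  apply: ler_expect => w; rewrite ler_nat -/a -/S.
  case: (leP K) => //= hK.
  rewrite lt0b -ltNge -K2 -[ltLHS]real_normK ?num_real //.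
  by rewrite ltrXn2r ?nnegrE ?sqrtr_ge0.
apply: le_trans (_ : expect (fun w : {ffun {set I} -> bool} => ind (~~ (K / 4 ^+ u <=
    `|pm (mat R w) finset.set0 finset.set0|))) <= _).
  apply: ler_expect => w; rewrite ler_nat.
  case: (leP (K / 4 ^+ u)) => hK /=; last exact: leq_b1.
  rewrite leqn0 eqb0 negbK; apply: le_trans QB _.
  rewrite ler_wpM2l ?exprn_ge0 ?ler0n // lerXn2r ?nnegrE ?sqr_ge0 ?(ltW Q0) //.
  have -> : Q = (K / 4 ^+ u) ^+ 2.
    rewrite /Q -/a -K2 expr_div_n; congr (_ / _); rewrite -exprM mulnC exprM.
    by congr (_ ^+ _); rewrite -natrX.
  rewrite -[leRHS]real_normK ?num_real // lerXn2r ?nnegrE //.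
  by rewrite divr_ge0 ?sqrtr_ge0 ?exprn_ge0.
apply: le_trans (H1 I ss K n1n sss uss) _; rewrite -/S.
suff : 2 * (f + (u.*2 * (u.*2 + u))%:R / n%:R) <= th / 2 by move: dense; lra.
have bf : B%:R * block_fail R m L b <= 3 * (E * E)%:R / n%:R.
  apply: le_trans (_ : E%:R * (3 / m%:R) <= _).
    apply: ler_pM => //; rewrite ?ler_nat //; last exact: block_fail_le.
    by rewrite addr_ge0 ?mulr_ge0 ?exprn_ge0 ?divr_ge0 ?invr_ge0.
  have mp : 0 < m%:R :> R by rewrite ltr0n.
  rewrite ler_pdivlMr // mulrA [_ * 3]mulrC mulrAC ler_pdivrMr // natrM -!mulrA.
  by rewrite ler_pM2l // ler_wpM2l ?ler0n // -natrM ler_nat.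
have : (2 * (u.*2 * (u.*2 + u))%:R + 6 * (E * E)%:R) / n%:R <= th / 4.
  apply: le_trans Hn2; rewrite ler_wpM2l ?addr_ge0 ?mulr_ge0 ?ler0n //.
  by rewrite lef_pV2 ?posrE ?ltr0n // ler_nat.
rewrite /f !mulrDl; move: bf; rewrite -!mulrA.
by set x := _%:R / _; set y := _%:R / _; move: (x) (y) => {}x {}y; lra.
Qed.

(** * The second moment *)

Section SecondMoment.
Context (R : realFieldType) (I : finType).
Local Notation Omega := {ffun {set I} -> bool}.
Implicit Types (w : Omega) (X Y A B : {set I}) (k l m p t : I) (x : {ffun I -> bool}).

Lemma expect_odd (f : {ffun I -> bool} -> R) i :
  (forall x, f (flip i x) = - f x) -> expect f = 0.
Proof.
move=> fN; have := @expect_flip R I i f.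
rewrite [X in _ = X](_ : _ = 0) // -[RHS](@expect_cst R I); apply: eq_expect => x.
by rewrite fN subrr mul0r.
Qed.

Lemma sg_flip i k x : sg R (flip i x k) = (if k == i then - sg R (x k) else sg R (x k)).
Proof. by rewrite ffunE eq_sym; case: eqP; rewrite ?addTb ?addFb ?sgN. Qed.

Lemma expect_sg2 k m : expect (fun x => sg R (x k) * sg R (x m)) = (k == m)%:R :> R.
Proof.
have [->|km] := eqVneq k m.
  by rewrite -[RHS](@expect_cst R I); apply: eq_expect => x; rewrite sgK.
by apply: (@expect_odd _ k) => x; rewrite !sg_flip eqxx eq_sym (negbTE km) mulNr.
Qed.

Lemma expect_sg4 (a : R) k m l p :
  a * expect (fun x => sg R (x k) * sg R (x m) * (sg R (x l) * sg R (x p)))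
  <= `|a| * (ind ((k == m) && (l == p)) + ind ((k == l) && (m == p)) + ind ((k == p) && (m == l))).
Proof.
set f := fun x => _.
pose c := [|| (k == m) && (l == p), (k == l) && (m == p) | (k == p) && (m == l)].
apply: le_trans (_ : `|a| * c%:R <= _); last first.
  by rewrite ler_wpM2l // -!natrD ler_nat /c; do 3!case: (_ && _).
have [_|] := boolP c.
  rewrite -expectZ; apply: expect_le => x; apply: le_trans (ler_norm _) _.
  by rewrite !normrM !sg_norm !mulr1.
rewrite /c !negb_or !negb_and => /and3P[c1 c2 c3].
have odd1 i : [/\ i = k, i != m, i != l & i != p] \/ [/\ i != k, i = m, i != l & i != p]
    \/ [/\ i != k, i != m, i = l & i != p] \/ [/\ i != k, i != m, i != l & i = p] -> expect f = 0.
  move=> once; apply: (@expect_odd _ i) => x; rewrite /f !sg_flip ![_ == i]eq_sym.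
  case: once => [[-> /negbTE-> /negbTE-> /negbTE->]|].
    by rewrite eqxx; ring.
  case=> [[/negbTE-> -> /negbTE-> /negbTE->]|]; first by rewrite eqxx; ring.
  case=> [[/negbTE-> /negbTE-> -> /negbTE->]|]; first by rewrite eqxx; ring.
  by case=> /negbTE-> /negbTE-> /negbTE-> ->; rewrite eqxx; ring.
suff -> : expect f = 0 by rewrite mulr0 mulr_ge0.
have sym (i j : I) : i != j -> j != i by rewrite eq_sym.
case: (eqVneq k m) => [e|km]; [subst m; rewrite eqxx /= in c1|].
  case: (eqVneq l k) => [e|lk]; [subst l|].
    by apply: (odd1 p); do 3!right; split => //; exact: sym.
  by apply: (odd1 l); do 2!right; left.
case: (eqVneq k l) => [e|kl]; [subst l; rewrite eqxx /= in c2|].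
  by apply: (odd1 m); right; left; split => //; exact: sym.
case: (eqVneq k p) => [e|kp]; [subst p; rewrite eqxx /= in c3|].
  by apply: (odd1 m); right; left; split => //; exact: sym.
by apply: (odd1 k); left.
Qed.
Lemma expect_lin2 (P : pred I) (a : I -> R) :
  expect (fun x => (\sum_(m | P m) sg R (x m) * a m) ^+ 2) = \sum_(m | P m) a m ^+ 2.
Proof.
rewrite (@eq_expect _ _ _ (fun x => \sum_(k | P k) \sum_(m | P m)
    (a k * a m) * (sg R (x k) * sg R (x m)))); last first.
  move=> x; rewrite expr2 mulr_suml; apply: eq_bigr => k _; rewrite mulr_sumr.
  by apply: eq_bigr => m _; ring.
rewrite /expect mean_sum; apply: eq_bigr => k Pk; rewrite mean_sum.
rewrite (bigD1 k) //= big1 ?addr0.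
  by rewrite -/(expect _) expectZ expect_sg2 eqxx mulr1 expr2.
move=> m /andP[_ mk]; rewrite -/(expect _) expectZ expect_sg2.
by rewrite eq_sym (negbTE mk) mulr0.
Qed.

(* Among the products of four signs only those whose indices pair off have a
   nonzero mean; AM-GM then leaves the weight n on the diagonal and 2 elsewhere. *)
Lemma expect_bil2 (T : I -> I -> R) :
  expect (fun x => bil T (fun k => sg R (x k)) (fun k => sg R (x k)) ^+ 2)
  <= \sum_(e : I * I) T e.1 e.2 ^+ 2 * (#|I|%:R * ind (e.1 == e.2) + 2).
Proof.
pose S x (e : I * I) := sg R (x e.1) * sg R (x e.2); pose Te (e : I * I) := T e.1 e.2.
pose c (e e' : I * I) : R := ind ((e.1 == e.2) && (e'.1 == e'.2)) + ind (e == e')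
  + ind (e == (e'.2, e'.1)).
rewrite (@eq_expect _ _ _ (fun x => \sum_e \sum_e' (Te e * Te e') * (S x e * S x e'))); last first.
  move=> x; rewrite /bil pair_big /= expr2 mulr_suml; apply: eq_bigr => e _; rewrite mulr_sumr.
  by apply: eq_bigr => e' _; rewrite /S /Te; ring.
rewrite /expect mean_sum.
apply: le_trans (_ : \sum_e \sum_e' (Te e ^+ 2 / 2 * c e e' + Te e' ^+ 2 / 2 * c e' e) <= _).
  apply: ler_sum => e _; rewrite mean_sum; apply: ler_sum => e' _.
  rewrite -/(expect _) expectZ.
  have cC : c e' e = c e e'.
    rewrite /c andbC [e' == e]eq_sym; congr (_ + ind _).
    by case: (e) (e') => [k m] [l p]; rewrite !xpair_eqE /= andbC ![_ == k]eq_sym ![_ == m]eq_sym.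
  apply: le_trans (expect_sg4 _ _ _ _ _) _.
  rewrite cC -mulrDl (_ : _ + _ + _ = c e e'); last first.
    by rewrite /c; case: (e) (e') => [k m] [l p]; rewrite !xpair_eqE.
  rewrite ler_wpM2r // ?addr_ge0 // normrM.
  have := sqr_ge0 (`|Te e| - `|Te e'|).
  rewrite -[Te e ^+ 2]real_normK ?num_real // -[Te e' ^+ 2]real_normK ?num_real //.
  by rewrite sqrrB; lra.
under eq_bigr do rewrite big_split /=.
rewrite big_split /= [X in _ + X]exchange_big /= -big_split /=.
apply: ler_sum => e _; rewrite -mulr_sumr -mulrDr.
have -> : \sum_e' c e e' = #|I|%:R * ind (e.1 == e.2) + 2.
  have once (e0 : I * I) : \sum_e' ind (e0 == e') = 1 :> R.
    by rewrite (bigD1 e0) //= eqxx big1 ?addr0 // => e'; rewrite eq_sym => /negbTE ->.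
  have h3 : \sum_(e' : I * I) ind (e == (e'.2, e'.1)) = 1 :> R.
    rewrite -[RHS](once (e.2, e.1)); apply: eq_bigr => -[l p] _ /=.
    by case: (e) => k m; rewrite !xpair_eqE andbC.
  have h1 : \sum_(e' : I * I) ind ((e.1 == e.2) && (e'.1 == e'.2)) = #|I|%:R * ind (e.1 == e.2) :> R.
    case: (e.1 == e.2); last by rewrite mulr0 big1.
    rewrite mulr1 -natr_sum; congr _%:R.
    rewrite -(pair_big xpredT xpredT (fun l p => nat_of_bool (l == p))) /=.
    rewrite (eq_bigr (fun=> 1%N)) ?sum1_card // => l _.
    by rewrite (bigD1 l) //= eqxx big1 // => p; rewrite eq_sym => /negbTE ->.
  by rewrite /c !big_split /= h1 h3 once -addrA.
by rewrite le_eqVlt; apply/orP; left; apply/eqP; rewrite /Te; field.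
Qed.

End SecondMoment.

Section MinorSecondMoment.
Context (R : realFieldType) (I : finType).
Implicit Types (X Y : {set I}).
Local Notation n := #|I|.

Definition moment X Y : R := expect (fun w => pm (mat R w) X Y ^+ 2).

Lemma moment_row t X Y : t \notin X -> t \in Y ->
  moment X Y = \sum_(m | m \notin Y) moment (t |: X) (m |: Y).
Proof.
move=> tX tY; rewrite /moment -(cexpT _ [ffun=> true]) (@cexp_refresh _ _ _ t setT); last first.
  by move=> m _; rewrite inE.
rewrite cexpT -[RHS]mean_sum; apply: eq_expect => w.
rewrite -expect_lin2; apply: eq_expect => x.
rewrite -[in LHS](setU1K tX) pm_row ?setU11 // /D; congr (_ ^+ 2); apply: eq_bigr => m _.
by rewrite mat_new pm_new ?in_setU1 ?eqxx // tY orbT.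
Qed.

(** From (p + q)^2 <= 2 p^2 + 2 q^2; the weights of [expect_bil2] sum to n^2 + 2 n^2 over all
    pairs. *)
Lemma moment_both t X Y (be : R) : t \notin X -> t \notin Y -> 0 <= be ->
  (forall k m, k \notin t |: X -> m \notin t |: Y -> moment (k |: (t |: X)) (m |: (t |: Y)) <= be) ->
  moment X Y <= 2 * moment (t |: X) (t |: Y) + 6 * n%:R ^+ 2 * be.
Proof.
move=> tX tY be0 hbe; rewrite /moment -(cexpT _ [ffun=> true]) (@cexp_refresh _ _ _ t setT); last first.
  by move=> m _; rewrite inE.
pose A := t |: X; pose B := t |: Y; have tA : t \in A := setU11 _ _; have tB : t \in B := setU11 _ _.
pose T w k m : R := if (k \notin A) && (m \notin B) then pm (mat R w) (k |: A) (m |: B) else 0.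
pose wt (e : I * I) : R := n%:R * ind (e.1 == e.2) + 2.
have wt0 e : 0 <= wt e by rewrite addr_ge0 ?mulr_ge0.
rewrite cexpT; apply: le_trans (_ : expect (fun w => 2 * pm (mat R w) A B ^+ 2
  + 2 * \sum_(e : I * I) T w e.1 e.2 ^+ 2 * wt e) <= _).
  apply: ler_expect => w.
  apply: le_trans (_ : expect (fun x => 2 * pm (mat R w) A B ^+ 2
    + 2 * bil (T w) (fun k => sg R (x k)) (fun k => sg R (x k)) ^+ 2) <= _).
    apply: ler_expect => x; rewrite -(setU1K tX) -(setU1K tY) -/A -/B pm_new_both //.
    rewrite -/(T w); set q := bil _ _ _; set p := pm _ _ _.
    have -> : p ^+ 2 = (sg R (x t) * p) ^+ 2 by rewrite [RHS]exprMn [sg _ _ ^+ 2]expr2 sgK mul1r.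
    have := sqr_ge0 (sg R (x t) * p - q); rewrite sqrrB sqrrD; lra.
  rewrite expectD expect_cst expectZ lerD2l ler_pM2l //; exact: expect_bil2.
rewrite expectD !expectZ lerD2l.
have -> : 6 * n%:R ^+ 2 * be = 2 * (be * (3 * n%:R ^+ 2)) by ring.
rewrite ler_pM2l // /expect mean_sum.
apply: le_trans (_ : \sum_(e : I * I) be * wt e <= _).
  apply: ler_sum => e _; rewrite -/(expect _) expectZr ler_wpM2r // /T.
  have [/andP[kA mB]|_] := boolP ((e.1 \notin A) && (e.2 \notin B)); first exact: hbe.
  by apply: expect_le => w; rewrite expr0n.
rewrite -mulr_sumr ler_wpM2l // big_split /=.
rewrite sumr_const card_prod -mulr_sumr -natr_sum.
rewrite -(pair_big xpredT xpredT (fun l p => nat_of_bool (l == p))) /=.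
rewrite (eq_bigr (fun=> 1%N)) ?sum1_card => [|l _]; last first.
  by rewrite (bigD1 l) //= eqxx big1 // => p; rewrite eq_sym => /negbTE ->.
rewrite -[2 *+ _]mulr_natr natrM -[#|xpredT|]/#|I| expr2; lra.
Qed.

(** The base z = 6 n closes both recursions: n z^(N-1) <= z^N when column t is already removed, and
    2 z^(N-1) + 6 n^2 z^(N-2) <= z^N otherwise. *)
Lemma moment_le N X Y : (n - #|X|)%N = N -> moment X Y <= (6 * n%:R) ^+ N.
Proof.
elim/ltn_ind: N X Y => N IH X Y cX.
have c6 k : 0 <= (6 * n%:R) ^+ k :> R by rewrite exprn_ge0 // mulr_ge0.
have [XT|] := eqVneq X setT.
  have N0 : N = 0%N by rewrite -cX XT cardsT subnn.
  rewrite N0 expr0; apply: expect_le => w; rewrite XT.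
  have [->|YT] := eqVneq Y setT; first by rewrite pm_full expr1n.
  suff -> : pm (mat R w) setT Y = 0 by rewrite expr0n.
  apply/eqP; apply: contraT => /pm_homog cY; case/eqP: YT; apply/eqP.
  by rewrite eqEcard subsetT cardsT /= cY cardsT.
rewrite -properT => /properP[_ [t _ tX]].
have n0 : (0 < n)%N by apply/card_gt0P; exists t.
have cX1 : (#|X| < n)%N.
  by have := max_card (t |: X); rewrite cardsU1 tX.
have np : 1 <= n%:R :> R by rewrite ler1n.
have ctX : (n - #|t |: X|)%N = N.-1 by rewrite cardsU1 tX; move: cX; clear; lia.
have NS : N = N.-1.+1 by move: cX cX1; clear; lia.
have [tY|tY] := boolP (t \in Y).
  rewrite (moment_row tX tY); apply: le_trans (_ : \sum_(m : I) (6 * n%:R) ^+ N.-1 <= _).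
    rewrite [leLHS]big_mkcond; apply: ler_sum => m _; case: ifP => // _.
    by apply: IH => //; rewrite [X in (_ < X)%N]NS.
  rewrite sumr_const -[leLHS]mulr_natl [X in _ <= _ ^+ X]NS exprS ler_wpM2r //.
  by rewrite ler_peMl ?ler1n.
pose z : R := 6 * n%:R; have z0 : 0 < z by rewrite mulr_gt0 // ltr0n.
have h1 : moment (t |: X) (t |: Y) <= z ^+ N / z.
  rewrite [X in _ ^+ X]NS exprS mulrAC divff ?mul1r ?gt_eqF //.
  by apply: IH => //; rewrite [X in (_ < X)%N]NS.
have be0 : 0 <= z ^+ N / z ^+ 2 by rewrite divr_ge0 // exprn_ge0 // ltW.
apply: le_trans (moment_both tX tY be0 _) _.
  move=> k m ktX mtY; have ck : (n - #|k |: (t |: X)|)%N = N.-2.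
    by rewrite cardsU1 ktX; move: ctX; clear; lia.
  have N2 : N = N.-2.+2.
    have := max_card (k |: (t |: X)); rewrite cardsU1 ktX; move: ctX NS; clear; lia.
  rewrite [X in _ ^+ X / _]N2 -addn2 exprD mulfK ?gt_eqF ?exprn_gt0 //.
  by apply: IH => //; rewrite [X in (_ < X)%N]N2.
have zN := c6 N; rewrite -/z in zN.
have zz (y : R) : 6 * n%:R ^+ 2 * (y / z ^+ 2) = y / 6.
  by rewrite /z; field; rewrite pnatr_eq0 -lt0n.
rewrite zz.
have : z ^+ N / z <= z ^+ N / 6.
  by rewrite ler_wpM2l // lef_pV2 ?posrE // /z; lra.
by move: h1; lra.
Qed.

End MinorSecondMoment.

(** Comparing with (12 n)^n makes Markov's failure probability 2^-n, and 12^(d n) <= n^n once n >=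
    12^d. *)
Lemma permanent_upper (R : archiRealFieldType) (d : nat) (th : R) : 0 < th ->
  exists n0 : nat, forall I : finType, (n0 <= #|I|)%N ->
    expect (fun w : {ffun {set I} -> bool} => ind (~~
      ((pm (mat R w) finset.set0 finset.set0 ^+ 2) ^+ d <= #|I|%:R ^+ (d.+1 * #|I|)))) <= th.
Proof.
move=> th0; have h0 : 0 <= 2^-1 :> R by rewrite invr_ge0.
have h1 : 2^-1 < 1 :> R by lra.
have [n1 Hn1] := ex_expr_le h0 h1 th0.
exists (maxn n1 (maxn 1 (12 ^ d))) => I; set n := #|I|; rewrite !geq_max => /and3P[n1n n0 dn].
have np : 0 < n%:R :> R by rewrite ltr0n.
pose c : R := (12 * n%:R) ^+ n; have c0 : 0 < c by rewrite exprn_gt0 // mulr_gt0.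
apply: le_trans (_ : expect (fun w : {ffun {set I} -> bool} =>
   ind (c <= pm (mat R w) finset.set0 finset.set0 ^+ 2)) <= _).
  apply: ler_expect => w; rewrite ler_nat; case: (leP c) => [_|hc]; first exact: leq_b1.
  rewrite leqn0 eqb0 negbK; apply: le_trans (_ : c ^+ d <= _).
    by rewrite lerXn2r ?nnegrE ?sqr_ge0 ?(ltW c0) // ltW.
  rewrite /c -exprM mulnC exprMn mulSn exprD ler_wpM2r ?exprn_ge0 ?ler0n //.
  by rewrite exprM lerXn2r ?nnegrE ?exprn_ge0 ?ler0n // -natrX ler_nat.
apply: le_trans (mean_markov c0 _) _ => [w _|]; first exact: sqr_ge0.
rewrite -/(expect _) ler_pdivrMr //; apply: le_trans (@moment_le R I n _ _ _) _.
  by rewrite cards0 subn0.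
have -> : (6 * n%:R) ^+ n = 2^-1 ^+ n * c.
  by rewrite /c -exprMn; congr (_ ^+ _); field.
rewrite ler_wpM2r ?(ltW c0) //; apply: le_trans Hn1.
by rewrite ler_wiXn2l // ltW.
Qed.

From mathcomp Require Import all_classical all_reals all_analysis.
Import numFieldNormedType.Exports.
Local Open Scope classical_set_scope.
Local Open Scope ring_scope.

(** * From sign patterns to the random matrix *)

Section Patterns.
Context (R : realFieldType) (J : finType) (E : {set J}).
Implicit Types (w c : {ffun J -> bool}) (F : {ffun J -> bool} -> R).

(** Clearing the bits outside E selects one representative for each assignment of bits on E. *)
Definition restr w : {ffun J -> bool} := [ffun p => (p \in E) && w p].
Definition patterns := [set w | restr w == w]%SET.

Lemma expect_patterns F : (forall w, F (restr w) = F w) -> expect F = mean patterns F.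
Proof.
move=> FE; pose xr c w : {ffun J -> bool} := [ffun p => c p (+) w p].
have xrK c : involutive (xr c) by move=> w; apply/ffunP => p; rewrite !ffunE addbA addbb.
have rr w : restr (restr w) = restr w.
  by apply/ffunP => p; rewrite !ffunE andbA andbb.
have C0 : patterns != finset.set0.
  by apply/set0Pn; exists (restr [ffun=> true]); rewrite inE rr.
rewrite -[LHS](mean_cst _ C0).
transitivity (mean patterns (fun c => expect (fun w => F (xr c w)))).
  by apply: eq_mean => c _; exact: expect_reindex.
rewrite /expect mean_exchange -[RHS](@expect_cst R J); apply: eq_mean => w _.
transitivity (mean patterns (fun c => F (xr (restr w) c))).
  apply: eq_mean => c; rewrite inE => /eqP cE; rewrite -FE -[RHS]FE; congr F.
  rewrite -cE; apply/ffunP => p; rewrite !ffunE.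
  by case: (p \in E) => //=; rewrite addbC.
rewrite /mean; congr (_ / _); rewrite [RHS](reindex_inj (inv_inj (xrK (restr w)))) /=.
apply: eq_bigl => c; rewrite !inE; apply/eqP/eqP => [cE|xE].
  rewrite -cE; apply/ffunP => p; rewrite !ffunE.
  by case: (p \in E).
apply/ffunP => p; have /ffunP/(_ p) := xE; rewrite !ffunE.
by case: (p \in E) => //= /addbI.
Qed.

Lemma card_patterns : #|patterns| = (2 ^ #|E|)%N.
Proof.
rewrite -card_bool -(card_pffun_on false E {:bool}); apply: eq_card => w.
rewrite inE; apply/eqP/pffun_onP => [wE|[sw _]].
  split=> [|//]; apply/fintype.subsetP => p; rewrite inE -wE ffunE.
  by case: (p \in E).
apply/ffunP => p; rewrite ffunE; case: (boolP (p \in E)) => //= pE.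
by apply/esym/negbTE; apply: contra pE => wp; apply: (fintype.subsetP sw); rewrite inE wp.
Qed.

End Patterns.

Lemma le_measure_sum d (T : measurableType d) (R : realType) (P : probability T R)
    (J : eqType) (s : seq J) (F : J -> set T) (A : set T) :
  uniq s -> measurable A -> (forall c, measurable (F c)) ->
  {in s &, forall c c' : J, c != c' -> F c `&` F c' = set0} ->
  (forall c, c \in s -> F c `<=` A) ->
  (\sum_(c <- s) P (F c) <= P A)%E.
Proof.
elim: s A => [|c s IH] A /=; first by move=> *; rewrite big_nil measure_ge0.
move=> /andP[cs us] mA mF dF sA; rewrite big_cons.
have FcA : F c `<=` A by apply: sA; rewrite mem_head.
rewrite (measureDI P mA (mF c)) (setIidr FcA) addeC leeD2r //.
apply: IH => //; first exact: measurableD.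
  by move=> x y xs ys; apply: dF; rewrite inE ?xs ?ys orbT.
move=> c' c's w Fw; split; first by apply: (sA c') => //; rewrite inE c's orbT.
move=> Fcw; have cc' : c != c' by apply: contraNneq cs => ->.
by have : (F c `&` F c') w by []; rewrite dF // ?mem_head // inE c's orbT.
Qed.

Section Transfer.
Context d (T : measurableType d) (R : realType) (P : probability T R) (n : nat).
Context (M : 'M[{RV P >-> R}]_n) (hM : symmetric_rademacher_matrix M).
Local Notation I := ('I_n).

Definition upper : {set I * I} := [set p : I * I | (p.1 <= p.2)%N]%SET.
Definition edges : {set {set I}} := [set [set p.1; p.2]%SET | p in upper]%SET.

Lemma edge_in (i j : I) : [set i; j]%SET \in edges.
Proof.
apply/imsetP; case: (leqP i j) => [ij|/ltnW ji]; first by exists (i, j); rewrite ?inE.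
by exists (j, i); rewrite ?inE //= finset.setUC.
Qed.

Lemma card_edges : #|edges| = #|upper|.
Proof.
apply: card_in_imset => -[i j] [k l]; rewrite !inE /= => ij kl e.
have := set21 i j; have := set22 i j; rewrite e !inE.
have := set21 k l; have := set22 k l; rewrite -e !inE -!val_eqE /= => h1 h2 h3 h4.
by apply/eqP; rewrite xpair_eqE -!val_eqE /=; move: ij kl h1 h2 h3 h4; clear; lia.
Qed.

Definition event_of (c : {ffun {set I} -> bool}) : set T :=
  [set w | forall p, p \in upper -> M p.1 p.2 w = mat R c p.1 p.2].

Lemma event_measurable c : measurable (event_of c).
Proof.
rewrite (_ : event_of c = \bigcap_(p in [set` upper]) (M p.1 p.2 @^-1` [set mat R c p.1 p.2])) //.
exact: fin_bigcap_measurable.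
Qed.

Lemma event_probability c : P (event_of c) = (2^-1 ^+ #|upper|)%:E.
Proof.
case: hM => _ rad indep.
have := indep upper (fun p => [set mat R c p.1 p.2]) (fintype.subxx _) (fun _ _ => measurable_set1 _).
rewrite -[X in P X]/(event_of c) => ->.
rewrite (eq_bigr (fun=> (2^-1 : R)%:E)).
  by rewrite prodEFin prodr_const.
move=> p; rewrite inE => /rad[p1 pN1]; rewrite /mat /sg.
by case: (c _); rewrite ?expr1 ?expr0.
Qed.

(** An inequality, because [rademacher] prescribes only the two atoms and the entries may take other
    values on a null set. The disjoint events [event_of c] with Q true already carry the mass, and a
    lower bound suffices for a limit equal to 1. *)
Lemma transfer (Q : (I -> I -> R) -> bool) (A : set T) : measurable A ->
  (forall w (N : I -> I -> R), (forall i j, M i j w = N i j) -> Q N -> A w) ->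
  ((expect (fun w => ind (Q (mat R w))))%:E <= P A)%E.
Proof.
move=> mA QA; have [sym _ _] := hM.
pose G w := Q (mat R w); have matE w : mat R (restr edges w) = mat R w.
  by apply: funext => i; apply: funext => j; rewrite /mat ffunE edge_in.
rewrite (@expect_patterns _ _ edges); last by move=> w; rewrite matE.
pose C := patterns edges; pose s := enum [set c in C | G c]%SET.
have -> : mean C (fun c => ind (Q (mat R c))) = (size s)%:R * 2^-1 ^+ #|upper| :> R.
  rewrite /mean card_patterns card_edges natrX exprVn; congr (_ / _).
  rewrite -natr_sum -cardE -sum1_card; congr _%:R.
  rewrite [RHS]big_mkcond [LHS]big_mkcond; apply: eq_bigr => c _.
  by rewrite -/(G c) [X in _ = if X then _ else _]inE; case: (c \in C); case: (G c).
have -> : ((size s)%:R * 2^-1 ^+ #|upper|)%:E = (\sum_(c <- s) P (event_of c))%E.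
  rewrite (eq_bigr (fun=> (2^-1 ^+ #|upper|)%:E)) => [|c _]; last exact: event_probability.
  by rewrite sumEFin big_const_seq count_predT iter_addr addr0 mulr_natl.
apply: le_measure_sum => //; first exact: enum_uniq.
- exact: event_measurable.
- move=> c c'; rewrite !mem_enum !inE => /andP[/eqP cE _] /andP[/eqP cE' _].
  apply: contra_neqP => /eqP/set0P[w [h h']].
  rewrite -cE -cE'; apply/ffunP => p; rewrite !ffunE; case: (boolP (p \in edges)) => //=.
  move=> /imsetP[q qU ->]; have := h' q qU; rewrite h // /mat /sg.
  by do 2!case: (_ [set _; _]%SET) => //; rewrite ?expr0 ?expr1; lra.
move=> c; rewrite mem_enum !inE => /andP[_ Gc] w h.
apply: (QA w (mat R c)) => // i j.
case: (leqP i j) => [ij|/ltnW ji]; first by apply: (h (i, j)); rewrite inE.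
by rewrite sym matC; apply: (h (j, i)); rewrite inE.
Qed.

End Transfer.

(** The power 2 d clears the real exponents. The hypotheses give the exponents n/2 - n/d and n/2 +
    n/(2 d), and 1 / d <= eps. *)
Lemma powR_bounds (R : realType) (n d : nat) (eps x : R) :
  (0 < n)%N -> (0 < d)%N -> eps^-1 <= d%:R -> 0 < eps -> 0 <= x ->
  n%:R ^+ (d * n) <= n%:R ^+ (2 * n) * (x ^+ 2) ^+ d ->
  (x ^+ 2) ^+ d <= n%:R ^+ (d.+1 * n) ->
  n%:R `^ (n%:R / 2 - eps * n%:R) <= x <= n%:R `^ (n%:R / 2 + eps * n%:R).
Proof.
move=> n0 d0 ed e0 x0 lo hi.
have np : 0 < n%:R :> R by rewrite ltr0n.
have n1 : 1 <= n%:R :> R by rewrite ler1n.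
have dp : 0 < d%:R :> R by rewrite ltr0n.
have dn0 : (0 < 2 * d)%N by rewrite muln_gt0.
have nd : n%:R / d%:R <= eps * n%:R :> R.
  by rewrite mulrC ler_wpM2r ?ler0n // -[eps]invrK lef_pV2 ?posrE ?invr_gt0.
have pw (y : R) : (n%:R `^ y) ^+ (2 * d) = n%:R `^ (y * (2 * d)%:R).
  by rewrite -powR_mulrn ?powR_ge0 // powRrM.
have pn k : n%:R ^+ k = n%:R `^ k%:R :> R by rewrite powR_mulrn // ler0n.
have nz y : (y == 0) ==> (n%:R != 0 :> R) by rewrite gt_eqF ?implybT.
rewrite -exprM in lo hi; apply/andP; split.
  apply: le_trans (_ : n%:R `^ (n%:R / 2 - n%:R / d%:R) <= _).
    by apply: ler_powR => //; rewrite lerD2l lerN2.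
  rewrite -(ler_pXn2r dn0) ?nnegrE ?powR_ge0 // pw.
  rewrite -(ler_pM2l (exprn_gt0 (2 * n) np)); apply: le_trans lo.
  rewrite !pn -powRD ?nz // (_ : _ + _ = (d * n)%:R) // !natrM.
  by field; rewrite gt_eqF.
apply: (@le_trans _ _ (n%:R `^ (n%:R / 2 + n%:R / d%:R))); last first.
  by apply: ler_powR => //; rewrite lerD2l.
rewrite -(ler_pXn2r dn0) ?nnegrE ?powR_ge0 // pw; apply: le_trans hi _.
rewrite pn; apply: ler_powR => //.
have -> : (n%:R / 2 + n%:R / d%:R) * (2 * d)%:R = (d * n + 2 * n)%:R :> R.
  by rewrite natrD !natrM; field; rewrite gt_eqF.
by rewrite ler_nat; clear; lia.
Qed.

Section Event.
Context d (T : measurableType d) (R : realType) (P : probability T R) (n : nat).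
Context (M : 'M[{RV P >-> R}]_n).

Lemma permanent_measurable : measurable_fun setT (fun w => permanent (realization M w)).
Proof.
apply: measurable_sum => s; apply: measurable_prod => i _.
under eq_fun do rewrite mxE.
exact: measurable_funP.
Qed.

Lemma permanent_event_measurable (lo hi : R) :
  measurable [set w | lo <= `|permanent (realization M w)| <= hi].
Proof.
have := measurableT_comp (@measurable_realfun.normr_measurable R setT) permanent_measurable.
move=> /(_ measurableT [set` `[lo, hi]] (measurable_itv _)); rewrite setTI.
by congr (measurable _); apply/seteqP; split => w /=; rewrite in_itv.
Qed.

Lemma permanent_probability (hM : symmetric_rademacher_matrix M) (k : nat) (eps th : R) :
  (0 < n)%N -> (0 < k)%N -> eps^-1 <= k%:R -> 0 < eps ->
  expect (fun w : {ffun {set 'I_n} -> bool} => ind (~~ (n%:R ^+ (k * n)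
    <= n%:R ^+ (2 * n) * (pm (mat R w) finset.set0 finset.set0 ^+ 2) ^+ k))) <= th / 2 ->
  expect (fun w : {ffun {set 'I_n} -> bool} => ind (~~
    ((pm (mat R w) finset.set0 finset.set0 ^+ 2) ^+ k <= n%:R ^+ (k.+1 * n)))) <= th / 2 ->
  ((1 - th)%:E <= P [set w | (n%:R `^ (n%:R / 2 - eps * n%:R)
     <= `|permanent (realization M w)| <= n%:R `^ (n%:R / 2 + eps * n%:R))%R])%E.
Proof.
move=> n0 k0 ek e0 lo hi.
pose Q (N : 'I_n -> 'I_n -> R) :=
  (n%:R ^+ (k * n) <= n%:R ^+ (2 * n) * (pm N finset.set0 finset.set0 ^+ 2) ^+ k)
  && ((pm N finset.set0 finset.set0 ^+ 2) ^+ k <= n%:R ^+ (k.+1 * n)).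
apply: le_trans (@transfer _ T R P n M hM Q _ (permanent_event_measurable _ _) _).
  rewrite lee_fin; move: lo hi; rewrite !expect_compl => lo hi.
  suff : expect (fun w => ind (~~ Q (mat R w))) <= th by rewrite expect_compl; lra.
  rewrite -!expect_compl in lo hi.
  apply: le_trans (_ : th / 2 + th / 2 <= _); last by rewrite -splitr.
  apply: le_trans (lerD lo hi); rewrite -expectD; apply: ler_expect => w.
  by rewrite -natrD ler_nat /Q; do 2!case: (_ <= _).
move=> w N MN /andP[lo' hi'] /=.
have -> : permanent (realization M w) = pm N finset.set0 finset.set0.
  by rewrite pm_empty; apply: eq_bigr => s _; apply: eq_bigr => i _; rewrite mxE MN.
by apply: (@powR_bounds R n k) => //; rewrite real_normK ?num_real.
Qed.

End Event.

Theorem theorem1p1 (R : realType) (d : nat -> measure_display)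
    (T : forall n : nat, measurableType (d n))
    (P : forall n : nat, probability (T n) R)
    (M : forall n : nat, 'M[{RV (P n) >-> R}]_n)
    (hM : forall n : nat, symmetric_rademacher_matrix (M n))
    (eps : R) (heps : 0 < eps) :
  P n [set w : T n |
        n%:R `^ (n%:R / 2 - eps * n%:R)
          <= `|permanent (realization (M n) w)|
          <= n%:R `^ (n%:R / 2 + eps * n%:R)] @[n --> \oo] --> 1%E.
Proof.
have mA n := permanent_event_measurable (M n) (n%:R `^ (n%:R / 2 - eps * n%:R))
  (n%:R `^ (n%:R / 2 + eps * n%:R)).
have fin n := fin_num_measure (P n) _ (mA n).
apply: cvg_EFin; first by near=> n; exact: fin.
apply/cvgrPdist_le => e e0.
have [k k0 ek] := ex_nat_ge eps^-1.
have e2 : 0 < e / 2 by rewrite divr_gt0.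
have [n1 H1] := permanent_lower k0 e2.
have [n2 H2] := permanent_upper k e2.
exists (maxn 1 (maxn n1 n2)) => // n; rewrite /= !geq_max => /and3P[n0 n1n n2n].
have := @permanent_probability _ _ R (P n) n (M n) (hM n) k eps e n0 k0 ek heps.
have lo := H1 'I_n; have hi := H2 'I_n; rewrite card_ord in lo hi.
move=> /(_ (lo n1n) (hi n2n)); set A := [set _ | _] => PA.
have := @probability_le1 _ _ _ (P n) A (mA n).
rewrite -[P n A in X in X -> _]fineK; last exact: fin.
have := fineK (fin n); rewrite -/A /= => E; rewrite -E lee_fin in PA; rewrite -E lee_fin => le1.
by rewrite ler_norml; move: PA le1; lra.
Unshelve. all: by end_near. Qed.
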